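(* Let $p>2$ be prime. For $t\in\mathbb{Z}/p\mathbb{Z}$ put $a_t(p) = -\sum_{x \bmod p}\left(\frac{x^3+tx^2+1}{p}\right)$, and let $A_{2}(p)=\sum_{t \bmod p} a_t(p)^2$. Let $n_{3,2,p}$ denote the number of solutions $x\in\mathbb{Z}/p\mathbb{Z}$ of $x^3\equiv 2 \pmod p$. Then \[ A_{2}(p) \;=\; p^2 - n_{3,2,p}\,p - 1 + p\sum_{x \bmod p}\left(\frac{4x^3+1}{p}\right). \] Moreover, for any real numbers $-2\le a<b\le 2$ there are infinitely many primes $p\equiv 1 \pmod 3$ such that \[ A_{2}(p) - \left(p^2 - n_{3,2,p}\,p - 1\right) \in \left[a\,p^{3/2},\, b\,p^{3/2}\right]. \]
   Context: $\left(\frac{\cdot}{p}\right)$ is the Legendre symbol (equal to $0$ at multiples of $p$). The quantity $a_t(p)$ is $p$ minus the number of affine solutions modulo $p$ of $y^2=x^3+tx^2+1$, i.e. the $p$-th coefficient for the member $E_t$ of the one-parameter family $y^2=x^3+Tx^2+1$ over $\mathbb{Q}(T)$. *)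

(* Defs.v *)
From HB Require Import structures.
From mathcomp Require Import all_boot all_order all_algebra.
From mathcomp Require Import reals.
Set Implicit Arguments. Unset Strict Implicit. Unset Printing Implicit Defensive.
Import Order.TTheory GRing.Theory Num.Theory.
Local Open Scope ring_scope.

Definition legendre (p : nat) (a : int) : int :=
  if (p%:Z %| a)%Z then 0
  else if [exists x : 'I_p, (p%:Z %| (x%:Z) ^+ 2 - a)%Z] then 1 else -1.

Definition a_t (p : nat) (t : int) : int :=
  - \sum_(x < p) legendre p ((x%:Z) ^+ 3 + t * (x%:Z) ^+ 2 + 1).

Definition A2 (p : nat) : int := \sum_(t < p) (a_t p t%:Z) ^+ 2.

Definition n32 (p : nat) : nat :=
  #|[pred x : 'I_p | (p%:Z %| (x%:Z) ^+ 3 - 2)%Z]|.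

(* Main.v *)
Require Import Defs.
From HB Require Import structures.
From mathcomp Require Import all_boot all_order all_algebra.
From mathcomp Require Import cyclic finfield reals.
From mathcomp Require Import ring lra zify boolp classical_sets sequences exp complex.
Set Implicit Arguments. Unset Strict Implicit. Unset Printing Implicit Defensive.
Import Order.TTheory GRing.Theory Num.Theory.
Local Open Scope ring_scope.

(* The second moment is computed by summing over t first: for x, y <> 0 the
   inner sum is p [u(x) = u(y)] - 1 with u(x) = (x^3 + 1) / x^2, and
   u(x) = u(y) means x = y or x^2 y^2 = x + y, a quadratic equation in y of
   discriminant 4 x^3 + 1 up to squares.

   For p = 1 mod 3, the sum of the Legendre symbols of 4 x^3 + 1 is J + conj J,
   where J is the Jacobi sum of the cubic character attached to a prime pi of
   Z[omega] above p; since pi divides J, N J = p and J = -1 mod 3, taking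
   pi = 1 mod 3 gives J = - pi.  It remains to find primes pi = 1 mod 3 in
   every sector (Hecke).  Let lam_k(x) = (x / |x|)^k on elements congruent to
   1 mod 3, and a_k(n) its sum over the elements of norm n.  Multiplying by
   elements of norm g^2, resp. by two elements of norm 7 with distinct
   lam_k-values, shows that the partial sums of a_k are c [k = 0] x + O(sqrt x)
   with c > 0.  Shapiro's method, in which the inverse of a_k for Dirichlet
   convolution is bounded by a_0, then yields that the sum of
   Lambda lam_k / N over norms up to x is eps_k log x + O(1), with eps_0 = 1 and
   eps_k = 0 or -1 for k > 0; the value -1 is excluded by
   3 + 4 cos t + cos 2t >= 0.  Finally |u + z|^(2n) has mean binomial(2n, n) over
   the unit circle, which exceeds its supremum over the complement of a given
   neighbourhood of z for large n, so that infinitely many primes fall in the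
   corresponding sector. *)

(** * Quadratic characters and the second moment *)

(** An element of Z[omega] prime to 3 has exactly one associate congruent to 1 mod 3. These elements
    therefore stand for the ideals prime to 3, and every power of x / |x| becomes multiplicative on
    such ideals. The character sum equals - 2 Re pi, that is - 2 sqrt p times the cosine of the
    angle of pi, so that an interval for the second moment becomes a sector for pi. Since only
    infinitely many primes are claimed, sums weighted by 1 / N with bounded error suffice: higher
    prime powers, inert primes and primes of norm at most N contribute O(1) together, while the
    kernel |u + z|^(2n), a finite combination of the lam_k, contributes a positive multiple of log
    x. Remainders are measured in powers of x^(1/4): log x <= 4 x^(1/4) absorbs the logarithms, and
    a saving of (N / i)^(-1/4) makes the sum over i, with weights a_0(i) / i, bounded. The two
    elements of norm 7 are 1 + 3 omega and its conjugate. No positive power of one equals the same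
    power of the other, so they separate every lam_k with k > 0 from the trivial character. *)

Section PrimeField.
Variable p : nat.
Hypotheses (pp : prime p) (p2 : (2 < p)%N).
Local Notation F := 'F_p.

Lemma Fp_intr_eq0 (a : int) : ((a%:~R : F) == 0) = (p%:Z %| a)%Z.
Proof.
have H n : ((n%:R : F) == 0) = (p %| n)%N by rewrite (dvdn_pcharf (pchar_Fp pp)).
case: a => n; first by rewrite -pmulrn H.
by rewrite NegzE rmorphN oppr_eq0 /= dvdzE abszN -pmulrn H.
Qed.

(** The carrier of ['F_p] is an ordinal type whose bound equals [p] only propositionally, by
    [Fp_cast]; hence the reindexing along [cast_ord]. *)
Lemma sum_Fp (V : nmodType) (f : F -> V) :
  \sum_(x < p) f (x%:Z)%:~R = \sum_x f x.
Proof.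
have e := Fp_cast pp.
rewrite [RHS](reindex (cast_ord (esym e))) /=; last first.
  by exists (cast_ord e) => x _; apply: val_inj.
apply: eq_bigr => x _; congr f; apply: val_inj.
by rewrite -pmulrn /= val_Fp_nat // modn_small.
Qed.

Definition eta (x : F) : int :=
  if x == 0 then 0 else if [exists y, y ^+ 2 == x] then 1 else -1.

Lemma legendreE (a : int) : legendre p a = eta a%:~R.
Proof.
rewrite /legendre /eta Fp_intr_eq0; case: ifP => // _.
congr (if _ then _ else _); apply/existsP/existsP => [[x]|[y /eqP e]].
  rewrite -Fp_intr_eq0 rmorphB rmorphXn subr_eq0 => h; by exists (x%:Z)%:~R.
have ly : (y < p)%N by rewrite -[X in (_ < X)%N](Fp_cast pp).
exists (Ordinal ly); rewrite -Fp_intr_eq0 rmorphB rmorphXn subr_eq0 /=.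
have -> : (y%:Z%:~R : F) = y; last by rewrite e.
by apply: val_inj; rewrite -pmulrn /= val_Fp_nat // modn_small.
Qed.

Lemma two_neq0 : 2 != 0 :> F.
Proof. by rewrite -[2]/(2%:R) -(dvdn_pcharf (pchar_Fp pp)) gtnNdvd. Qed.

Lemma card_F : #|F| = p. Proof. exact: card_Fp. Qed.

Lemma Fp_expp (x : F) : x ^+ p = x.
Proof. by have := expf_card x; rewrite card_F. Qed.

Lemma ex_primitive_root : exists g : F, p.-1.-primitive_root g.
Proof.
have p0 : (0 < p.-1)%N by lia.
have : has (p.-1).-primitive_root [seq x <- enum F | x != 0].
  apply: has_prim_root => //.
  - apply/allP => x; rewrite mem_filter unity_rootE => /andP[x0 _].
    apply/eqP; apply: (mulfI x0); rewrite -exprS prednK ?prime_gt0 // mulr1.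
    exact: Fp_expp.
  - by rewrite filter_uniq // enum_uniq.
  have -> : [seq x <- enum F | x != 0] = enum (predC1 (0 : F)).
    by rewrite {2}/enum_mem -enumT; apply: eq_filter => x; rewrite inE.
  by rewrite -cardE cardC1 card_F.
by case/hasP=> g _; exists g.
Qed.

Lemma primitive_root_exp (g x : F) : p.-1.-primitive_root g -> x != 0 -> exists i : nat, x = g ^+ i.
Proof.
move=> hg x0; have xn : x ^+ p.-1 = 1.
  by apply: (mulfI x0); rewrite -exprS prednK ?prime_gt0 // mulr1 Fp_expp.
by have [i ->] := prim_rootP hg xn; exists i.
Qed.

Lemma primitive_root_neq0 (g : F) : p.-1.-primitive_root g -> g != 0.
Proof.
move=> hg; apply/eqP => g0; have := prim_expr_order hg; rewrite g0 expr0n.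
have -> : (p.-1 == 0)%N = false by apply/negbTE; lia.
by move/eqP; rewrite eq_sym oner_eq0.
Qed.

(** As p - 1 is even, the parity of the exponent is well defined, and it decides whether the power
    is a square. Multiplicativity of [eta] is read off from this form. *)
Lemma eta_primitive_root (g : F) i : p.-1.-primitive_root g -> eta (g ^+ i) = (-1) ^+ i.
Proof.
move=> hg; have g0 := primitive_root_neq0 hg; rewrite /eta expf_eq0 (negPf g0) andbF.
have podd : ~~ odd p.-1 by have := odd_prime_gt2; case: (even_prime pp) => h; lia.
rewrite -signr_odd; case: existsP => [[y /eqP e]|h].
  have y0 : y != 0 by apply: contraTneq (expf_neq0 i g0) => y0; rewrite -e y0 expr0n eqxx.
  have [j ej] := primitive_root_exp hg y0; move: e; rewrite ej -exprM => /eqP.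
  rewrite (eq_prim_root_expr hg) => /eqP e.
  have d2 : (2 %| p.-1)%N by rewrite dvdn2.
  have : (j * 2 = i %[mod 2])%N by rewrite -(modn_dvdm _ d2) e modn_dvdm.
  by rewrite modnMl modn2; case: (odd i).
case: (boolP (odd i)) => // hi; case: h; exists (g ^+ i./2).
by rewrite -exprM muln2 -{2}(odd_double_half i) (negPf hi).
Qed.

Lemma eta0 : eta 0 = 0. Proof. by rewrite /eta eqxx. Qed.
Lemma eta1 : eta 1 = 1.
Proof.
rewrite /eta oner_eq0; case: existsP => // -[]; exists 1; by rewrite expr1n.
Qed.

Lemma etaM x y : eta (x * y) = eta x * eta y.
Proof.
have [->|x0] := eqVneq x 0; first by rewrite mul0r eta0 mul0r.
have [->|y0] := eqVneq y 0; first by rewrite mulr0 eta0 mulr0.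
have [g hg] := ex_primitive_root.
have [i ->] := primitive_root_exp hg x0; have [j ->] := primitive_root_exp hg y0.
by rewrite -exprD !eta_primitive_root // exprD.
Qed.

Lemma eta_sqr x : x != 0 -> eta (x ^+ 2) = 1.
Proof.
move=> x0; rewrite /eta expf_eq0 (negPf x0) andbF.
by case: existsP => // -[]; exists x.
Qed.

Lemma eta_neq0_sqr x : x != 0 -> eta x * eta x = 1.
Proof. by move=> x0; rewrite -etaM -expr2 eta_sqr. Qed.

Lemma count_sqrt x : \sum_y (y ^+ 2 == x :> F)%:R = 1 + eta x.
Proof.
rewrite /eta; case: eqP => [->|/eqP x0].
  rewrite (bigD1 0) // [0 ^+ 2]expr0n /= ?eqxx big1 ?addr0 // => y y0.
  by rewrite expf_eq0 (negPf y0) andbF.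
case: existsP => [[y /eqP e]|h]; last first.
  rewrite big1 ?subrr // => y _; case: eqP => // e; case: h; exists y; exact/eqP.
have y0 : y != 0 by apply: contraNneq x0 => y0; rewrite -e y0 expr0n.
have ny : - y != y.
  rewrite eq_sym -subr_eq0 opprK -mulr2n -mulr_natl mulf_neq0 //; exact: two_neq0.
rewrite (bigD1 y) //= e eqxx (bigD1 (- y)) //= sqrrN e eqxx big1 ?addr0 // => z /andP[z1 z2].
rewrite -e; case: eqP => // /eqP; rewrite -subr_eq0 subr_sqr mulf_eq0 subr_eq0 addr_eq0.
by rewrite (negPf z1) (negPf z2).
Qed.

Lemma sum_one : \sum_(x : F) 1 = p%:Z.
Proof. by rewrite sumr_const card_F -[RHS]intz pmulrn. Qed.

Lemma sum_eta : \sum_x eta x = 0.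
Proof.
have : \sum_x (1 + eta x) = p%:Z.
  under eq_bigr do rewrite -count_sqrt.
  rewrite exchange_big /= -sum_one; apply: eq_bigr => y _.
  rewrite (bigD1 (y ^+ 2)) //= eqxx big1 ?addr0 // => x /negPf; by rewrite eq_sym => ->.
rewrite big_split /= sum_one => /eqP; by rewrite addrC -subr_eq0 addrK => /eqP.
Qed.

Lemma sum_eta_affine a b : a != 0 -> \sum_t eta (a * t + b) = 0.
Proof.
move=> a0; rewrite -[RHS]sum_eta [RHS](reindex (fun t => a * t + b)) //.
exists (fun t => (t - b) / a) => t _; first by rewrite addrK mulrC mulKf.
by rewrite mulrC divfK // subrK.
Qed.

(** After a translation the product is eta(t) eta(t + c) with c = v - u. For t and c nonzero it
    equals eta(1 + c / t), and c / t runs over the nonzero elements, so the sum is 0 - eta(1) =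
    -1. *)
Lemma sum_eta_shift u v : \sum_t eta (t + u) * eta (t + v) = p%:Z * (u == v)%:R - 1.
Proof.
have -> : \sum_t eta (t + u) * eta (t + v) = \sum_t eta t * eta (t + (v - u)).
  rewrite [RHS](reindex (fun t => t + u)) /=.
    by apply: eq_bigr => t _; congr (_ * eta _); ring.
  by exists (fun t => t - u) => t _; rewrite ?addrK ?subrK.
rewrite (bigD1 0) //= eta0 mul0r add0r.
case: eqP => [->|/eqP uv].
  rewrite mulr1 subrr; under eq_bigr => t t0 do rewrite addr0 eta_neq0_sqr //.
  by rewrite -sum_one [X in _ = X - 1](bigD1 0) //=; ring.
rewrite mulr0 sub0r; have c0 : v - u != 0 by rewrite subr_eq0 eq_sym.
transitivity (\sum_(t | t != 0) eta (1 + t)); last first.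
  have := sum_eta_affine 1 (oner_neq0 F); rewrite (bigD1 0) //= mulr0 add0r eta1.
  under eq_bigr do rewrite mul1r addrC.
  by move=> /eqP; rewrite addrC addr_eq0 => /eqP.
rewrite [RHS](reindex (fun t => (v - u) / t)) /=; last first.
  exists (fun t => (v - u) / t) => t; rewrite inE => ht.
    by rewrite invf_div mulrCA divff ?mulr1 //; apply: contraNneq ht => ->; rewrite invr0 mulr0.
  by rewrite invf_div mulrCA divff ?mulr1.
apply: eq_big => [t|t t0].
  by rewrite mulf_eq0 invr_eq0 (negPf c0).
have -> : t + (v - u) = t * (1 + (v - u) / t) by field.
by rewrite etaM mulrA eta_neq0_sqr // mul1r.
Qed.

Definition Ssum : int := \sum_x eta (4 * x ^+ 3 + 1).

(** Both cubics are affine in t with slopes x^2 and y^2. They are constant, equal to 1, exactly at x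
    = 0 or y = 0: two constants give p, one constant leaves a complete affine sum, which vanishes.
    Otherwise the slopes are nonzero squares and can be divided out. *)
Lemma sum_eta_cubics x y : \sum_t eta (x ^+ 3 + t * x ^+ 2 + 1) * eta (y ^+ 3 + t * y ^+ 2 + 1) =
  p%:Z * ((x == 0) && (y == 0))%:R +
  ((x != 0) && (y != 0))%:R * (p%:Z * ((x == y) || (x ^+ 2 * y ^+ 2 == x + y))%:R - 1).
Proof.
have [x0|x0] := eqVneq x 0; have [y0|y0] := eqVneq y 0.
- rewrite x0 y0 /= mul0r addr0 mulr1 -sum_one; apply: eq_bigr => t _.
  by rewrite !expr0n mulr0 !add0r eta1.
- rewrite x0 /= mulr0 mul0r addr0 -[RHS](sum_eta_affine (y ^+ 3 + 1) (expf_neq0 2 y0)).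
  apply: eq_bigr => t _; rewrite !expr0n mulr0 !add0r eta1 mul1r; congr eta; ring.
- rewrite y0 /= mulr0 mul0r addr0 -[RHS](sum_eta_affine (x ^+ 3 + 1) (expf_neq0 2 x0)).
  apply: eq_bigr => t _; rewrite !expr0n mulr0 !add0r eta1 mulr1; congr eta; ring.
rewrite /= mulr0 add0r mul1r.
pose u (z : F) := (z ^+ 3 + 1) / z ^+ 2.
have E (z t : F) : z != 0 -> eta (z ^+ 3 + t * z ^+ 2 + 1) = eta (t + u z).
  move=> z0; have -> : z ^+ 3 + t * z ^+ 2 + 1 = z ^+ 2 * (t + u z) by rewrite /u; field.
  by rewrite etaM eta_sqr // mul1r.
under eq_bigr do rewrite !E //.
rewrite sum_eta_shift; congr (_ * _%:R - _).
have -> : (u x == u y) = ((x - y) * (x ^+ 2 * y ^+ 2 - (x + y)) == 0).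
  rewrite -subr_eq0; have -> : u x - u y = (x - y) * (x ^+ 2 * y ^+ 2 - (x + y)) / (x * y) ^+ 2 by rewrite /u; field; rewrite x0 y0.
  by rewrite [LHS]mulf_eq0 invr_eq0 expf_eq0 [in X in _ || X]mulf_eq0 (negPf x0) (negPf y0) andbF orbF.
by rewrite mulf_eq0 !subr_eq0.
Qed.

End PrimeField.

(** * The second moment as a count of pairs (x, y) *)

Section SecondMoment.
Variable p : nat.
Hypotheses (pp : prime p) (p2 : (2 < p)%N).
Local Notation F := 'F_p.
Local Notation eta := (@eta p).

Lemma sum_legendre_curve : \sum_(x < p) legendre p (4 * (x%:Z) ^+ 3 + 1) = Ssum p.
Proof.
rewrite /Ssum -(sum_Fp pp (fun x => eta (4 * x ^+ 3 + 1))); apply: eq_bigr => x _.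
by rewrite legendreE // rmorphD rmorphM rmorphXn rmorph1.
Qed.

Lemma n32E : (n32 p)%:Z = \sum_(x : F) (x ^+ 3 == 2)%:R.
Proof.
rewrite -(sum_Fp pp (fun x : F => (x ^+ 3 == 2)%:R : int)) /n32 -sum1_card big_mkcond /=.
rewrite -[LHS]intz -pmulrn natr_sum; apply: eq_bigr => x _.
by rewrite inE -(Fp_intr_eq0 pp) rmorphB rmorphXn subr_eq0; case: ifP.
Qed.

Lemma A2E : A2 p = \sum_(t : F) \sum_(x : F) \sum_(y : F)
   eta (x ^+ 3 + t * x ^+ 2 + 1) * eta (y ^+ 3 + t * y ^+ 2 + 1).
Proof.
rewrite /A2 -(sum_Fp pp (fun t => \sum_(x : F) \sum_(y : F)
   eta (x ^+ 3 + t * x ^+ 2 + 1) * eta (y ^+ 3 + t * y ^+ 2 + 1))).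
apply: eq_bigr => t _; rewrite /a_t sqrrN.
have -> : \sum_(x < p) legendre p (x%:Z ^+ 3 + t%:Z * x%:Z ^+ 2 + 1) =
   \sum_x eta (x ^+ 3 + (t%:Z)%:~R * x ^+ 2 + 1).
  rewrite -(sum_Fp pp (fun x => eta (x ^+ 3 + (t%:Z)%:~R * x ^+ 2 + 1))).
  apply: eq_bigr => x _.
  by rewrite legendreE // !rmorphD rmorphM !rmorphXn rmorph1.
by rewrite expr2 mulr_suml; apply: eq_bigr => x _; rewrite mulr_sumr.
Qed.

Lemma sum_indicator (x : F) (f : F -> int) : \sum_y (y == x)%:R * f y = f x.
Proof.
rewrite (bigD1 x) //= eqxx mul1r big1 ?addr0 // => y /negPf ->; exact: mul0r.
Qed.

(** Inclusion and exclusion: the solution y = x and the 1 + eta(4 x^3 + 1) roots of the quadratic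
    overlap exactly when x^4 = 2 x, that is x^3 = 2. This overlap is the source of the term with
    [n32]. *)
Lemma count_symmetric (x : F) : x != 0 ->
  \sum_(y : F | y != 0%R) ((x == y) || (x ^+ 2 * y ^+ 2 == x + y))%:R =
  2 + eta (4 * x ^+ 3 + 1) - (x ^+ 3 == 2)%:R.
Proof.
move=> x0.
have -> : \sum_(y : F | y != 0%R) ((x == y) || (x ^+ 2 * y ^+ 2 == x + y))%:R =
  \sum_y ((x == y) || (x ^+ 2 * y ^+ 2 == x + y))%:R :> int.
  rewrite [RHS](bigD1 0) //= (negPf x0) expr0n mulr0 addr0 eq_sym (negPf x0) add0r //.
have -> : \sum_y ((x == y) || (x ^+ 2 * y ^+ 2 == x + y))%:R =
   \sum_y ((y == x)%:R * (1 - (x ^+ 2 * y ^+ 2 == x + y)%:R) + (x ^+ 2 * y ^+ 2 == x + y)%:R) :> int.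
  by apply: eq_bigr => y _; rewrite eq_sym; case: (y == x); case: (_ == x + y).
rewrite big_split /= sum_indicator.
have -> : \sum_y (x ^+ 2 * y ^+ 2 == x + y)%:R = 1 + eta (4 * x ^+ 3 + 1).
  have t0 := two_neq0 pp p2; have a0 : 2 * x ^+ 2 != 0 by rewrite mulf_neq0 ?expf_neq0.
  (* Completing the square: with Y = 2 x^2 y - 1, the quadratic multiplied by 4 x^2 reads Y^2 = 4
     x^3 + 1. *)
  rewrite -count_sqrt // [RHS](reindex (fun y => 2 * x ^+ 2 * y - 1)) /=; last first.
    exists (fun z => (z + 1) / (2 * x ^+ 2)) => z _; first by rewrite subrK mulrAC divff ?mul1r.
    by rewrite mulrC divfK // addrK.
  apply: eq_bigr => y _; congr ((nat_of_bool _)%:R); rewrite -[RHS]subr_eq0.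
  have -> : (2 * x ^+ 2 * y - 1) ^+ 2 - (4 * x ^+ 3 + 1) = (2 * x) ^+ 2 * (x ^+ 2 * y ^+ 2 - (x + y)) by ring.
  by rewrite mulf_eq0 expf_eq0 mulf_eq0 (negPf x0) (negPf t0) /= subr_eq0.
have -> : (x ^+ 2 * x ^+ 2 == x + x) = (x ^+ 3 == 2).
  rewrite -subr_eq0 -[RHS]subr_eq0.
  have -> : x ^+ 2 * x ^+ 2 - (x + x) = x * (x ^+ 3 - 2) by ring.
  by rewrite mulf_eq0 (negPf x0).
ring.
Qed.

Theorem second_moment : A2 p = (p%:Z) ^+ 2 - (n32 p)%:Z * p%:Z - 1
            + p%:Z * \sum_(x < p) legendre p (4 * (x%:Z) ^+ 3 + 1).
Proof.
rewrite sum_legendre_curve n32E A2E exchange_big /=.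
under eq_bigr do rewrite exchange_big /=.
under eq_bigr do under eq_bigr do rewrite sum_eta_cubics //.
have row (x : F) : x != 0 -> \sum_y (p%:Z * ((x == 0) && (y == 0))%:R +
  ((x != 0) && (y != 0))%:R * (p%:Z * ((x == y) || (x ^+ 2 * y ^+ 2 == x + y))%:R - 1)) =
  p%:Z * (2 + eta (4 * x ^+ 3 + 1) - (x ^+ 3 == 2)%:R) - (p%:Z - 1).
  move=> x0; rewrite (negPf x0) /=.
  transitivity (\sum_(y : F | y != 0%R) (p%:Z * ((x == y) || (x ^+ 2 * y ^+ 2 == x + y))%:R - 1)).
    rewrite [RHS]big_mkcond; apply: eq_bigr => y _.
    by case: (y == 0); rewrite ?mulr0 ?mul0r ?add0r ?mul1r.
  rewrite sumrB -mulr_sumr count_symmetric //; congr (_ - _).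
  by have := sum_one pp; rewrite (bigD1 0) //=; move=> <-; ring.
rewrite (bigD1 0) //=.
have -> : \sum_(y : F) (p%:Z * ((0 == 0 :> F) && (y == 0))%:R +
   (~~ (0 == 0 :> F) && (y != 0))%:R * (p%:Z * ((0 == y) || (0 ^+ 2 * y ^+ 2 == 0 + y))%:R - 1)) = p%:Z.
  rewrite (bigD1 0) //= ?eqxx /= ?mul0r ?mulr1 ?addr0 big1 ?addr0 // => y /negPf ->.
  by rewrite mulr0 mul0r.
rewrite (eq_bigr _ row) sumrB -mulr_sumr sumrB big_split /=.
have e1 : \sum_(x : F | x != 0%R) (1 : int) = p%:Z - 1.
  by have := sum_one pp; rewrite (bigD1 0) //=; move=> <-; ring.
have -> : \sum_(x : F | x != 0%R) (2 : int) = 2 * (p%:Z - 1).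
  by rewrite -e1 mulr_sumr; apply: eq_bigr => x _; rewrite mulr1.
have -> : \sum_(x : F | x != 0%R) (p%:Z - 1) = (p%:Z - 1) * (p%:Z - 1).
  by rewrite -{3}e1 mulr_sumr; apply: eq_bigr => x _; rewrite mulr1.
have -> : \sum_(x : F | x != 0%R) eta (4 * x ^+ 3 + 1) = Ssum p - 1.
  by rewrite /Ssum [in RHS](bigD1 0) //= expr0n mulr0 add0r eta1; ring.
have -> : \sum_(x : F | x != 0%R) (x ^+ 3 == 2)%:R = \sum_(x : F) (x ^+ 3 == 2)%:R :> int.
  rewrite [RHS](bigD1 0) //= expr0n eq_sym (negPf (two_neq0 pp p2)) add0r //.
ring.
Qed.

End SecondMoment.

(** * Eisenstein integers *)

(** [Eis a b] stands for a + b omega, where omega^2 + omega + 1 = 0. *)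
Record eis := Eis { ere : int; eim : int }.

Definition pair_of_eis z := (ere z, eim z).
Definition eis_of_pair u := Eis u.1 u.2.
Lemma pair_of_eisK : cancel pair_of_eis eis_of_pair. Proof. by case. Qed.
HB.instance Definition _ := Choice.copy eis (can_type pair_of_eisK).

Definition eis_add x y := Eis (ere x + ere y) (eim x + eim y).
Definition eis_opp x := Eis (- ere x) (- eim x).
Definition eis_mul x y :=
  Eis (ere x * ere y - eim x * eim y)
      (ere x * eim y + eim x * ere y - eim x * eim y).

Lemma eis_addA : associative eis_add.
Proof. by move=> [a b] [c d] [e f]; congr Eis => /=; ring. Qed.
Lemma eis_addC : commutative eis_add.
Proof. by move=> [a b] [c d]; congr Eis => /=; ring. Qed.
Lemma eis_add0 : left_id (Eis 0 0) eis_add.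
Proof. by move=> [a b]; congr Eis => /=; ring. Qed.
Lemma eis_addN : left_inverse (Eis 0 0) eis_opp eis_add.
Proof. by move=> [a b]; congr Eis => /=; ring. Qed.
HB.instance Definition _ :=
  GRing.isZmodule.Build eis eis_addA eis_addC eis_add0 eis_addN.

Lemma eis_mulA : associative eis_mul.
Proof. by move=> [a b] [c d] [e f]; congr Eis => /=; ring. Qed.
Lemma eis_mulC : commutative eis_mul.
Proof. by move=> [a b] [c d]; congr Eis => /=; ring. Qed.
Lemma eis_mul1 : left_id (Eis 1 0) eis_mul.
Proof. by move=> [a b]; congr Eis => /=; ring. Qed.
Lemma eis_mulD : left_distributive eis_mul eis_add.
Proof. by move=> [a b] [c d] [e f]; congr Eis => /=; ring. Qed.
Lemma eis_oner_neq0 : Eis 1 0 != 0. Proof. by []. Qed.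
HB.instance Definition _ := GRing.Zmodule_isComNzRing.Build eis
  eis_mulA eis_mulC eis_mul1 eis_mulD eis_oner_neq0.

Lemma eisD x y : x + y = Eis (ere x + ere y) (eim x + eim y). Proof. by []. Qed.
Lemma eisN x : - x = Eis (- ere x) (- eim x). Proof. by []. Qed.
Lemma eisM x y : x * y = Eis (ere x * ere y - eim x * eim y)
      (ere x * eim y + eim x * ere y - eim x * eim y). Proof. by []. Qed.
Lemma eis0 : (0 : eis) = Eis 0 0. Proof. by []. Qed.
Lemma eis1 : (1 : eis) = Eis 1 0. Proof. by []. Qed.
Definition eisE := (eisD, eisN, eisM, eis0, eis1).

Lemma eisMn x n : x *+ n = Eis (ere x *+ n) (eim x *+ n).
Proof. by elim: n => [//|n IH]; rewrite !mulrSr IH. Qed.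

Lemma eis_intr (z : int) : z%:~R = Eis z 0 :> eis.
Proof.
have H n : n%:R = Eis n 0 :> eis by rewrite eisMn /= mul0rn pmulrn intz.
by case: z => n; [exact: H | rewrite NegzE mulrNz -pmulrn H eisN oppr0].
Qed.

Definition conje (x : eis) := Eis (ere x - eim x) (- eim x).

Lemma conjeK : involutive conje.
Proof. by case=> a b; congr Eis => /=; ring. Qed.
Lemma conjeM x y : conje (x * y) = conje x * conje y.
Proof. by case: x y => a b [c d]; congr Eis => /=; ring. Qed.
Lemma conjeD x y : conje (x + y) = conje x + conje y.
Proof. by case: x y => a b [c d]; congr Eis => /=; ring. Qed.

Definition normez x : int := ere x ^+ 2 - ere x * eim x + eim x ^+ 2.
Definition norme x : nat := `|normez x|%N.

Lemma normez_ge0 x : 0 <= normez x.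
Proof. by case: x => a b; rewrite /normez /=; nia. Qed.
Lemma normeE x : (norme x)%:Z = normez x.
Proof. by rewrite /norme gez0_abs // normez_ge0. Qed.
Lemma normezM x y : normez (x * y) = normez x * normez y.
Proof. by case: x y => a b [c d]; rewrite /normez /=; ring. Qed.
Lemma normeM x y : norme (x * y) = (norme x * norme y)%N.
Proof. by rewrite /norme normezM abszM. Qed.
Lemma normeX x n : norme (x ^+ n) = (norme x ^ n)%N.
Proof. by elim: n => [//|n IH]; rewrite exprS expnS normeM IH. Qed.
Lemma norme_eq0 x : (norme x == 0%N) = (x == 0).
Proof.
apply/eqP/eqP => [|->//]; move/(congr1 Posz); rewrite normeE.
case: x => a b; rewrite /normez /= => H.
have -> : a = 0 by nia. by have -> : b = 0 by nia.
Qed.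
Lemma norme_gt0 x : (0 < norme x)%N = (x != 0).
Proof. by rewrite lt0n norme_eq0. Qed.
Lemma norme_conj x : norme (conje x) = norme x.
Proof. by rewrite /norme; congr absz; case: x => a b; rewrite /normez /=; ring. Qed.
Lemma mul_conje x : x * conje x = (normez x)%:~R.
Proof. by rewrite eis_intr; case: x => a b; congr Eis; rewrite /normez /=; ring. Qed.

Lemma eis_mulf_eq0 (x y : eis) : (x * y == 0) = (x == 0) || (y == 0).
Proof. by rewrite -!norme_eq0 normeM muln_eq0. Qed.
Lemma eis_mulfI (x : eis) : x != 0 -> injective ( *%R x).
Proof.
move=> x0 y z /eqP; rewrite -subr_eq0 -mulrBr eis_mulf_eq0 (negPf x0) subr_eq0.
by move/eqP.
Qed.

Definition dvde (x y : eis) := exists z, y = z * x.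

(* Rounding the quotient to the nearest lattice point leaves a remainder of relative norm at most 3/4. *)
Lemma eis_divP (x y : eis) : y != 0 -> exists q : eis, (norme (x - q * y)%R < norme y)%N.
Proof.
move=> y0; set n := normez y.
have n0 : 0 < n by rewrite /n -normeE; move: y0; rewrite -norme_gt0; lia.
have rnd (a : int) : exists q : int, `|2 * (a - q * n)| <= n.
  exists ((2 * a + n) %/ (2 * n))%Z.
  have := divz_eq (2 * a + n) (2 * n).
  have := modz_ge0 (2 * a + n) (_ : 2 * n != 0).
  have := ltz_pmod (2 * a + n) (_ : 0 < 2 * n).
  move=> H1 H2; have {}H1 := H1 ltac:(lia); have {}H2 := H2 ltac:(lia).
  nia.
set t := x * conje y.
have [q1 h1] := rnd (ere t); have [q2 h2] := rnd (eim t).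
exists (Eis q1 q2).
suff : normez (x - Eis q1 q2 * y) < n by rewrite /n -!normeE ltz_nat.
have e : (x - Eis q1 q2 * y) * conje y = Eis (ere t - q1 * n) (eim t - q2 * n).
  rewrite mulrBl -mulrA mul_conje -/n -/t eis_intr.
  by case: (t) => a b; congr Eis => /=; ring.
have E := congr1 normez e; rewrite normezM in E.
have cj : normez (conje y) = n by rewrite -normeE norme_conj normeE.
rewrite cj in E; move: E; rewrite {2}/normez /=.
set A := ere t - _ in h1 *; set B := eim t - _ in h2 *.
move: (normez _) => r E.
suff : r * n < n * n by rewrite ltr_pM2r.
rewrite E; have : 4 * (A ^+ 2 - A * B + B ^+ 2) <= 3 * n * n; last by nia.
have : `|2 * A| ^+ 2 <= n ^+ 2 by rewrite lerXn2r ?nnegrE ?normr_ge0 //; lia.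
have : `|2 * B| ^+ 2 <= n ^+ 2 by rewrite lerXn2r ?nnegrE ?normr_ge0 //; lia.
have : `|2 * A| * `|2 * B| <= n * n by apply: ler_pM.
rewrite -normrM !real_normK ?num_real // => H3 H2 H1.
have := ler_normr (2 * A * (2 * B)) (- (2 * A * (2 * B))).
by nia.
Qed.

(** Congruence to 1 modulo 3. The six units represent all invertible classes modulo 3, so this
    selects one generator of each ideal prime to 3. *)
Definition primary x := (ere x %% 3 == 1)%Z && (eim x %% 3 == 0)%Z.

Lemma primaryP x : reflect (exists y, x = 1 + y *+ 3) (primary x).
Proof.
apply: (iffP andP) => [[/eqP h1 /eqP h2]|[[c d] ->]].
  exists (Eis (ere x %/ 3)%Z (eim x %/ 3)%Z); case: x h1 h2 => a b /= h1 h2.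
  rewrite eisMn; congr Eis => /=; lia.
by rewrite eisMn /=; split; apply/eqP; lia.
Qed.

Lemma primaryM x y : primary x -> primary y -> primary (x * y).
Proof.
move=> /primaryP [u ->] /primaryP [v ->]; apply/primaryP.
by exists (u + v + u * v *+ 3); ring.
Qed.

Lemma primaryX x n : primary x -> primary (x ^+ n).
Proof. by move=> h; elim: n => // n IH; rewrite exprS primaryM. Qed.

Lemma primary_neq0 x : primary x -> x != 0.
Proof. by move=> h; apply: contraL h => /eqP ->. Qed.

Lemma primary_divr x y : primary x -> primary (x * y) -> primary y.
Proof.
move=> /primaryP [u ->] /primaryP [v e]; apply/primaryP.
exists (v - u * y); transitivity ((1 + u *+ 3) * y - (u * y) *+ 3); first by ring.
by rewrite e; ring.
Qed.

Lemma primary_conj x : primary x -> primary (conje x).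
Proof.
move=> /primaryP [u ->]; apply/primaryP; exists (conje u).
by case: u => a b; rewrite !eisMn; congr Eis => /=; ring.
Qed.

Lemma norme_primary_mod3 x : primary x -> (norme x %% 3 = 1)%N.
Proof.
move=> /primaryP [[u v] ->].
apply/eqP; rewrite -eqz_nat -modz_nat normeE eisMn /normez /=; apply/eqP.
have -> : (1 + u *+ 3) ^+ 2 - (1 + u *+ 3) * (0 + v *+ 3) + (0 + v *+ 3) ^+ 2 =
   (2 * u - v + 3 * (u ^+ 2 - u * v + v ^+ 2)) * 3 + 1 by ring.
by rewrite modzMDl.
Qed.

Lemma primary_unit x : primary x -> norme x = 1%N -> x = 1.
Proof.
move=> /primaryP [[u v] ->] /(congr1 Posz); rewrite eisMn normeE /normez /= => e.
have v0 : v = 0.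
  have := sqr_ge0 (2 * (1 + u *+ 3) - v *+ 3); have : v ^+ 2 < 1 -> v = 0 by nia.
  by nia.
by move: e; rewrite v0 => e; have -> : u = 0 by nia.
Qed.

Lemma dvde_refl x : dvde x x. Proof. by exists 1; rewrite mul1r. Qed.
Lemma dvde_trans y x z : dvde x y -> dvde y z -> dvde x z.
Proof. by move=> [u ->] [v ->]; exists (v * u); rewrite mulrA. Qed.
Lemma dvde_mull x y z : dvde x y -> dvde x (z * y).
Proof. by move=> [u ->]; exists (z * u); rewrite mulrA. Qed.
Lemma dvde_mulr x y z : dvde x y -> dvde x (y * z).
Proof. by move=> h; rewrite mulrC; exact: dvde_mull. Qed.
Lemma dvde_add x y z : dvde x y -> dvde x z -> dvde x (y + z).
Proof. by move=> [u ->] [v ->]; exists (u + v); rewrite mulrDl. Qed.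
Lemma dvde_norm x y : dvde x y -> (norme x %| norme y)%N.
Proof. by move=> [u ->]; rewrite normeM dvdn_mull. Qed.
Lemma dvde_norm_leq x y : y != 0 -> dvde x y -> (norme x <= norme y)%N.
Proof. by move=> y0 /dvde_norm h; rewrite dvdn_leq ?norme_gt0. Qed.

Lemma eis_unit_mul (u : eis) : norme u = 1%N -> u * conje u = 1.
Proof. by move=> h; rewrite mul_conje -normeE h. Qed.

Lemma dvde_assoc x y : x != 0 -> dvde x y -> norme x = norme y -> dvde y x.
Proof.
move=> x0 [u ->]; rewrite normeM => e.
have u1 : norme u = 1%N.
  by apply/eqP; rewrite -(eqn_pmul2r (_ : 0 < norme x)%N) ?norme_gt0 // mul1n -e.
by exists (conje u); rewrite mulrA [conje u * u]mulrC eis_unit_mul // mul1r.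
Qed.

Lemma eis_bezout (x y : eis) : exists g u v : eis,
  [/\ g = u * x + v * y, dvde g x & dvde g y].
Proof.
have [n] := ubnP (norme y); elim: n x y => // n IH x y hn.
have [->|y0] := eqVneq y 0.
  by exists x, 1, 0; split; [ring | exact: dvde_refl | exists 0; rewrite mul0r].
have [q hq] := eis_divP x y0.
have [|g [u [v [e h1 h2]]]] := IH y (x - q * y).
  by apply: leq_trans hq _; rewrite -ltnS.
exists g, v, (u - v * q); split=> //; first by rewrite e; ring.
by rewrite -(subrK (q * y) x); apply: dvde_add => //; apply: dvde_mull.
Qed.

Definition prime_eis (x : eis) :=
  (1 < norme x)%N /\ forall y z, dvde x (y * z) -> dvde x y \/ dvde x z.

(** Divisors are tested by their norm alone: norm 1 means a unit, and the full norm means an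
    associate, by [dvde_assoc]. *)
Definition irred_eis x :=
  (1 < norme x)%N /\ forall g, dvde g x -> norme g = 1%N \/ norme g = norme x.

Lemma irred_prime x : irred_eis x -> prime_eis x.
Proof.
move=> [x1 hx]; split=> // y z hyz.
have [g [u [v [e h1 h2]]]] := eis_bezout x y.
have x0 : x != 0 by rewrite -norme_gt0; lia.
have [g1|gx] := hx g h1; last first.
  left; apply: dvde_trans h2; apply: dvde_assoc (gx) => //.
  by rewrite -norme_gt0 gx; lia.
right; have -> : z = conje g * (z * u * x + v * (y * z)).
  have -> : z * u * x + v * (y * z) = z * g by rewrite e; ring.
  by rewrite mulrCA [conje g * g]mulrC eis_unit_mul // mulr1.
by apply/dvde_mull/dvde_add; apply: dvde_mull => //; exact: dvde_refl.
Qed.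

Lemma prime_irred x : prime_eis x -> irred_eis x.
Proof.
move=> [x1 hx]; split=> // g [u e].
have x0 : x != 0 by rewrite -norme_gt0; lia.
have [|h|h] := hx u g; first by rewrite -e; exact: dvde_refl.
- left; have : (norme u * norme g = norme x)%N by rewrite -normeM -e.
  have u0 : u != 0 by apply: contraNneq x0 => u0; rewrite e u0 mul0r.
  have := dvde_norm_leq u0 h; rewrite -norme_gt0 in u0; nia.
- right; apply/eqP; rewrite eqn_leq dvde_norm_leq //=; last by exists u.
  by apply: dvde_norm_leq h; apply: contraNneq x0 => g0; rewrite e g0 mulr0.
Qed.

Lemma prime_divisor x : (1 < norme x)%N -> exists2 p, prime_eis p & dvde p x.
Proof.
have [n] := ubnP (norme x); elim: n x => // n IH x hn x1.
have [/irred_prime h|h] := pselect (irred_eis x); first by exists x => //; exact: dvde_refl.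
have x0 : x != 0 by rewrite -norme_gt0; lia.
have [g [gx g1 gx1]] : exists g, [/\ dvde g x, norme g <> 1%N & norme g <> norme x].
  apply: contrapT => h'; apply: h; split=> // g gx.
  apply: contrapT => /not_orP [? ?]; apply: h'; by exists g.
have le := dvde_norm_leq x0 gx.
have g0 : g != 0 by case: gx x0 => u ->; rewrite eis_mulf_eq0 negb_or => /andP[].
rewrite -norme_gt0 in g0.
have [||p hp pg] := IH g; [lia | lia |].
by exists p => //; exact: dvde_trans pg gx.
Qed.

(** Nine residue pairs modulo 3: three of them make the norm divisible by 3, and each of the other
    six is sent to (1, 0) by its own unit. The auxiliary [H c d] checks the unit c + d omega. *)
Lemma primary_assoc x : (norme x %% 3 != 0)%N ->
  exists2 u, norme u = 1%N & primary (u * x).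
Proof.
case: x => a b h.
have {}h : (normez (Eis a b) %% 3)%Z != 0 by rewrite -normeE; lia.
have ea := divz_eq a 3; have eb := divz_eq b 3.
set qa := (a %/ 3)%Z in ea; set qb := (b %/ 3)%Z in eb.
have ra0 := modz_ge0 a (isT : 3%:Z != 0); have rb0 := modz_ge0 b (isT : 3%:Z != 0).
have ra := ltz_pmod a (isT : 0 < 3%:Z); have rb := ltz_pmod b (isT : 0 < 3%:Z).
set sa := (a %% 3)%Z in ea ra0 ra; set sb := (b %% 3)%Z in eb rb0 rb.
have H c d : norme (Eis c d) = 1%N ->
   (exists m, c * a - d * b = 1 + 3 * m) -> (exists m, c * b + d * a - d * b = 3 * m) ->
   exists2 u, norme u = 1%N & primary (u * Eis a b).
  by move=> h1 [m e1] [m' e2]; exists (Eis c d) => //; rewrite /primary /= e1 e2; lia.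
have S r : 0 <= r -> r < 3 -> [\/ r = 0, r = 1 | r = 2 :> int].
  move=> h0 h3; have [->|[->|->]] : r = 0 \/ r = 1 \/ r = 2 by lia.
  - by constructor 1.
  - by constructor 2.
  - by constructor 3.
have exceptional m : normez (Eis a b) = 3 * m -> False by move=> e; move: h; rewrite e; lia.
case: (S _ ra0 ra) (S _ rb0 rb) => e1 [] e2; rewrite e1 ?addr0 in ea; rewrite e2 ?addr0 in eb.
- by case: (exceptional (3 * (qa ^+ 2 - qa * qb + qb ^+ 2))); rewrite /normez /= ea eb; ring.
- by apply: (H (-1) (-1)) => //; [exists (- qa + qb) | exists (- qa)]; rewrite ea eb; ring.
- by apply: (H 1 1) => //; [exists (qa - qb - 1) | exists qa]; rewrite ea eb; ring.
- by apply: (H 1 0) => //; [exists qa | exists qb]; rewrite ea eb; ring.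
- by apply: (H 0 (-1)) => //; [exists qb | exists (qb - qa)]; rewrite ea eb; ring.
- by case: (exceptional (3 * (qa ^+ 2 - qa * qb + qb ^+ 2) + 3 * qb + 1)); rewrite /normez /= ea eb; ring.
- by apply: (H (-1) 0) => //; [exists (- qa - 1) | exists (- qb)]; rewrite ea eb; ring.
- by case: (exceptional (3 * (qa ^+ 2 - qa * qb + qb ^+ 2) + 3 * qa + 1)); rewrite /normez /= ea eb; ring.
- by apply: (H 0 1) => //; [exists (- qb - 1) | exists (qa - qb)]; rewrite ea eb; ring.
Qed.

Lemma prime_dvde_primary p q : prime_eis p -> prime_eis q ->
  primary p -> primary q -> dvde p q -> p = q.
Proof.
move=> [p1 _] /prime_irred [q1 hq] pp pq pdq.
case: (hq p pdq) => [|e]; first by lia.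
case: pdq => u eq; rewrite eq mulrC in pq.
have := primary_unit (primary_divr pp pq); rewrite eq => -> //; first by rewrite mul1r.
have := e; rewrite eq normeM => e'; apply/eqP.
by rewrite -(eqn_pmul2r (_ : 0 < norme p)%N) ?mul1n -?e' //; lia.
Qed.

Lemma primary_prime_divisor x : primary x -> (1 < norme x)%N ->
  exists p, [/\ prime_eis p, primary p & dvde p x].
Proof.
move=> px x1; have [p [p1 hp] pdx] := prime_divisor x1.
have [|u u1 pu] := @primary_assoc p.
  have := norme_primary_mod3 px.
  have /dvdnP[k ->] := dvde_norm pdx => h; apply/eqP => h0.
  by move: h; rewrite -modnMmr h0 muln0.
have E : p = conje u * (u * p) by rewrite mulrA [conje u * u]mulrC eis_unit_mul // mul1r.
exists (u * p); split=> //; last first.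
  by case: pdx => v ->; exists (v * conje u); rewrite {1}E; ring.
split; first by rewrite normeM u1 mul1n.
move=> y z h; have : dvde p (y * z).
  by apply: dvde_trans h; exists u.
by case/hp => [] [v ->]; [left|right]; exists (v * conje u); rewrite {1}E; ring.
Qed.

(** A factor q leaves the p-adic valuation unchanged. In [ln_norme_factor] this shows that
    cancelling one prime affects only the terms of that prime. *)
Lemma dvde_expn_mul p q x m : prime_eis p -> prime_eis q -> primary p -> primary q ->
  p != q -> dvde (p ^+ m) (x * q) -> dvde (p ^+ m) x.
Proof.
move=> hp hq pp pq pneq; elim: m x => [|m IH] x; first by exists x; rewrite mulr1.
move=> h; have : dvde p (x * q).
  by apply: dvde_trans h; exists (p ^+ m); rewrite -exprSr.
case: (hp) => _ /[apply] -[[y e]|/prime_dvde_primary h']; last first.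
  by case/eqP: pneq; exact: h'.
have p0 := primary_neq0 pp.
have : dvde (p ^+ m) y.
  apply: IH; case: h => v; rewrite e => h; exists v.
  by apply: (eis_mulfI p0); transitivity (y * p * q); [ring | rewrite h exprS; ring].
by case=> w e'; exists w; rewrite e e' exprS; ring.
Qed.

(** * Finite lists of primary elements of bounded or given norm *)

Definition ints M : seq int := [seq i%:Z - M%:Z | i <- iota 0 (M + M).+1].

Lemma mem_ints M z : (z \in ints M) = (`|z| <= M)%N.
Proof.
apply/mapP/idP => [[k]|h]; first by rewrite mem_iota => h ->; lia.
by exists (absz (z + M%:Z)); rewrite ?mem_iota; lia.
Qed.
Lemma ints_uniq M : uniq (ints M).
Proof. by rewrite map_inj_uniq ?iota_uniq // => i j; lia. Qed.

Definition box M : seq eis := [seq Eis a b | a <- ints M, b <- ints M].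

Lemma mem_box M x : (x \in box M) = (`|ere x| <= M)%N && (`|eim x| <= M)%N.
Proof.
rewrite -!mem_ints; apply/allpairsP/andP => [[[a b] [/= ha hb ->]] //|[ha hb]].
by exists (ere x, eim x); split=> //; case: (x).
Qed.
Lemma box_uniq M : uniq (box M).
Proof.
apply: allpairs_uniq; rewrite ?ints_uniq // => -[a b] [c d] _ _ /= [-> ->] //.
Qed.

(** From 4 N = 3 a^2 + (2 b - a)^2 and its mirror image, both coordinates c satisfy 3 c^2 <= 4 N,
    and integrality turns this into |c| <= N. *)
Lemma norme_box x M : (norme x <= M)%N -> x \in box M.
Proof.
move=> h; rewrite mem_box; have := normeE x; rewrite /normez.
move: (norme x) h => n h; case: x => a b /= e.
have B (c : int) : 3 * c ^+ 2 <= 4 * n%:Z -> (`|c| <= M)%N.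
  move=> hc; have [|] : (`|c| <= 1)%N \/ 2 * `|c| <= c ^+ 2; [nia | nia | nia].
have := sqr_ge0 (2 * b - a); have := sqr_ge0 (2 * a - b).
by move=> h1 h2; apply/andP; split; apply: B; nia.
Qed.

Definition disk M := [seq x <- box M | primary x && (norme x <= M)%N].
Definition shell n := [seq x <- box n | primary x && (norme x == n)].
Definition disk_primes M := [seq x <- disk M | `[< prime_eis x >]].

Lemma mem_disk M x : (x \in disk M) = primary x && (norme x <= M)%N.
Proof.
rewrite mem_filter andb_idr // => /andP[_]; exact: norme_box.
Qed.
Lemma mem_shell n x : (x \in shell n) = primary x && (norme x == n).
Proof.
rewrite mem_filter andb_idr // => /andP[_ /eqP <-]; exact: norme_box.
Qed.
Lemma mem_disk_primes M x : (x \in disk_primes M) = [&& `[< prime_eis x >], primary x & (norme x <= M)%N].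
Proof. by rewrite mem_filter mem_disk. Qed.
Lemma disk_uniq M : uniq (disk M). Proof. exact/filter_uniq/box_uniq. Qed.
Lemma shell_uniq M : uniq (shell M). Proof. exact/filter_uniq/box_uniq. Qed.
Lemma disk_primes_uniq M : uniq (disk_primes M). Proof. exact/filter_uniq/disk_uniq. Qed.

Lemma prime_pow_norm p m x : prime_eis p -> x != 0 -> dvde (p ^+ m) x -> (m < norme x)%N.
Proof.
move=> [p1 _] x0 /(dvde_norm_leq x0); rewrite normeX.
by apply: leq_trans; apply: ltn_expl.
Qed.

(** The analogue of log n as the sum of Lambda over the divisors of n: unique factorisation enters
    the analytic part in this form. The proof is by induction on the norm, cancelling one primary
    prime. The bound [M] serves both for the primes and for the exponents. *)
Lemma ln_norme_factor (R : realType) x M : primary x -> (norme x <= M)%N ->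
  ln (norme x)%:R = \sum_(p <- disk_primes M) \sum_(1 <= m < M.+1)
     (if `[< dvde (p ^+ m) x >] then ln (norme p)%:R else 0) :> R.
Proof.
have [n] := ubnP (norme x); elim: n x => // n IH x hn px hM.
have x0 := primary_neq0 px.
have [x1|x1] := leqP (norme x) 1.
  have e1 : norme x = 1%N by apply/eqP; rewrite eqn_leq x1 norme_gt0.
  rewrite e1 ln1 big_seq big1 // => p; rewrite mem_disk_primes => /andP[/asboolP hp _].
  rewrite big_nat big1 // => m /andP[m1 _]; case: asboolP => // h.
  by have := prime_pow_norm hp x0 h; lia.
have [p [hp pp [y e]]] := primary_prime_divisor px x1.
have py : primary y by apply: (primary_divr pp); rewrite mulrC -e.
have y0 := primary_neq0 py.
have nx : norme x = (norme y * norme p)%N by rewrite e normeM.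
have p1 : (1 < norme p)%N by case: hp.
have ny : (norme y < norme x)%N by move: y0; rewrite -norme_gt0; nia.
rewrite nx natrM lnM ?posrE ?ltr0n ?norme_gt0 ?(primary_neq0 pp) //.
rewrite (IH y) //; [|lia|lia].
have pM : p \in disk_primes M.
  rewrite mem_disk_primes pp; apply/and3P; split=> //; first exact/asboolP.
  by move: y0; rewrite -norme_gt0; nia.
rewrite !(bigD1_seq p pM (disk_primes_uniq M)) /= [LHS]addrAC; congr (_ + _); last first.
  rewrite big_seq_cond [RHS]big_seq_cond; apply: eq_bigr => q /andP[qM qp].
  move: qM; rewrite mem_disk_primes => /and3P[/asboolP hq pq _].
  apply: eq_bigr => m _; congr (if _ then _ else _); apply/asboolP/asboolP.
    by rewrite e => h; apply: dvde_mulr.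
  by rewrite e; apply: dvde_expn_mul.
have M0 : (0 < M)%N by lia.
(* For the cancelled prime, the powers dividing x are those dividing y shifted by one. The last term
   for y is zero, since p^M has norm above M; the first term for x supplies the new ln N p. *)
rewrite big_nat_recr //= [RHS]big_nat_recl //= expr1.
have -> : `[< dvde p x >] by apply/asboolP; exists y.
rewrite [X in _ + X + _](_ : _ = 0) ?addr0; last first.
  by case: asboolP => // h; have := prime_pow_norm hp y0 h; lia.
rewrite addrC; congr (_ + _).
apply: eq_big_nat => m _; congr (if _ then _ else _); apply/asboolP/asboolP.
  by case=> w ey; exists w; rewrite e ey exprSr mulrA.
case=> w; rewrite e exprSr mulrA => h; exists w.
by apply: (eis_mulfI (primary_neq0 pp)); rewrite mulrC h mulrC.
Qed.

(** * The cubic Jacobi sum *)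

Definition omega : eis := Eis 0 1.

Section Reduction.
Variables (p : nat) (w : eis).
Hypotheses (pp : prime p) (p2 : (2 < p)%N) (pw : primary w) (nw : norme w = p).
Local Notation F := 'F_p.
Local Notation eta := (@eta p).

Let a : F := (ere w)%:~R.
Let b : F := (eim w)%:~R.

Let nab : a ^+ 2 - a * b + b ^+ 2 = 0.
Proof.
have : (normez w)%:~R = 0 :> F.
  by apply/eqP; rewrite Fp_intr_eq0 // -normeE nw dvdzz.
by rewrite /normez !(rmorphD, rmorphN, rmorphM, rmorphXn).
Qed.

(** If p divided [eim w] it would divide [ere w] too, and then p^2 would divide [norme w = p]. *)
Let b0 : b != 0.
Proof.
apply/negP => hb; have hb' := hb; rewrite Fp_intr_eq0 // in hb'.
have : a ^+ 2 = 0 by move: nab; rewrite (eqP hb) mulr0 subr0 expr0n addr0.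
move/eqP; rewrite expf_eq0 /= Fp_intr_eq0 // => ha'.
have [u eu] := dvdzP hb'; have [v ev] := dvdzP ha'.
have := normeE w; rewrite nw /normez eu ev => e.
have : p%:Z = p%:Z * (p%:Z * (v ^+ 2 - v * u + u ^+ 2)) by rewrite {1}e; ring.
have := prime_gt1 pp; move: (v ^+ 2 - _ + _) => k p1 h.
have [k0|k1] : k <= 0 \/ 1 <= k by lia.
  by have : p%:Z * k <= 0 by [rewrite mulr_ge0_le0]; nia.
have : p%:Z * p%:Z <= p%:Z * (p%:Z * k) by rewrite ler_wpM2l // ler_peMr.
by rewrite -h; nia.
Qed.

(** The image of omega under reduction modulo w: it solves a + b z = 0 for w = a + b omega. *)
Definition zroot : F := - (ere w)%:~R / (eim w)%:~R.
Local Notation z := zroot.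

Lemma zroot_eq : z ^+ 2 + z + 1 = 0.
Proof.
have -> : z ^+ 2 + z + 1 = (a ^+ 2 - a * b + b ^+ 2) / b ^+ 2 by rewrite /z -/a -/b; field.
by rewrite nab mul0r.
Qed.

Definition red (x : eis) : F := (ere x)%:~R + (eim x)%:~R * z.

Lemma red1 : red 1 = 1. Proof. by rewrite /red /= mul0r addr0. Qed.
Lemma red0 : red 0 = 0. Proof. by rewrite /red /= mul0r addr0. Qed.
Lemma redD x y : red (x + y) = red x + red y.
Proof. by case: x y => c d [e f]; rewrite /red /= !rmorphD /=; ring. Qed.
Lemma redM x y : red (x * y) = red x * red y.
Proof.
case: x y => c d [e f]; rewrite /red /= !(rmorphD, rmorphN, rmorphM) /=.
move: (c%:~R : F) (d%:~R : F) (e%:~R : F) (f%:~R : F) => c' d' e' f'.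
apply/eqP; rewrite -subr_eq0.
have -> : c' * e' - d' * f' + (c' * f' + d' * e' - d' * f') * z - (c' + d' * z) * (e' + f' * z)
   = - d' * f' * (z ^+ 2 + z + 1) by ring.
by rewrite zroot_eq mulr0.
Qed.
Lemma red_sum I (r : seq I) (P : pred I) (G : I -> eis) :
  red (\sum_(i <- r | P i) G i) = \sum_(i <- r | P i) red (G i).
Proof. by elim/big_rec2: _ => [|i x y _ <-]; rewrite ?red0 ?redD. Qed.
Lemma redX x n : red (x ^+ n) = red x ^+ n.
Proof. by elim: n => [|n IH]; rewrite ?expr0 ?red1 // !exprS redM IH. Qed.
Lemma red_omega : red omega = z. Proof. by rewrite /red /= add0r mul1r. Qed.

(** The kernel of the reduction is the ideal of w. With y = conje w * x, vanishing gives p |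
    [eim y]; the norm of y is p times that of x, so p | [ere y] as well. Thus y is p times some
    element, and multiplying by w cancels p. *)
Lemma red_eq0_dvde x : red x = 0 -> dvde w x.
Proof.
case: x => c d; rewrite /red /= => h.
have h1 : c%:~R * b - a * d%:~R = 0 :> F.
  have -> : c%:~R * b - a * d%:~R = (c%:~R + d%:~R * z) * b by rewrite /z -/a -/b; field.
  by rewrite h mul0r.
move: h1; rewrite -!rmorphM -rmorphB => /eqP; rewrite Fp_intr_eq0 // => /dvdzP[k ek].
pose y := conje w * Eis c d.
have ey : eim y = p%:Z * - k.
  by rewrite /y; case: (w) ek => e f /= ek; transitivity (- (c * f - e * d)); [ring | rewrite ek; ring].
have ny : normez y = p%:Z * normez (Eis c d).
  by rewrite /y normezM -normeE norme_conj nw.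
have : (p%:Z %| ere y ^+ 2)%Z.
  apply/dvdzP; exists (normez (Eis c d) - k * ere y - p%:Z * k ^+ 2).
  by move: ny; rewrite /normez ey => ny; move: ny; set Q := c ^+ 2 - _ + _; lia.
rewrite dvdzE abszX /= Euclid_dvdX // andbT => hX.
have /dvdzP[m em] : (p%:Z %| ere y)%Z by rewrite dvdzE.
exists (Eis m (- k)).
have p0 : p%:Z%:~R != 0 :> eis by rewrite eis_intr; apply/eqP => -[] e; have := prime_gt0 pp; lia.
apply: (eis_mulfI p0).
have ey2 : y = p%:Z%:~R * Eis m (- k).
  have -> : y = Eis (ere y) (eim y) by case: (y).
  by rewrite em ey eis_intr; congr Eis => /=; ring.
transitivity (w * y); first by rewrite /y mulrA mul_conje -normeE nw.
rewrite ey2; ring.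
Qed.

Lemma p3 : (p %% 3 = 1)%N. Proof. by rewrite -nw norme_primary_mod3. Qed.

Let e := (p.-1 %/ 3)%N.
Let e3 : (e * 3 = p.-1)%N.
Proof. by rewrite /e divnK //; have := p3; have := prime_gt0 pp; rewrite /dvdn; lia. Qed.
Let e_gt0 : (0 < e)%N. Proof. by have := e3; have := prime_gt1 pp; lia. Qed.

Lemma three_neq0 : 3 != 0 :> F.
Proof.
rewrite -[3]/(3%:R) -(dvdn_pcharf (pchar_Fp pp)) gtnNdvd //.
by have := p3; case: (p) p2 => [|[|[|[|]]]].
Qed.

Lemma zroot3 : z ^+ 3 = 1.
Proof.
apply/eqP; rewrite -subr_eq0.
have -> : z ^+ 3 - 1 = (z - 1) * (z ^+ 2 + z + 1) by ring.
by rewrite zroot_eq mulr0.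
Qed.
Lemma zroot_neq1 : z != 1.
Proof.
apply/eqP => h; have := zroot_eq; rewrite h expr1n => /eqP.
by have -> : 1 + 1 + 1 = 3 :> F; [ring | rewrite (negPf three_neq0)].
Qed.
Lemma zroot_neq0 : z != 0.
Proof. by apply/eqP => h; have := zroot3; rewrite h expr0n => /eqP; rewrite eq_sym oner_eq0. Qed.

Lemma Fermat (x : F) : x != 0 -> x ^+ p.-1 = 1.
Proof.
by move=> x0; apply: (mulfI x0); rewrite -exprS prednK ?prime_gt0 // mulr1 Fp_expp.
Qed.

Lemma cube_root_cases (u : F) : u ^+ 3 = 1 -> [\/ u = 1, u = z | u = z ^+ 2].
Proof.
move=> h; have : (u - 1) * ((u - z) * (u - z ^+ 2)) = 0.
  have -> : (u - z) * (u - z ^+ 2) = (u ^+ 2 + u + 1) - u * (z ^+ 2 + z + 1) + (z ^+ 3 - 1) by ring.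
  rewrite zroot_eq zroot3 mulr0 subr0 subrr addr0.
  have -> : (u - 1) * (u ^+ 2 + u + 1) = u ^+ 3 - 1 by ring.
  by rewrite h subrr.
move/eqP; rewrite !mulf_eq0 !subr_eq0 => /or3P[] /eqP ->; by constructor.
Qed.

(** The cubic residue symbol modulo w: the cube root of unity in Z[omega] that reduces to x^((p - 1)
    / 3), see [red_cubic]. *)
Definition cubic (x : F) : eis :=
  if x == 0 then 0 else if x ^+ e == 1 then 1 else if x ^+ e == z then omega else omega ^+ 2.
Local Notation chi := cubic.

Let exp_e (x : F) : x != 0 -> (x ^+ e) ^+ 3 = 1.
Proof. by move=> x0; rewrite -exprM e3 Fermat. Qed.

Lemma cubic_cases x : x != 0 -> [\/ chi x = 1, chi x = omega | chi x = omega ^+ 2].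
Proof.
move=> x0; rewrite /chi (negPf x0); case: ifP => _; first by constructor.
by case: ifP => _; constructor.
Qed.

Lemma red_cubic x : red (chi x) = x ^+ e.
Proof.
rewrite /chi; case: eqP => [->|/eqP x0].
  by rewrite red0 expr0n; case: (e) e_gt0.
case: eqP => [->|h1]; first exact: red1.
case: eqP => [->|h2]; first exact: red_omega.
rewrite redX red_omega.
by case: (cube_root_cases (exp_e x0)).
Qed.

(** The three cube roots of unity stay distinct modulo w, so identities between character values can
    be verified in ['F_p]. *)
Lemma red_root_inj x y :
  [\/ x = 1, x = omega | x = omega ^+ 2] -> [\/ y = 1, y = omega | y = omega ^+ 2] ->
  red x = red y -> x = y.
Proof.
have z1 := zroot_neq1; have z0 := zroot_neq0.
have zz : z ^+ 2 != z by rewrite expr2 -{3}[z]mulr1 (inj_eq (mulfI z0)).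
have zz1 : z ^+ 2 != 1.
  apply: contra z1 => /eqP h; have := zroot3; by rewrite exprS h mulr1 => ->.
by move=> [] -> [] -> //; rewrite ?redX ?red_omega ?red1 => /eqP; rewrite 1?eq_sym ?(negPf z1) ?(negPf zz) ?(negPf zz1) // 1?eq_sym ?(negPf z1) ?(negPf zz) ?(negPf zz1).
Qed.

Lemma cubic0 : chi 0 = 0. Proof. by rewrite /chi eqxx. Qed.
Lemma cubic1 : chi 1 = 1. Proof. by rewrite /chi oner_eq0 expr1n eqxx. Qed.

Lemma cubic_pow3 x : x != 0 -> chi x ^+ 3 = 1.
Proof. by case/cubic_cases => ->. Qed.

Lemma cubicM x y : chi (x * y) = chi x * chi y.
Proof.
have [->|x0] := eqVneq x 0; first by rewrite mul0r cubic0 mul0r.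
have [->|y0] := eqVneq y 0; first by rewrite mulr0 cubic0 mulr0.
have xy0 : x * y != 0 by rewrite mulf_neq0.
apply: red_root_inj; first exact: cubic_cases.
  case: (cubic_cases x0) => ->; case: (cubic_cases y0) => ->;
    by [constructor 1 | constructor 2 | constructor 3].
by rewrite redM !red_cubic exprMn.
Qed.

Lemma cubic_conj x : x != 0 -> chi x * conje (chi x) = 1.
Proof. by case/cubic_cases => ->. Qed.

Lemma cubicN1 : chi (-1) = 1.
Proof.
have h : chi (-1) * chi (-1) = 1 by rewrite -cubicM mulrNN mulr1 cubic1.
have := cubic_pow3 (_ : -1 != 0); rewrite oppr_eq0 oner_eq0 => /(_ isT).
by rewrite exprS expr2 h mulr1.
Qed.

Lemma exists_cubic_nontrivial : exists2 c, c != 0 & chi c != 1.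
Proof.
have [g hg] := ex_primitive_root pp p2; exists g; first exact: primitive_root_neq0 hg.
apply/eqP => h; have := red_cubic g; rewrite h red1 => /esym/eqP.
rewrite -(prim_order_dvd hg) => /dvdn_leq; have := e3; have := e_gt0; lia.
Qed.

Lemma sum_cubic : \sum_x chi x = 0.
Proof.
have [c c0 c1] := exists_cubic_nontrivial.
have : chi c * \sum_x chi x = \sum_x chi x.
  rewrite mulr_sumr [RHS](reindex (fun x => c * x)) /=.
    by apply: eq_bigr => x _; rewrite cubicM.
  by exists (fun x => c^-1 * x) => x _; rewrite ?mulKf ?mulVKf.
move/eqP; rewrite -subr_eq0 -{2}[\sum_x _]mul1r -mulrBl eis_mulf_eq0 subr_eq0 (negPf c1) /=.
by move/eqP.
Qed.

(** The cubic counterpart of [count_sqrt]. If the symbol of u = g^i is 1 then 3 divides i, and the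
    roots are x0, x0 z and x0 z^2 with x0 = g^(i / 3). *)
Lemma count_cubes (u : F) : \sum_x ((x ^+ 3 == u)%:R : eis) = 1 + chi u + conje (chi u).
Proof.
have [->|u0] := eqVneq u 0.
  rewrite cubic0 (bigD1 0) // [0 ^+ 3]expr0n /= big1 => [//|x x0].
  by rewrite expf_eq0 (negPf x0).
have [c1|c1] := eqVneq (chi u) 1; last first.
  rewrite big1.
    by case: (cubic_cases u0) c1 => ->; rewrite ?eqxx.
  move=> x _; case: eqP => // ex; case/eqP: c1; rewrite -ex.
  have x0 : x != 0 by apply: contraNneq u0 => x0; rewrite -ex x0 expr0n.
  by rewrite !exprS expr0 mulr1 !cubicM -(cubic_pow3 x0); ring.
have [g hg] := ex_primitive_root pp p2.
have [i ei] := primitive_root_exp pp hg u0.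
have : (3 %| i)%N.
  have := red_cubic u; rewrite c1 red1 ei -exprM => /esym/eqP.
  by rewrite -(prim_order_dvd hg) -e3 mulnC dvdn_pmul2r.
case/dvdnP => j ej; set x0 := g ^+ j.
have ex : x0 ^+ 3 = u by rewrite -exprM -ej.
have x00 : x0 != 0 by rewrite expf_neq0 // (primitive_root_neq0 pp p2 hg).
have z0 := zroot_neq0; have z1 := zroot_neq1.
have zz : z ^+ 2 != z by rewrite expr2 -{3}[z]mulr1 (inj_eq (mulfI z0)).
have zz1 : z ^+ 2 != 1.
  apply: contra z1 => /eqP h; have := zroot3; by rewrite exprS h mulr1 => ->.
have nxz : x0 * z != x0 by rewrite -{2}[x0]mulr1 (inj_eq (mulfI x00)).
have nxz2 : x0 * z ^+ 2 != x0 by rewrite -{2}[x0]mulr1 (inj_eq (mulfI x00)).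
have nxzz : x0 * z ^+ 2 != x0 * z by rewrite (inj_eq (mulfI x00)).
rewrite (bigD1 x0) //= (bigD1 (x0 * z)) //= (bigD1 (x0 * z ^+ 2)) /=; last by rewrite nxz2 nxzz.
have z6 : (z ^+ 2) ^+ 3 = 1 by rewrite -exprM mulnC exprM zroot3 expr1n.
rewrite (exprMn 3 x0 z) (exprMn 3 x0 (z ^+ 2)) z6 zroot3 !mulr1 ex eqxx big1 ?addr0.
  by rewrite c1 addrA.
move=> x /andP[/andP[h1 h2] h3]; case: eqP => // ex3.
have h : (x / x0) ^+ 3 = 1 by rewrite expr_div_n ex3 ex divff.
have xx : x = x0 * (x / x0) by rewrite mulrC divfK.
by case: (cube_root_cases h) => hh; rewrite hh in xx; move: h1 h2 h3; rewrite xx ?mulr1 eqxx.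
Qed.

Lemma sum_pow j : (0 < j < p.-1)%N -> \sum_(x : F) x ^+ j = 0.
Proof.
move=> /andP[j0 jp]; have [g hg] := ex_primitive_root pp p2.
have g0 := primitive_root_neq0 pp p2 hg.
have : g ^+ j * \sum_(x : F) x ^+ j = \sum_(x : F) x ^+ j.
  rewrite mulr_sumr [RHS](reindex (fun x => g * x)) /=.
    by apply: eq_bigr => x _; rewrite exprMn.
  by exists (fun x => g^-1 * x) => x _; rewrite ?mulKf ?mulVKf.
move/eqP; rewrite -subr_eq0 -{2}[\sum_x _]mul1r -mulrBl mulf_eq0 subr_eq0.
rewrite -(prim_order_dvd hg) => /orP[/dvdn_leq|/eqP //]; lia.
Qed.

Definition jacobi : eis := \sum_(x : F) chi x * chi (1 - x).
Local Notation J := jacobi.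

(** J reduces to the sum of x^e (1 - x)^e with e = (p - 1) / 3. Every exponent that occurs lies
    between e and 2 e, strictly between 0 and p - 1, so each power sum vanishes. *)
Lemma red_jacobi : red J = 0.
Proof.
rewrite /J red_sum.
transitivity (\sum_(x : F) \sum_(i < e.+1) (-1) ^+ i * 'C(e, i)%:R * x ^+ (e + i)).
  apply: eq_bigr => x _; rewrite redM !red_cubic exprBn mulr_sumr; apply: eq_bigr => i _.
  by rewrite expr1n mulr1 exprD -mulr_natr; ring.
rewrite exchange_big big1 //= => i _; rewrite -mulr_sumr sum_pow ?mulr0 //.
by have := ltn_ord i; have := e3; have := e_gt0; lia.
Qed.

Lemma sum_conj_cubic : \sum_x conje (chi x) = 0.
Proof.
have -> : \sum_x conje (chi x) = conje (\sum_x chi x).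
  by elim/big_rec2: _ => [//|x u v _ ->]; rewrite conjeD.
by rewrite sum_cubic.
Qed.

Lemma conj_cubic_sqr x : conje (chi x) = chi x ^+ 2.
Proof.
have [->|x0] := eqVneq x 0; first by rewrite cubic0.
by case: (cubic_cases x0) => ->.
Qed.

Lemma conj_cubicV x : conje (chi x) = chi x^-1.
Proof.
have [->|x0] := eqVneq x 0; first by rewrite invr0 cubic0.
have h : chi x * chi x^-1 = 1 by rewrite -cubicM divff // cubic1.
by rewrite -[LHS]mulr1 -h mulrA [conje _ * _]mulrC cubic_conj // mul1r.
Qed.

Lemma sum_one_eis : \sum_(x : F) 1 = p%:R :> eis.
Proof. by rewrite sumr_const card_F. Qed.

(** In J times its conjugate, putting x = y t cancels chi(y) against its conjugate and leaves chi(t)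
    times an inner sum over y <> 0. That sum is p - 2 at t = 1 and - chi(t) - 1 elsewhere. *)
Lemma norm_jacobi : norme J = p.
Proof.
have : J * conje J = p%:R; last first.
  rewrite mul_conje -normeE => h; have := congr1 ere h.
  by rewrite [p%:R in RHS]pmulrn !eis_intr /= => -[].
have -> : conje J = \sum_(y : F) conje (chi y) * conje (chi (1 - y)).
  rewrite /J; elim/big_rec2: _ => [//|x u v _ h]; by rewrite conjeD conjeM h.
transitivity (\sum_(t : F) chi t * \sum_(y : F) chi (1 - y * t) * conje (chi (1 - y)) * (y != 0)%:R).
  rewrite mulr_sumr.
  transitivity (\sum_(y : F) \sum_(t : F) chi t * (chi (1 - y * t) * conje (chi (1 - y)) * (y != 0)%:R)).
    apply: eq_bigr => y _; have [->|y0] := eqVneq y 0.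
      rewrite cubic0 [conje 0](_ : _ = 0) // mul0r mulr0 big1 // => t _; by rewrite !mulr0.
    rewrite /J mulr_suml (reindex (fun t => y * t)) /=; last first.
      by exists (fun x => y^-1 * x) => x _; rewrite ?mulKf ?mulVKf.
    apply: eq_bigr => t _; rewrite cubicM mulr1.
    transitivity (chi y * conje (chi y) * (chi t * (chi (1 - y * t) * conje (chi (1 - y))))); first by ring.
    by rewrite cubic_conj // mul1r.
  by rewrite exchange_big; apply: eq_bigr => t _; rewrite mulr_sumr.
have inner t : t != 1 -> \sum_(y : F) chi (1 - y * t) * conje (chi (1 - y)) * (y != 0)%:R = - chi t - 1.
  move=> t1; have t10 : 1 - t != 0 by rewrite subr_eq0 eq_sym.
  (* Since [0^-1] is 0, the map s -> 1 - 1 / s permutes the whole field; it sends s = 0 to y = 1 and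
     s = 1 to y = 0. It turns the quotient of 1 - y t by 1 - y into an affine function of s. *)
  rewrite (reindex (fun s => 1 - s^-1)) /=; last first.
    by exists (fun y => (1 - y)^-1) => y _; rewrite ?subKr ?invrK ?subKr.
  transitivity (\sum_(s : F) (chi (t + (1 - t) * s) - (s == 0)%:R * chi t - (s == 1)%:R)).
    apply: eq_bigr => s _; have [->|s0] := eqVneq s 0.
      have c0 : conje (chi (1 - (1 - 0^-1))) = 0 by rewrite invr0 subr0 subrr cubic0.
      by rewrite c0 mulr0 mul0r mulr0 !addr0 mul1r subrr.
    rewrite mul0r subr0 subr_eq0 subKr -[1 == s^-1](inj_eq (@invr_inj F)) invr1 invrK eq_sym conj_cubicV invrK.
    have -> : chi (1 - (1 - s^-1) * t) * chi s = chi (t + (1 - t) * s).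
      by rewrite -cubicM; congr chi; field.
    have [->|s1] := eqVneq s 1; last by rewrite mulr1 subr0.
    by rewrite mulr1 addrC subrK cubic1 subrr mulr0.
  rewrite !sumrB; have -> : \sum_(s : F) chi (t + (1 - t) * s) = 0.
    rewrite -[RHS]sum_cubic [RHS](reindex (fun s => t + (1 - t) * s)) //.
    exists (fun x => (x - t) / (1 - t)) => s _; first by rewrite addrC addKr mulrC mulKf.
    by rewrite mulrC divfK // addrC subrK.
  rewrite (bigD1 0) //= ?eqxx mul1r big1 ?addr0; last by move=> s /negPf ->; rewrite mul0r.
  rewrite (bigD1 1) //= big1 ?addr0; last by move=> s /negPf ->.
  by rewrite ?eqxx sub0r.
rewrite (bigD1 1) //= cubic1 mul1r.
have -> : \sum_(y : F) chi (1 - y * 1) * conje (chi (1 - y)) * (y != 0)%:R = p%:R - 1 - 1.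
  transitivity (\sum_(y : F) (1 - (y == 0)%:R - (y == 1)%:R : eis)).
    apply: eq_bigr => y _; rewrite mulr1; have [->|y1] := eqVneq y 1.
      by rewrite subrr cubic0 !mul0r oner_eq0 subr0 subrr.
    rewrite cubic_conj ?mul1r; last by rewrite subr_eq0 eq_sym.
    by case: (y == 0); rewrite subr0 ?subrr ?subr0.
  rewrite !sumrB sum_one_eis; congr (_ - _ - _).
    by rewrite (bigD1 0) //= ?eqxx big1 ?addr0 // => y /negPf ->.
  by rewrite (bigD1 1) //= ?eqxx big1 ?addr0 // => y /negPf ->.
rewrite (eq_bigr (fun t => - conje (chi t) - chi t)); last first.
  by move=> t t1; rewrite inner // conj_cubic_sqr; ring.
rewrite sumrB sumrN.
have := sum_conj_cubic; rewrite (bigD1 1) //= cubic1 => /eqP; rewrite addrC addr_eq0 => /eqP ->.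
have := sum_cubic; rewrite (bigD1 1) //= cubic1 => /eqP; rewrite addrC addr_eq0 => /eqP ->.
have -> : conje 1 = 1 by [].
ring.
Qed.

(* [p + J] is the sum of the [(1 - chi x) (1 - chi (1 - x))], each divisible by [(1 - omega)^2 = - 3 omega]. *)
Lemma jacobi_primary : primary (- J).
Proof.
have : exists y, \sum_(x : F) (1 - chi x) * (1 - chi (1 - x)) = y *+ 3.
  apply: (big_ind (fun s => exists y, s = y *+ 3)) => [|u v [y ->] [y' ->]|x _].
  - by exists 0; rewrite mul0rn.
  - by exists (y + y'); rewrite mulrnDl.
  have [->|x0] := eqVneq x 0; first by exists 0; rewrite (subr0 (1 : F)) cubic1 subrr mulr0 mul0rn.
  have [->|x1] := eqVneq x 1; first by exists 0; rewrite cubic1 subrr mul0r mul0rn.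
  have x10 : 1 - x != 0 by rewrite subr_eq0 eq_sym.
  case: (cubic_cases x0) => ->; case: (cubic_cases x10) => ->.
  - by exists 0.
  - by exists 0.
  - by exists 0.
  - by exists 0.
  - by exists (- omega).
  - by exists (1 : eis).
  - by exists 0.
  - by exists (1 : eis).
  - by exists (- omega ^+ 2).
move=> [y ey]; apply/primaryP.
have ek : p%:R = 1 + (p %/ 3)%:R *+ 3 :> eis.
  by rewrite {1}(divn_eq p 3) p3 natrD natrM mulr_natr addrC.
exists ((p %/ 3)%:R - y).
have eJ : \sum_(x : F) (1 - chi x) * (1 - chi (1 - x)) = p%:R + J.
  transitivity (\sum_(x : F) (1 - chi x - chi (1 - x) + chi x * chi (1 - x))).
    by apply: eq_bigr => x _; ring.
  rewrite big_split /= -/J !sumrB sum_one_eis sum_cubic subr0.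
  have -> : \sum_(x : F) chi (1 - x) = 0; last by rewrite subr0.
  rewrite -[RHS]sum_cubic [RHS](reindex (fun x => 1 - x)) //.
  by exists (fun x => 1 - x) => x _; rewrite subKr.
have -> : - J = p%:R - y *+ 3 by rewrite -ey eJ; ring.
rewrite ek; ring.
Qed.

Lemma jacobiE : J = - w.
Proof.
have [u eu] := red_eq0_dvde red_jacobi.
have pJ := jacobi_primary; have p0 := prime_gt0 pp.
have u1 : norme u = 1%N.
  apply/eqP; rewrite -(eqn_pmul2r p0) mul1n -{1}nw -normeM -eu norm_jacobi //.
have nu1 : norme (- u) = 1%N by rewrite -u1 -[- u]mulN1r normeM mul1n.
have pu : primary (- u) by apply: (primary_divr pw); rewrite mulrC mulNr -eu.
by rewrite eu -[u]opprK (primary_unit pu nu1) mulNr mul1r.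
Qed.

(** Counting cube roots writes the sum as K + conj K, where K is the sum of eta(4 u + 1) chi(u); the
    part without chi vanishes. Then K = J = - w, and the right-hand side is minus the trace of w. *)
Theorem Ssum_primary : Ssum p = eim w - 2 * ere w.
Proof.
have h4 : 4 != 0 :> F by have -> : 4 = 2 * 2 :> F; [ring | rewrite mulf_neq0 ?two_neq0].
pose K := \sum_(u : F) (eta (4 * u + 1))%:~R * chi u : eis.
have eS : (Ssum p)%:~R = K + conje K.
  have -> : conje K = \sum_(u : F) (eta (4 * u + 1))%:~R * conje (chi u).
    rewrite /K; elim/big_rec2: _ => [//|x u v _ h]; rewrite conjeD conjeM h; congr (_ * _ + _).
    by rewrite eis_intr /conje /= subr0 oppr0.
  transitivity (\sum_(u : F) (eta (4 * u + 1))%:~R * (1 + chi u + conje (chi u)) : eis); last first.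
    rewrite -big_split /=.
    transitivity (\sum_(u : F) ((eta (4 * u + 1))%:~R + ((eta (4 * u + 1))%:~R * chi u +
      (eta (4 * u + 1))%:~R * conje (chi u))) : eis).
      by apply: eq_bigr => u _; ring.
    by rewrite big_split /= -rmorph_sum /= (sum_eta_affine pp p2) // rmorph0 add0r.
  under [RHS]eq_bigr do rewrite -count_cubes mulr_sumr.
  rewrite exchange_big /= /Ssum rmorph_sum /=; apply: eq_bigr => x _.
  rewrite (bigD1 (x ^+ 3)) //= ?eqxx mulr1 big1 ?addr0 // => u /negPf.
  by rewrite eq_sym => ->; rewrite mulr0.
(* The equation x (1 - x) = v has discriminant 1 - 4 v, so 1 + eta(1 - 4 v) counts its solutions;
   the sign in u = - v is harmless because chi(-1) = 1. *)
have KJ : K = J.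
  transitivity (\sum_(v : F) chi v * (1 + eta (1 - 4 * v))%:~R : eis).
    rewrite /K (reindex (fun v => - v)) /=; last by exists (fun v => - v) => v _; rewrite opprK.
    transitivity (\sum_(v : F) (chi v * (eta (1 - 4 * v))%:~R : eis)).
      apply: eq_bigr => v _; rewrite -[- v]mulN1r cubicM cubicN1 mul1r mulrC; congr (_ * (eta _)%:~R); ring.
    rewrite -[LHS]add0r -[X in X + _]sum_cubic -big_split; apply: eq_bigr => v _ /=.
    by rewrite rmorphD /=; ring.
  transitivity (\sum_(v : F) \sum_(x : F) chi v * ((x * (1 - x) == v)%:R : eis)).
    apply: eq_bigr => v _; rewrite -mulr_sumr; congr (_ * _).
    rewrite -(count_sqrt pp p2) rmorph_sum /=.
    rewrite (reindex (fun x => 2 * x - 1)) /=; last first.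
      have t0 := two_neq0 pp p2.
      by exists (fun y => (y + 1) / 2) => x _; [rewrite subrK mulrC mulKf | rewrite mulrC divfK // addrK].
    apply: eq_bigr => x _; rewrite rmorph_nat; congr ((nat_of_bool _)%:R).
    rewrite -[LHS]subr_eq0 -[RHS]subr_eq0.
    have -> : (2 * x - 1) ^+ 2 - (1 - 4 * v) = - 4 * (x * (1 - x) - v) by ring.
    by rewrite mulf_eq0 oppr_eq0 (negPf h4).
  rewrite exchange_big /J /=; apply: eq_bigr => x _.
  rewrite (bigD1 (x * (1 - x))) //= ?eqxx mulr1 big1 ?addr0 ?cubicM // => v /negPf.
  by rewrite eq_sym => ->; rewrite mulr0.
move: eS; rewrite KJ jacobiE eis_intr => /(congr1 ere).
by case: (w) => c d /= ->; ring.
Qed.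

End Reduction.

(** * Dirichlet convolution *)

Section Convolution.
Variable R : comNzRingType.
Implicit Types f g h : nat -> R.

Definition conv f g n : R :=
  \sum_(1 <= i < n.+1) \sum_(1 <= j < n.+1 | (i * j == n)%N) f i * g j.

(** A range common to all n <= N, so that the sums over n, i and j can be interchanged. *)
Lemma conv_widen f g n N : (0 < n <= N)%N ->
  conv f g n = \sum_(1 <= i < N.+1) \sum_(1 <= j < N.+1 | (i * j == n)%N) f i * g j.
Proof.
move=> /andP[n0 nN].
have inner i : \sum_(1 <= j < N.+1 | (i * j == n)%N) f i * g j =
               \sum_(1 <= j < n.+1 | (i * j == n)%N) f i * g j.
  rewrite (big_cat_nat (n := n.+1)) //= [X in _ + X]big_nat_cond [X in _ + X]big1 ?addr0 //.
  move=> j /andP[h1 /eqP h2]; exfalso; have : (i = 0 \/ j <= i * j)%N by nia.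
  by case=> h3; nia.
rewrite (big_cat_nat (n := n.+1)) //= [X in _ = _ + X]big_nat_cond [X in _ = _ + X]big1.
  by rewrite addr0; apply: eq_bigr => i _.
move=> i hi; rewrite big_nat_cond big1 // => j /andP[h1 /eqP h2]; exfalso.
have h3 : (j = 0 \/ i <= i * j)%N by nia.
by case: h3 => h3; nia.
Qed.

Lemma eq_conv f f' g g' n : (forall i, (0 < i)%N -> f i = f' i) ->
  (forall i, (0 < i)%N -> g i = g' i) -> conv f g n = conv f' g' n.
Proof.
move=> hf hg; apply: eq_big_nat => i /andP[i0 _].
rewrite big_nat_cond [RHS]big_nat_cond; apply: eq_bigr => j /andP[/andP[j0 _] _].
by rewrite hf // hg.
Qed.

Lemma convC f g n : conv f g n = conv g f n.
Proof.
rewrite /conv; under eq_bigr do rewrite big_mkcond.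
rewrite exchange_big /=; apply: eq_bigr => i _.
rewrite [RHS]big_mkcond; apply: eq_bigr => j _.
by rewrite mulnC mulrC.
Qed.

Lemma sum_nat_eq (F : nat -> R) m n k :
  \sum_(m <= i < n | (k == i)%N) F i = if (m <= k < n)%N then F k else 0.
Proof.
under eq_bigl do rewrite eq_sym.
rewrite -big_filter; have -> : [seq i <- index_iota m n | i == k] =
    if (m <= k < n)%N then [:: k] else [::].
  rewrite -(mem_index_iota m n); case: ifP => h.
    by rewrite filter_pred1_uniq ?iota_uniq.
  by apply/eqP; rewrite -(negbK (_ == _)) -has_filter; apply/negP => /hasP[x + /eqP xk]; rewrite xk h.
by case: ifP; rewrite ?big_seq1 ?big_nil.
Qed.

Lemma convA f g h n : (0 < n)%N -> conv f (conv g h) n = conv (conv f g) h n.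
Proof.
move=> n0.
have -> : conv f (conv g h) n = \sum_(1 <= i < n.+1) \sum_(1 <= j < n.+1)
   \sum_(1 <= k < n.+1 | (i * (j * k) == n)%N) f i * (g j * h k).
  apply: eq_big_nat => i /andP[i0 _].
  transitivity (\sum_(1 <= l < n.+1 | (i * l == n)%N) \sum_(1 <= j < n.+1)
     \sum_(1 <= k < n.+1 | (j * k == l)%N) f i * (g j * h k)).
    rewrite big_nat_cond [RHS]big_nat_cond; apply: eq_bigr => l hl.
    rewrite (@conv_widen _ _ _ n); last by lia.
    by rewrite mulr_sumr; apply: eq_bigr => j _; rewrite mulr_sumr.
  rewrite exchange_big /=; apply: eq_big_nat => j /andP[j0 _].
  rewrite [LHS](exchange_big_dep xpredT) //= [RHS]big_mkcond /=.
  apply: eq_big_nat => k /andP[k0 kn].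
  transitivity (\sum_(1 <= l < n.+1 | (j * k == l)%N) (if (i * l == n)%N then f i * (g j * h k) else 0)).
    by rewrite -big_mkcondr; apply: eq_bigl => l; rewrite andbC.
  have h0 : (0 < j * k)%N by rewrite muln_gt0 j0.
  have h3 : (j * k <= i * (j * k))%N by rewrite leq_pmull.
  by rewrite sum_nat_eq; case: ifP => h1; case: eqP => h2 //; lia.
transitivity (\sum_(1 <= k < n.+1) \sum_(1 <= i < n.+1) \sum_(1 <= j < n.+1 | (i * (j * k) == n)%N)
    f i * (g j * h k)).
  rewrite [RHS]exchange_big /=; apply: eq_bigr => i _.
  by under eq_bigr do rewrite big_mkcond; rewrite exchange_big /=; apply: eq_bigr => k _; rewrite -big_mkcond.
rewrite [RHS]convC; apply: eq_big_nat => k /andP[k0 _].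
transitivity (\sum_(1 <= l < n.+1 | (k * l == n)%N) \sum_(1 <= i < n.+1)
     \sum_(1 <= j < n.+1 | (i * j == l)%N) f i * (g j * h k)); last first.
  rewrite big_nat_cond [RHS]big_nat_cond; apply: eq_bigr => l hl.
  rewrite (@conv_widen _ _ _ n); last by lia.
  rewrite mulr_sumr; apply: eq_bigr => j _; rewrite mulr_sumr; apply: eq_bigr => i _; ring.
rewrite exchange_big /=; apply: eq_big_nat => i /andP[i0 _].
rewrite [RHS](exchange_big_dep xpredT) //= [LHS]big_mkcond /=.
apply: eq_big_nat => j /andP[j0 _].
transitivity (\sum_(1 <= l < n.+1 | (i * j == l)%N) (if (k * l == n)%N then f i * (g j * h k) else 0)).
  have -> : (i * (j * k) = k * (i * j))%N by lia.
  have h0 : (0 < i * j)%N by rewrite muln_gt0 i0.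
  have h3 : (i * j <= k * (i * j))%N by rewrite leq_pmull.
  rewrite sum_nat_eq. by case: ifP => h1; case: ifP => h2 //; lia.
by rewrite -big_mkcondr; apply: eq_bigl => l; rewrite andbC.
Qed.

Definition delta n : R := (n == 1%N)%:R.

Lemma conv_delta f n : (0 < n)%N -> conv delta f n = f n.
Proof.
move=> n0; rewrite /conv big_ltn; last by lia.
rewrite [X in _ + X]big_nat_cond [X in _ + X]big1 ?addr0; last first.
  by move=> i hi; rewrite big1 // => j _; rewrite /delta; case: eqP; [lia | rewrite mul0r].
under eq_bigl do rewrite mul1n eq_sym.
by rewrite sum_nat_eq ifT ?mul1r //; lia.
Qed.

Lemma sum_conv f g N : \sum_(1 <= n < N.+1) conv f g n =
  \sum_(1 <= i < N.+1) f i * \sum_(1 <= j < (N %/ i).+1) g j.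
Proof.
transitivity (\sum_(1 <= n < N.+1) \sum_(1 <= i < N.+1)
   \sum_(1 <= j < N.+1 | (i * j == n)%N) f i * g j).
  by apply: eq_big_nat => n hn; apply: conv_widen; lia.
rewrite exchange_big /=; apply: eq_big_nat => i /andP[i0 _].
rewrite (exchange_big_dep xpredT) //=.
under eq_bigr do rewrite sum_nat_eq.
have leN : ((N %/ i).+1 <= N.+1)%N by rewrite ltnS leq_div.
rewrite (big_cat_nat (n := (N %/ i).+1)) //= [X in _ + X]big_nat_cond [X in _ + X]big1 ?addr0; last first.
  move=> j /andP[/andP[h _] _]; rewrite ifF //; apply/negbTE.
  by move: h; rewrite ltn_divLR // => h; lia.
rewrite mulr_sumr; apply: eq_big_nat => j /andP[j0].
by rewrite ltnS leq_divRL // mulnC => h; rewrite ifT //; nia.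
Qed.

(** The Dirichlet inverse by course-of-values recursion. The equation [conv m a n = delta n] is
    solved for its last term m(n) a(1), with a(1) = 1; the earlier values are kept in a list to make
    the recursion structural. *)
Fixpoint inv_list (a : nat -> R) N : seq R :=
  if N is N'.+1 then
    let s := inv_list a N' in
    rcons s (delta N' - \sum_(1 <= i < N') \sum_(1 <= j < N'.+1 | (i * j == N')%N) s`_i * a j)
  else [::].

Definition dinv a n : R := (inv_list a n.+1)`_n.

Lemma size_inv_list a N : size (inv_list a N) = N.
Proof. by elim: N => //= N IH; rewrite size_rcons IH. Qed.

Lemma nth_inv_list a N i : (i < N)%N -> (inv_list a N)`_i = dinv a i.
Proof.
elim: N => // N IH; rewrite ltnS leq_eqVlt => /predU1P[-> //|h].
by rewrite /= nth_rcons size_inv_list h IH.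
Qed.

Lemma conv_dinv a n : a 1%N = 1 -> (0 < n)%N -> conv (dinv a) a n = delta n.
Proof.
move=> a1 n0; rewrite /conv big_nat_recr //=.
have -> : \sum_(1 <= j < n.+1 | (n * j == n)%N) dinv a n * a j = dinv a n.
  rewrite (eq_bigl (fun j => 1 == j)%N).
    by rewrite sum_nat_eq ifT ?a1 ?mulr1 //; lia.
  by move=> j; rewrite -{2}[n]muln1 eqn_pmul2l // eq_sym.
rewrite {2}/dinv /= nth_rcons size_inv_list ltnn eqxx.
rewrite [X in _ - X](_ : _ = \sum_(1 <= i < n) \sum_(1 <= j < n.+1 | (i * j == n)%N) dinv a i * a j); first by ring.
by apply: eq_big_nat => i /andP[_ hi]; apply: eq_bigr => j _; rewrite nth_inv_list.
Qed.

End Convolution.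

(** * Multiplication by the logarithm as a derivation *)

Section LogDerivation.
Variable R : realType.
Implicit Types a b f g w : nat -> R.

Definition mulln f n : R := f n * ln n%:R.

(** The Leibniz rule, from ln(i j) = ln i + ln j: on Dirichlet series [mulln] is - d/ds. *)
Lemma conv_mulln f g n :
  conv f g n * ln n%:R = conv (mulln f) g n + conv f (mulln g) n.
Proof.
rewrite /conv -big_split mulr_suml /=; apply: eq_big_nat => i /andP[i0 _].
rewrite -big_split mulr_suml /= big_nat_cond [RHS]big_nat_cond.
apply: eq_bigr => j /andP[/andP[j0 _] /eqP <-].
by rewrite natrM lnM ?posrE ?ltr0n // /mulln; ring.
Qed.

Variables a b : nat -> R.
Hypothesis a1 : a 1%N = 1.
Hypothesis ab : forall n, (0 < n)%N -> conv b a n = mulln a n.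
Local Notation m := (dinv a).

(** If [a] has Dirichlet series L, the hypothesis [ab] makes [b] the coefficients of - L' / L, here
    recovered as the product of 1 / L and - L'. *)
Lemma conv_dinv_mulln n : (0 < n)%N -> conv m (mulln a) n = b n.
Proof.
move=> n0; transitivity (conv m (conv b a) n).
  by apply: eq_conv => // i i0; rewrite ab.
rewrite (eq_conv (g' := conv a b) (f' := m)) //; last by move=> i _; rewrite convC.
rewrite convA // (eq_conv (f' := delta R) (g' := b)) ?conv_delta // => i i0.
exact: conv_dinv.
Qed.

(** The coefficient form of (1 / L)' = - (L' / L) (1 / L). *)
Lemma dinv_mulln n : (0 < n)%N -> mulln m n = - conv b m n.
Proof.
have H i : (0 < i)%N -> conv (mulln m) a i = - b i.
  move=> i0; have := conv_mulln m a i; rewrite conv_dinv // conv_dinv_mulln // /delta.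
  by case: eqP => [->|_]; rewrite ?ln1 ?mulr0 ?mul0r => /eqP; rewrite eq_sym addr_eq0 => /eqP.
move=> n0; transitivity (conv (mulln m) (conv a m) n).
  rewrite convC (eq_conv (f' := delta R) (g' := mulln m)) ?conv_delta // => i i0.
  by rewrite convC conv_dinv.
rewrite convA // (eq_conv (f' := fun i => - b i) (g' := m)) // /conv -sumrN.
by apply: eq_bigr => i _; rewrite -sumrN; apply: eq_bigr => j _; rewrite mulNr.
Qed.

(* Strong induction on [m ln = - b * m] replaces the explicit Moebius function. *)
Lemma dinv_le (b0 w : nat -> R) : w 1%N = 1 -> (forall n, 0 <= w n) ->
  (forall n, (0 < n)%N -> conv b0 w n = mulln w n) ->
  (forall n, `|b n| <= b0 n) -> forall n, (0 < n)%N -> `|m n| <= w n.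
Proof.
move=> w1 w0 bw bb0.
have b01 : b0 1%N = 0.
  by have := bw 1%N isT; rewrite /mulln ln1 mulr0 /conv big_nat1 big_mkcond big_nat1 /= w1 mulr1.
have b1 : b 1%N = 0.
  by have := bb0 1%N; rewrite b01 normr_le0 => /eqP.
have m1 : m 1%N = 1.
  by have := conv_dinv a1 (ltnSn 0); rewrite /conv big_nat1 big_mkcond big_nat1 /= a1 mulr1.
elim/ltn_ind => n IH n0; have [n1|n1] := leqP n 1.
  by have -> : n = 1%N by [lia]; rewrite m1 w1 normr1.
have ln0 : 0 < ln n%:R :> R by rewrite ln_gt0 // ltr1n.
rewrite -(ler_pM2r ln0) -[X in _ * X]gtr0_norm // -normrM -/(mulln m n) dinv_mulln // normrN.
rewrite (_ : w n * _ = conv b0 w n); last by rewrite bw // gtr0_norm.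
rewrite /conv.
apply: le_trans (ler_norm_sum _ _ _) _; rewrite big_nat_cond [leRHS]big_nat_cond.
apply: ler_sum => i /andP[/andP[i0 _] _].
apply: le_trans (ler_norm_sum _ _ _) _; rewrite big_nat_cond [leRHS]big_nat_cond.
apply: ler_sum => j /andP[/andP[j0 jn] /eqP ij].
have [i1|i1] := leqP i 1.
  by have -> : i = 1%N by [lia]; rewrite b1 b01 !mul0r normr0.
by rewrite normrM ler_pM // IH //; nia.
Qed.

End LogDerivation.

(** * Partial summation and Shapiro's method *)

Section Abel.
Variable R : realType.
Implicit Types a f u v : nat -> R.

(** Nested intervals: u - v increases and u + v decreases, so the supremum of u - v lies within v(n)
    of u(n) for every n. The limit thus comes with an explicit rate. *)
Lemma telescoping_limit u v : (forall n, 0 <= v n) ->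
  (forall n, (0 < n)%N -> `|u n.+1 - u n| <= v n - v n.+1) ->
  exists L, forall n, (0 < n)%N -> `|u n - L| <= v n.
Proof.
move=> v0 uv.
have inc n k : (0 < n)%N -> u n - v n <= u (n + k)%N - v (n + k)%N.
  move=> n0; elim: k => [|k IH]; first by rewrite addn0.
  apply: le_trans IH _; rewrite addnS; have := uv (n + k)%N ltac:(lia).
  by rewrite ler_norml => /andP[]; lra.
have dec n k : (0 < n)%N -> u (n + k)%N + v (n + k)%N <= u n + v n.
  move=> n0; elim: k => [|k IH]; first by rewrite addn0.
  apply: le_trans _ IH; rewrite addnS; have := uv (n + k)%N ltac:(lia).
  by rewrite ler_norml => /andP[]; lra.
have cmp n k : (0 < n)%N -> (0 < k)%N -> u n - v n <= u k + v k.
  move=> n0 k0; have := inc n k n0; have := dec k n k0; rewrite addnC.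
  by have := v0 (n + k)%N; lra.
pose E : set R := [set x | exists2 n, (0 < n)%N & x = u n - v n]%classic.
have E0 : (E !=set0)%classic by exists (u 1%N - v 1%N), 1%N.
have ubE k : (0 < k)%N -> ubound E (u k + v k).
  by move=> k0 x [n n0 ->]; apply: cmp.
exists (sup E) => n n0; rewrite ler_norml.
have h1 : sup E <= u n + v n by apply: ge_sup => //; apply: ubE.
have h2 : u n - v n <= sup E.
  by apply: ub_le_sup; [exists (u 1%N + v 1%N); apply: ubE | exists n].
by apply/andP; split; lra.
Qed.

(** The fourth root. Its integer powers express all the error terms, and one factor of it dominates
    a logarithm, by [ln_le_rt4]. *)
Definition rt4 (x : R) : R := Num.sqrt (Num.sqrt x).

Lemma rt4X x : 0 <= x -> rt4 x ^+ 4 = x.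
Proof. by move=> x0; rewrite (exprM _ 2 2) !sqr_sqrtr ?sqrtr_ge0. Qed.
Lemma rt4X2 x : 0 <= x -> rt4 x ^+ 2 = Num.sqrt x.
Proof. by move=> x0; rewrite sqr_sqrtr ?sqrtr_ge0. Qed.
Lemma rt4_ge0 x : 0 <= rt4 x. Proof. exact: sqrtr_ge0. Qed.
Lemma rt4_gt0 x : 0 < x -> 0 < rt4 x. Proof. by move=> x0; rewrite !sqrtr_gt0. Qed.
Lemma rt4_ge1 x : 1 <= x -> 1 <= rt4 x.
Proof. by move=> x1; rewrite -sqrtr1 ler_wsqrtr // -sqrtr1 ler_wsqrtr. Qed.
Lemma ler_rt4 x y : x <= y -> rt4 x <= rt4 y.
Proof. by move=> xy; rewrite !ler_wsqrtr. Qed.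
Lemma rt4M x y : 0 <= x -> rt4 (x * y) = rt4 x * rt4 y.
Proof. by move=> x0; rewrite /rt4 sqrtrM // sqrtrM ?sqrtr_ge0. Qed.

Lemma ln_le_subr1 (x : R) : 0 < x -> ln x <= x - 1.
Proof. by move=> x0; have := @le_ln1Dx R (x - 1); rewrite addrCA subrr addr0; apply; lra. Qed.

Lemma ln_le_rt4 x : 1 <= x -> ln x <= 4 * rt4 x.
Proof.
move=> x1; have r0 : 0 < rt4 x by apply: rt4_gt0; lra.
rewrite -{1}(@rt4X x); last by lra.
by rewrite lnXn // -mulr_natl; have := ln_le_subr1 r0; lra.
Qed.

Lemma rt4_incr n : (0 < n)%N -> (rt4 n%:R)^-1 - (rt4 n.+1%:R)^-1 >=
   1 / (4 * rt4 n%:R * n.+1%:R).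
Proof.
move=> n0.
have s0 : 0 < rt4 n%:R by rewrite rt4_gt0 // ltr0n.
have t0 : 0 < rt4 n.+1%:R by rewrite rt4_gt0 // ltr0n.
have st : rt4 n%:R <= rt4 n.+1%:R by rewrite ler_rt4 // ler_nat.
have es := @rt4X n%:R (ler0n _ _); have et := @rt4X n.+1%:R (ler0n _ _).
have e1 : rt4 n.+1%:R ^+ 4 - rt4 n%:R ^+ 4 = 1 by rewrite es et -natr1; ring.
move: (rt4 n%:R) (rt4 n.+1%:R) s0 t0 st et e1 => s t s0 t0 st et e1; rewrite -et.
have -> : s^-1 - t^-1 = (t - s) / (s * t) by field; rewrite ?gt_eqF.
rewrite ler_pdivlMr ?mulr_gt0 // mulrAC ler_pdivrMr ?mulr_gt0 ?exprn_gt0 //.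
rewrite mul1r.
have -> : (t - s) * (4 * s * t ^+ 4) = (s * t) * ((t - s) * (4 * t ^+ 3)) by ring.
rewrite ler_pMr ?mulr_gt0 // -[leLHS]e1.
have -> : t ^+ 4 - s ^+ 4 = (t - s) * (t ^+ 3 + t ^+ 2 * s + t * s ^+ 2 + s ^+ 3) by ring.
apply: ler_wpM2l; first by rewrite subr_ge0.
have h1 : t ^+ 2 * s <= t ^+ 3 by rewrite [t ^+ 3]exprSr ler_wpM2l // sqr_ge0.
have h2 : t * s ^+ 2 <= t ^+ 3.
  by rewrite [t ^+ 3]exprS (ler_wpM2l (ltW t0)) // lerXn2r ?nnegrE ?(ltW s0) ?(ltW t0).
have h3 : s ^+ 3 <= t ^+ 3 by rewrite lerXn2r ?nnegrE ?(ltW s0) ?(ltW t0).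
lra.
Qed.

(** A discrete form of the derivative of x^(-(e + 1) / 4). The factor 4 is right for e = 0, by
    [rt4_incr], and remains sufficient for larger e because n -> 1 / rt4 n decreases. *)
Lemma rt4_decay e n : (0 < n)%N ->
  1 / (rt4 n%:R ^+ e.+1 * n.+1%:R) <= 4 / rt4 n%:R ^+ e.+1 - 4 / rt4 n.+1%:R ^+ e.+1.
Proof.
move=> n0; have H := rt4_incr n0; move: H.
have s0 : 0 < rt4 n%:R by rewrite rt4_gt0 // ltr0n.
have t0 : 0 < rt4 n.+1%:R by rewrite rt4_gt0 // ltr0n.
have st : rt4 n%:R <= rt4 n.+1%:R by rewrite ler_rt4 // ler_nat.
have N0 : 0 < n.+1%:R :> R by rewrite ltr0n.
move: (rt4 n%:R) (rt4 n.+1%:R) s0 t0 st => s t s0 t0 st.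
move: (n.+1%:R : R) N0 => N N0 H.
rewrite -!exprVn.
have hs : 0 <= s^-1 by rewrite invr_ge0 ltW.
have ht : 0 <= t^-1 by rewrite invr_ge0 ltW.
have ts : t^-1 <= s^-1 by rewrite lef_pV2.
have -> : 1 / (s ^+ e.+1 * N) = (s^-1 ^+ e) * (4 * (1 / (4 * s * N))).
  rewrite exprS exprVn; field.
  by rewrite !gt_eqF // exprn_gt0.
rewrite -mulrBr !exprS.
have h : t^-1 * t^-1 ^+ e <= t^-1 * s^-1 ^+ e.
  by apply: ler_wpM2l => //; rewrite lerXn2r.
have h2 : s^-1 ^+ e * (1 / (4 * s * N)) <= s^-1 ^+ e * (s^-1 - t^-1).
  by apply: ler_wpM2l => //; rewrite exprn_ge0.
lra.
Qed.

Lemma rt4_limit u e (C : R) : 0 <= C ->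
  (forall n, (0 < n)%N -> `|u n.+1 - u n| <= C / (rt4 n%:R ^+ e.+1 * n.+1%:R)) ->
  exists L, forall n, (0 < n)%N -> `|u n - L| <= 4 * C / rt4 n%:R ^+ e.+1.
Proof.
move=> C0 H; apply: telescoping_limit => [n|n n0].
  by rewrite divr_ge0 ?exprn_ge0 ?rt4_ge0 //; lra.
apply: le_trans (H n n0) _.
by have := ler_wpM2l C0 (rt4_decay e n0); rewrite mulrBr !mulrA mulr1 [C * 4]mulrC.
Qed.

(** Partial summation: the sum of a(i) f(i) minus A(n) f(n) has increments A(n) (f(n) - f(n+1)). The
    constant 5 is 4 from [rt4_limit] plus 1 from the boundary term A(n) f(n). *)
Lemma abel_limit a f e (K C : R) : 0 <= K -> 0 <= C ->
  (forall n, `|\sum_(1 <= i < n.+1) a i| <= K * rt4 n%:R ^+ 2) ->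
  (forall n, (0 < n)%N -> `|f n| * rt4 n%:R ^+ 2 <= C / rt4 n%:R ^+ e.+1) ->
  (forall n, (0 < n)%N -> `|f n - f n.+1| * rt4 n%:R ^+ 2 <= C / (rt4 n%:R ^+ e.+1 * n.+1%:R)) ->
  exists L, forall n, (0 < n)%N ->
    `|\sum_(1 <= i < n.+1) a i * f i - L| <= 5 * (K * C) / rt4 n%:R ^+ e.+1.
Proof.
move=> K0 C0 hA hf hd; set A := fun n => \sum_(1 <= i < n.+1) a i.
pose u n := \sum_(1 <= i < n.+1) a i * f i - A n * f n.
have [||L hL] := @rt4_limit u e (K * C); first exact: mulr_ge0.
  move=> n n0; have -> : u n.+1 - u n = A n * (f n - f n.+1).
    by rewrite /u /A ![\sum_(1 <= i < n.+2) _]big_nat_recr //=; ring.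
  rewrite normrM; apply: le_trans (ler_wpM2r (normr_ge0 _) (hA n)) _.
  by rewrite mulrAC -(mulrA K `|_|) -(mulrA K C); apply: ler_wpM2l => //; exact: hd.
exists L => n n0.
have -> : \sum_(1 <= i < n.+1) a i * f i - L = (u n - L) + A n * f n by rewrite /u; ring.
apply: le_trans (ler_normD _ _) _.
have h1 : `|A n * f n| <= K * (C / rt4 n%:R ^+ e.+1).
  rewrite normrM; apply: le_trans (ler_wpM2r (normr_ge0 _) (hA n)) _.
  by rewrite mulrAC -(mulrA K `|_|); apply: ler_wpM2l => //; exact: hf.
have := hL n n0; rewrite -!mulrA; lra.
Qed.

End Abel.

(** * Sums weighted by 1 / n and ln n / n *)

Section Asymptotics.
Variable R : realType.
Implicit Types a f u v w : nat -> R.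

Lemma ln_succ n : (0 < n)%N ->
  n.+1%:R^-1 <= ln n.+1%:R - ln n%:R :> R /\ ln n.+1%:R - ln n%:R <= n%:R^-1 :> R.
Proof.
move=> n0; have N0 : 0 < n%:R :> R by rewrite ltr0n.
have N1 : 0 < n.+1%:R :> R by rewrite ltr0n.
have e : n.+1%:R = n%:R + 1 :> R by rewrite natr1.
split.
  have := @ln_le_subr1 R (n%:R / n.+1%:R) (divr_gt0 N0 N1).
  rewrite ln_div ?posrE //; have -> : n%:R / n.+1%:R - 1 = - n.+1%:R^-1 :> R.
    by rewrite e; field; rewrite -e gt_eqF.
  by move=> h; rewrite -lerN2 opprB.
have := @ln_le_subr1 R (n.+1%:R / n%:R) (divr_gt0 N1 N0).
rewrite ln_div ?posrE //; have -> : n.+1%:R / n%:R - 1 = n%:R^-1 :> R.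
  by rewrite e; field; rewrite gt_eqF.
by [].
Qed.

Lemma rt4_nat_ge1 n : (0 < n)%N -> 1 <= rt4 n%:R :> R.
Proof. by move=> n0; rewrite rt4_ge1 // ler1n. Qed.

Lemma ln_nat_ge0 n : 0 <= ln n%:R :> R.
Proof. by case: n => [|n]; [rewrite ln0 | rewrite ln_ge0 // ler1n]. Qed.

Lemma inv_succ_le n e : (0 < n)%N -> (e <= 4)%N ->
  (n%:R * n.+1%:R)^-1 <= (rt4 n%:R ^+ e * n.+1%:R)^-1 :> R.
Proof.
move=> n0 e4; have s1 := rt4_nat_ge1 n0.
have N1 : 0 < n.+1%:R :> R by rewrite ltr0n.
rewrite lef_pV2 ?posrE ?mulr_gt0 ?exprn_gt0 ?ltr0n //; try lra.
by rewrite ler_pM2r // -[leRHS]rt4X // ler_weXn2l.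
Qed.

Lemma harmonic_asymp : exists g : R, forall n, (0 < n)%N ->
  `|\sum_(1 <= i < n.+1) i%:R^-1 - ln n%:R - g| <= 4 / rt4 n%:R ^+ 2.
Proof.
pose u n : R := \sum_(1 <= i < n.+1) i%:R^-1 - ln n%:R.
have [||g hg] := @rt4_limit R u 1 1; first by [].
  move=> n n0; rewrite /u big_nat_recr //=.
  have [h1 h2] := ln_succ n0; have N0 : 0 < n%:R :> R by rewrite ltr0n.
  have N1 : 0 < n.+1%:R :> R by rewrite ltr0n.
  rewrite div1r; apply: le_trans _ (inv_succ_le n0 (isT : 2 <= 4)%N).
  have -> : (n%:R * n.+1%:R)^-1 = n%:R^-1 - n.+1%:R^-1 :> R.
    by rewrite -natr1; field; rewrite natr1 !gt_eqF.
  move: h1 h2; move: (n%:R^-1) (n.+1%:R^-1) => x y h1 h2.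
  by rewrite ler_norml; apply/andP; split; lra.
by exists g => n n0; have := hg n n0; rewrite mulr1.
Qed.

(** The increment is that of the integral of ln x / x up to 6 rt4(n) / (n (n + 1)), where rt4(n)
    pays for ln n; 24 is 4 times 6. *)
Lemma ln_harmonic_asymp : exists g : R, forall n, (0 < n)%N ->
  `|\sum_(1 <= i < n.+1) ln i%:R / i%:R - ln n%:R ^+ 2 / 2 - g| <= 24 / rt4 n%:R.
Proof.
pose u n : R := \sum_(1 <= i < n.+1) ln i%:R / i%:R - ln n%:R ^+ 2 / 2.
have [||g hg] := @rt4_limit R u 0 6; first by [].
  move=> n n0; rewrite /u big_nat_recr //=.
  have [h1 h2] := ln_succ n0; have N0 : 0 < n%:R :> R by rewrite ltr0n.
  have N1 : 0 < n.+1%:R :> R by rewrite ltr0n.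
  have Nn1 : 1 <= n%:R :> R by rewrite ler1n.
  have s1 := rt4_nat_ge1 n0; have l1 := @ln_le_rt4 R n%:R Nn1.
  have l0 := ln_nat_ge0 n.
  set x := n%:R^-1 in h1 h2; set y := n.+1%:R^-1 in h1 h2 *.
  have x0 : 0 < x by rewrite invr_gt0.
  have y0 : 0 < y by rewrite invr_gt0.
  have x1 : x <= 1 by rewrite invf_le1.
  have xy : x * y = x - y by rewrite /x /y -natr1; field; rewrite natr1 !gt_eqF.
  have xy2 : x <= 2 * y.
    by rewrite /x /y ler_pdivlMr // mulrC ler_pdivrMr // -natr1; lra.
  set d := ln n.+1%:R - ln n%:R in h1 h2.
  have -> : ln n.+1%:R = ln n%:R + d by rewrite /d; ring.
  set l := ln n%:R in l0 l1 *; set s := rt4 n%:R in s1 l1 *.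
  have d1 : 0 <= d - y by lra.
  have d2 : d - y <= x * y by lra.
  have main : `|(l + d) * y - ((l + d) ^+ 2 - l ^+ 2) / 2| <= 6 * s * (x * y).
    have -> : (l + d) * y - ((l + d) ^+ 2 - l ^+ 2) / 2 = d ^+ 2 / 2 - (l + d) * (d - y) by field.
    have A : d ^+ 2 <= 2 * (x * y).
      have : d ^+ 2 <= x * x by rewrite expr2 ler_pM //; lra.
      have := ler_wpM2l (ltW x0) xy2; lra.
    have B : (l + d) * (d - y) <= (5 * s) * (x * y) by rewrite ler_pM //; lra.
    have B0 : 0 <= (l + d) * (d - y) by rewrite mulr_ge0 //; lra.
    have A0 : 0 <= d ^+ 2 by exact: sqr_ge0.
    have C : 1 * (x * y) <= s * (x * y) by rewrite ler_wpM2r // mulr_ge0 // ltW.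
    rewrite ler_norml; apply/andP; split; lra.
  have -> : \sum_(1 <= i < n.+1) ln i%:R / i%:R + (l + d) * y - (l + d) ^+ 2 / 2 -
      (\sum_(1 <= i < n.+1) ln i%:R / i%:R - l ^+ 2 / 2) =
      (l + d) * y - ((l + d) ^+ 2 - l ^+ 2) / 2 by field.
  apply: le_trans main _.
  have xs : x * s ^+ 2 <= 1.
    rewrite /x mulrC ler_pdivrMr // mul1r -[leRHS]rt4X //; apply: ler_weXn2l => //.
  rewrite expr1 invfM -/y -!mulrA ler_pM2l // !mulrA ler_pM2r //.
  rewrite -div1r ler_pdivlMr; last by lra.
  by move: xs; rewrite expr2; lra.
by exists g => n n0; have := hg n n0; rewrite expr1; have -> : 4 * 6 = 24 :> R by ring.
Qed.

Section PartialSums.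
Variables (a : nat -> R) (c K : R).
Hypothesis K0 : 0 <= K.
Hypothesis ha : forall n, `|\sum_(1 <= i < n.+1) a i - c * n%:R| <= K * rt4 n%:R ^+ 2.

Let a' i := a i - c.

Let ha' n : `|\sum_(1 <= i < n.+1) a' i| <= K * rt4 n%:R ^+ 2.
Proof.
rewrite /a' sumrB sumr_const_nat subn1 /=.
by have := ha n; rewrite -[c *+ n]mulr_natr.
Qed.

(** The mean value c is split off: it contributes c times the harmonic sum, while a - c has partial
    sums O(sqrt n), so that [abel_limit] applies. *)
Lemma sum_div_asymp : exists c' K1 : R, 0 <= K1 /\ forall n, (0 < n)%N ->
  `|\sum_(1 <= i < n.+1) a i / i%:R - c * ln n%:R - c'| <= K1 / rt4 n%:R ^+ 2.
Proof.
have [||L hL] := @abel_limit R a' (fun n => n%:R^-1) 1 K 1 K0 ler01 ha'.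
- move=> n n0; have s1 := rt4_nat_ge1 n0; have N0 : 0 < n%:R :> R by rewrite ltr0n.
  rewrite ger0_norm ?invr_ge0 ?ler0n //; have := @rt4X R n%:R (ler0n _ _).
  move: (rt4 n%:R) s1 => s s1 <-; have s0 : 0 < s by lra.
  by rewrite le_eqVlt; apply/orP; left; apply/eqP; field; rewrite gt_eqF.
- move=> n n0; have s1 := rt4_nat_ge1 n0; have N0 : 0 < n%:R :> R by rewrite ltr0n.
  have N1 : 0 < n.+1%:R :> R by rewrite ltr0n.
  have -> : n%:R^-1 - n.+1%:R^-1 = (n%:R * n.+1%:R)^-1 :> R.
    by rewrite -natr1; field; rewrite natr1 !gt_eqF.
  rewrite ger0_norm ?invr_ge0 ?mulr_ge0 ?ler0n // div1r !invfM mulrAC.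
  apply: ler_wpM2r; first by rewrite invr_ge0 ler0n.
  have := @rt4X R n%:R (ler0n _ _).
  move: (rt4 n%:R) s1 => s s1 <-; have s0 : 0 < s by lra.
  by rewrite le_eqVlt; apply/orP; left; apply/eqP; field; rewrite gt_eqF.
have [g hg] := harmonic_asymp.
exists (L + c * g), (5 * (K * 1) + `|c| * 4); split.
  by rewrite addr_ge0 ?mulr_ge0 ?normr_ge0 ?ler0n ?ler01.
move=> n n0.
have -> : \sum_(1 <= i < n.+1) a i / i%:R - c * ln n%:R - (L + c * g) =
  (\sum_(1 <= i < n.+1) a' i * i%:R^-1 - L) +
    c * (\sum_(1 <= i < n.+1) i%:R^-1 - ln n%:R - g).
  under [X in _ = X - L + _]eq_bigr do rewrite /a' mulrBl.
  by rewrite sumrB -mulr_sumr; ring.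
apply: le_trans (ler_normD _ _) _; rewrite mulrDl lerD ?hL //.
by rewrite normrM -mulrA ler_wpM2l ?hg.
Qed.

Lemma sum_ln_div_asymp : exists c' K1 : R, 0 <= K1 /\ forall n, (0 < n)%N ->
  `|\sum_(1 <= i < n.+1) mulln a i / i%:R - c / 2 * ln n%:R ^+ 2 - c'| <= K1 / rt4 n%:R.
Proof.
have [||L hL] := @abel_limit R a' (fun n => ln n%:R / n%:R) 0 K 4 K0 ltac:(lra) ha'.
- move=> n n0; have s1 := rt4_nat_ge1 n0; have N0 : 0 < n%:R :> R by rewrite ltr0n.
  have l0 := ln_nat_ge0 n; have l1 := @ln_le_rt4 R n%:R ltac:(by rewrite ler1n).
  rewrite ger0_norm ?divr_ge0 ?ler0n // expr1; have := @rt4X R n%:R (ler0n _ _).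
  move: (ln n%:R) (rt4 n%:R) s1 l0 l1 => l s s1 l0 l1 <-; have s0 : 0 < s by lra.
  have -> : l / s ^+ 4 * s ^+ 2 = l / s ^+ 2 by field; rewrite gt_eqF.
  have -> : 4 / s = 4 * s / s ^+ 2 by field; rewrite gt_eqF.
  by rewrite ler_wpM2r // invr_ge0 sqr_ge0.
- move=> n n0; have s1 := rt4_nat_ge1 n0; have N0 : 0 < n%:R :> R by rewrite ltr0n.
  have N1 : 0 < n.+1%:R :> R by rewrite ltr0n.
  have l0 := ln_nat_ge0 n; have l1 := @ln_le_rt4 R n%:R ltac:(by rewrite ler1n).
  have [h1 h2] := ln_succ n0.
  set x := n%:R^-1 in h1 h2 *; set y := n.+1%:R^-1 in h1 h2 *.
  have x0 : 0 < x by rewrite invr_gt0.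
  have y0 : 0 < y by rewrite invr_gt0.
  have xy : x * y = x - y by rewrite /x /y -natr1; field; rewrite natr1 !gt_eqF.
  set d := ln n.+1%:R - ln n%:R in h1 h2.
  have -> : ln n.+1%:R = ln n%:R + d by rewrite /d; ring.
  set l := ln n%:R in l0 l1 *; set s := rt4 n%:R in s1 l1 *.
  have b : `|l * x - (l + d) * y| <= 4 * s * (x * y).
    have -> : l * x - (l + d) * y = l * (x * y) - d * y by rewrite xy; ring.
    have A : l * (x * y) <= 4 * s * (x * y) by rewrite ler_wpM2r // mulr_ge0 // ltW.
    have A0 : 0 <= l * (x * y) by rewrite !mulr_ge0 // ltW.
    have B : d * y <= 1 * (x * y) by rewrite mul1r ler_wpM2r // ltW.
    have B0 : 0 <= d * y by rewrite mulr_ge0 // ?ltW //; lra.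
    have C : 1 * (x * y) <= s * (x * y) by rewrite ler_wpM2r // mulr_ge0 // ltW.
    by rewrite ler_norml; apply/andP; split; lra.
  apply: le_trans (ler_wpM2r (sqr_ge0 _) b) _.
  have s0 : 0 < s by lra.
  have -> : 4 * s * (x * y) * s ^+ 2 = 4 * s * x * s ^+ 2 * y by ring.
  rewrite [leRHS](_ : _ = 4 * s^-1 * y); last by rewrite expr1 invfM mulrA.
  rewrite ler_wpM2r ?(ltW y0) //.
  have es := @rt4X R n%:R (ler0n _ _); rewrite -/s in es.
  rewrite /x -es le_eqVlt; apply/orP; left; apply/eqP; field.
  by rewrite gt_eqF.
have [g hg] := ln_harmonic_asymp.
exists (L + c * g), (5 * (K * 4) + `|c| * 24); split.
  by rewrite addr_ge0 ?mulr_ge0 ?normr_ge0 ?ler0n ?ler01.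
move=> n n0.
have -> : \sum_(1 <= i < n.+1) mulln a i / i%:R - c / 2 * ln n%:R ^+ 2 - (L + c * g) =
  (\sum_(1 <= i < n.+1) a' i * (ln i%:R / i%:R) - L) +
    c * (\sum_(1 <= i < n.+1) ln i%:R / i%:R - ln n%:R ^+ 2 / 2 - g).
  under [X in _ = X - L + _]eq_bigr do rewrite /a' mulrBl.
  rewrite sumrB -mulr_sumr /mulln; under eq_bigr do rewrite -mulrA.
  by field.
apply: le_trans (ler_normD _ _) _; rewrite mulrDl lerD //.
  by have := hL n n0; rewrite expr1.
by rewrite normrM -(mulrA `|c|) ler_wpM2l ?hg.
Qed.

End PartialSums.

(** Against a decreasing f, weights whose partial sums are at most K n count no more than the
    constant weight K. *)
Lemma sum_monotone_le w f K N : (forall n, 0 <= w n) ->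
  (forall n, \sum_(1 <= i < n.+1) w i <= K * n%:R) ->
  (forall n, (0 < n)%N -> f n.+1 <= f n) -> (forall n, (0 < n)%N -> 0 <= f n) ->
  \sum_(1 <= i < N.+1) w i * f i <= K * \sum_(1 <= i < N.+1) f i.
Proof.
move=> w0 hw fd f0; have [->|N0] := posnP N; first by rewrite !big_geq // mulr0.
set W := fun n => \sum_(1 <= i < n.+1) w i.
suff : \sum_(1 <= i < N.+1) w i * f i <= K * \sum_(1 <= i < N.+1) f i - (K * N%:R - W N) * f N.
  move/le_trans; apply; rewrite gerBl mulr_ge0 ?f0 // subr_ge0; exact: hw.
elim: N N0 => // N IH _; have [->|N0] := posnP N.
  by rewrite /W !big_nat1; lra.
rewrite big_nat_recr //= [\sum_(1 <= i < N.+2) f i]big_nat_recr //=.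
have -> : W N.+1 = W N + w N.+1 by rewrite /W big_nat_recr.
have := IH N0; have : 0 <= (K * N%:R - W N) * (f N - f N.+1).
  by rewrite mulr_ge0 // subr_ge0 ?fd //; exact: hw.
rewrite -natr1; lra.
Qed.

Lemma sum_rt4_inv3 N : \sum_(1 <= i < N.+1) (rt4 i%:R ^+ 3)^-1 <= 4 * rt4 N%:R :> R.
Proof.
elim: N => [|N IH]; first by rewrite big_geq // mulr_ge0 // rt4_ge0.
rewrite big_nat_recr //=; apply: (le_trans (lerD IH (lexx _))).
have es := @rt4X R N%:R (ler0n _ _); have et := @rt4X R N.+1%:R (ler0n _ _).
have e1 : rt4 N.+1%:R ^+ 4 - rt4 N%:R ^+ 4 = 1 :> R by rewrite es et -natr1; ring.
have t0 : 0 < rt4 N.+1%:R :> R by rewrite rt4_gt0 // ltr0n.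
have s0 := @rt4_ge0 R N%:R.
have st : rt4 N%:R <= rt4 N.+1%:R :> R by rewrite ler_rt4 // ler_nat.
move: (rt4 N%:R) (rt4 N.+1%:R) s0 t0 st e1 => s t s0 t0 st e1.
suff : (t ^+ 3)^-1 <= 4 * (t - s) by lra.
rewrite -div1r ler_pdivrMr ?exprn_gt0 // -[leLHS]e1.
have -> : t ^+ 4 - s ^+ 4 = (t - s) * (t ^+ 3 + t ^+ 2 * s + t * s ^+ 2 + s ^+ 3) by ring.
have -> : 4 * (t - s) * t ^+ 3 = (t - s) * (4 * t ^+ 3) by ring.
apply: ler_wpM2l; first by rewrite subr_ge0.
have t0' := ltW t0.
have h1 : t ^+ 2 * s <= t ^+ 3 by rewrite [t ^+ 3]exprSr ler_wpM2l // sqr_ge0.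
have h2 : t * s ^+ 2 <= t ^+ 3.
  by rewrite [t ^+ 3]exprS (ler_wpM2l t0') // lerXn2r ?nnegrE.
have h3 : s ^+ 3 <= t ^+ 3 by rewrite lerXn2r ?nnegrE.
lra.
Qed.

(** The sum is N^(-1/4) times that of w(i) i^(-3/4). It is bounded, so an error of size (N /
    i)^(-1/4) in the inner sum of a convolution costs only O(1) overall. *)
Lemma sum_rt4_quot w K N : (forall n, 0 <= w n) -> 0 <= K ->
  (forall n, \sum_(1 <= i < n.+1) w i <= K * n%:R) -> (0 < N)%N ->
  \sum_(1 <= i < N.+1) w i / i%:R * (rt4 (N%:R / i%:R))^-1 <= 4 * K.
Proof.
move=> w0 K0 hw N0.
have t0 : 0 < rt4 N%:R :> R by rewrite rt4_gt0 // ltr0n.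
have -> : \sum_(1 <= i < N.+1) w i / i%:R * (rt4 (N%:R / i%:R))^-1 =
   (\sum_(1 <= i < N.+1) w i * (rt4 i%:R ^+ 3)^-1) / rt4 N%:R.
  rewrite mulr_suml; apply: eq_big_nat => i /andP[i0 _].
  have s0 : 0 < rt4 i%:R :> R by rewrite rt4_gt0 // ltr0n.
  have e : rt4 N%:R = rt4 (N%:R / i%:R) * rt4 i%:R :> R.
    by rewrite -rt4M ?divr_ge0 // divfK // pnatr_eq0; lia.
  have q0 : 0 < rt4 (N%:R / i%:R) :> R by rewrite rt4_gt0 // divr_gt0 // ltr0n.
  rewrite e; have := @rt4X R i%:R (ler0n _ _).
  move: (rt4 (_ / _)) q0 => q q0; move: (rt4 i%:R) s0 => s s0 <-; field.
  by rewrite !gt_eqF.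
rewrite ler_pdivrMr // -mulrA [K * _]mulrC mulrA.
apply: le_trans (@sum_monotone_le w (fun i => (rt4 i%:R ^+ 3)^-1) K N w0 hw _ _) _.
- move=> n n0; rewrite lef_pV2 ?posrE ?exprn_gt0 ?rt4_gt0 ?ltr0n //.
  by rewrite lerXn2r ?nnegrE ?rt4_ge0 // ler_rt4 // ler_nat.
- by move=> n _; rewrite invr_ge0 exprn_ge0 // rt4_ge0.
- by rewrite mulrC ler_wpM2r // sum_rt4_inv3.
Qed.

End Asymptotics.

(** * Shapiro's method for a general coefficient sequence *)

Section Trichotomy.
Variable R : realType.
Variables (a b w : nat -> R) (c K Kw : R).
Hypotheses (a1 : a 1%N = 1) (ab : forall n, (0 < n)%N -> conv b a n = mulln a n).
Hypotheses (K0 : 0 <= K) (Kw0 : 0 <= Kw) (w0 : forall n, 0 <= w n).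
Hypothesis hw : forall n, \sum_(1 <= i < n.+1) w i <= Kw * n%:R.
Hypothesis mw : forall n, (0 < n)%N -> `|dinv a n| <= w n.
Hypothesis ha : forall n, `|\sum_(1 <= i < n.+1) a i - c * n%:R| <= K * rt4 n%:R ^+ 2.
Local Notation m := (dinv a).

Lemma conv_div (f g : nat -> R) n : (0 < n)%N ->
  conv (fun i => f i / i%:R) (fun i => g i / i%:R) n = conv f g n / n%:R.
Proof.
move=> n0; rewrite /conv mulr_suml; apply: eq_big_nat => i /andP[i0 _].
rewrite mulr_suml big_nat_cond [RHS]big_nat_cond.
apply: eq_bigr => j /andP[/andP[j0 _] /eqP <-].
by rewrite natrM invfM; ring.
Qed.

Lemma sum_delta N (f : nat -> R) : (0 < N)%N -> f 1%N = 1 ->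
  \sum_(1 <= n < N.+1) delta R n * f n = 1.
Proof.
move=> N0 f1; rewrite big_ltn ?ltnS // /delta f1 mulr1 big_nat_cond big1 ?addr0 //.
by move=> i hi; case: eqP; [lia | rewrite mul0r].
Qed.

Lemma sum_dinv_div N : (0 < N)%N ->
  \sum_(1 <= i < N.+1) m i / i%:R * \sum_(1 <= j < (N %/ i).+1) a j / j%:R = 1.
Proof.
move=> N0; rewrite -(sum_conv (fun i => m i / i%:R) (fun i => a i / i%:R)).
rewrite -[RHS](@sum_delta N (fun n => n%:R^-1)) ?invr1 //.
by apply: eq_big_nat => n /andP[n0 _]; rewrite conv_div // conv_dinv.
Qed.

Lemma sum_dinv N : (0 < N)%N ->
  \sum_(1 <= i < N.+1) m i * \sum_(1 <= j < (N %/ i).+1) a j = 1.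
Proof.
move=> N0; rewrite -(sum_conv m a) -[RHS](@sum_delta N (fun=> 1)) //.
by apply: eq_big_nat => n /andP[n0 _]; rewrite conv_dinv // mulr1.
Qed.

Lemma sum_dinv_mulln N :
  \sum_(1 <= i < N.+1) m i / i%:R * \sum_(1 <= j < (N %/ i).+1) mulln a j / j%:R =
  \sum_(1 <= n < N.+1) b n / n%:R.
Proof.
rewrite -(sum_conv (fun i => m i / i%:R) (fun i => mulln a i / i%:R)).
by apply: eq_big_nat => n /andP[n0 _]; rewrite conv_div // (conv_dinv_mulln a1 ab).
Qed.

(** Writing ln(N / i) = ln N - ln i, the first part is ln N by [sum_dinv_div]; the second convolves
    [mulln m] with [a], which gives - b. *)
Lemma sum_dinv_ln N : (0 < N)%N ->
  \sum_(1 <= i < N.+1) m i / i%:R * (ln (N%:R / i%:R) * \sum_(1 <= j < (N %/ i).+1) a j / j%:R) =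
  ln N%:R + \sum_(1 <= n < N.+1) b n / n%:R.
Proof.
move=> N0.
have e : \sum_(1 <= i < N.+1) mulln m i / i%:R * \sum_(1 <= j < (N %/ i).+1) a j / j%:R =
   - \sum_(1 <= n < N.+1) b n / n%:R.
  rewrite -(sum_conv (fun i => mulln m i / i%:R) (fun i => a i / i%:R)) -sumrN.
  apply: eq_big_nat => n /andP[n0 _]; rewrite conv_div // -mulNr; congr (_ / _).
  have := conv_mulln m a n; rewrite (conv_dinv_mulln a1 ab) // conv_dinv // /delta.
  case: eqP => [->|_]; rewrite ?ln1 ?mulr0 ?mul0r => /eqP; by rewrite eq_sym addr_eq0 => /eqP.
transitivity (ln N%:R * (\sum_(1 <= i < N.+1) m i / i%:R * \sum_(1 <= j < (N %/ i).+1) a j / j%:R)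
   - \sum_(1 <= i < N.+1) mulln m i / i%:R * \sum_(1 <= j < (N %/ i).+1) a j / j%:R); last first.
  by rewrite sum_dinv_div // mulr1 e opprK.
rewrite mulr_sumr -sumrB; apply: eq_big_nat => i /andP[i0 _].
rewrite ln_div ?posrE ?ltr0n // /mulln; ring.
Qed.

Lemma quot_bounds N i : (0 < i <= N)%N ->
  [/\ 1 <= (N %/ i)%:R :> R, (N %/ i)%:R <= N%:R / i%:R :> R & N%:R / i%:R <= (N %/ i)%:R + 1 :> R].
Proof.
move=> /andP[i0 iN]; have I0 : 0 < i%:R :> R by rewrite ltr0n.
split; first by rewrite ler1n divn_gt0.
  by rewrite ler_pdivlMr // -natrM ler_nat leq_divM.
rewrite ler_pdivrMr // natr1 -natrM ler_nat ltnW // {1}(divn_eq N i) mulSn addnC ltn_add2r ltn_mod //.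
Qed.

Lemma sum_error (E : nat -> R) B N : (0 < N)%N -> 0 <= B ->
  (forall i, (0 < i <= N)%N -> `|E i| <= B / rt4 (N%:R / i%:R)) ->
  `|\sum_(1 <= i < N.+1) m i / i%:R * E i| <= 4 * Kw * B.
Proof.
move=> N0 B0 hE; apply: le_trans (ler_norm_sum _ _ _) _.
apply: le_trans (_ : B * \sum_(1 <= i < N.+1) w i / i%:R * (rt4 (N%:R / i%:R))^-1 <= _); last first.
  by rewrite mulrC ler_wpM2r // sum_rt4_quot.
rewrite mulr_sumr; apply: ler_sum_nat => i hi.
rewrite normrM normrM [`|_^-1|]ger0_norm ?invr_ge0 ?ler0n //.
rewrite [leRHS](_ : _ = w i / i%:R * (B / rt4 (N%:R / i%:R))); last by ring.
apply: ler_pM => //; first by rewrite mulr_ge0 ?invr_ge0 ?ler0n.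
  by rewrite ler_wpM2r ?invr_ge0 ?ler0n // mw //; lia.
by apply: hE; lia.
Qed.

Lemma quot_gt0 N i : (0 < i <= N)%N -> (0 < N %/ i)%N.
Proof. by move=> /andP[i0 iN]; rewrite divn_gt0. Qed.

(** The exact partial sums live at the integer part q of y = N / i, the main terms at y itself. As q
    <= y <= q + 1 and q >= 1, one has y <= 16 q, hence the factor 2 between fourth roots, and ln y -
    ln q <= 1 / q <= 2 / y. *)
Lemma quot_rt4 N i : (0 < i <= N)%N ->
  [/\ 1 <= rt4 (N%:R / i%:R) :> R, rt4 (N%:R / i%:R) <= 2 * rt4 (N %/ i)%:R :> R,
      0 <= ln (N%:R / i%:R) - ln (N %/ i)%:R :> R &
      ln (N%:R / i%:R) - ln (N %/ i)%:R <= 2 / rt4 (N%:R / i%:R) ^+ 4 :> R].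
Proof.
move=> h; have [h1 h2 h3] := quot_bounds h.
set q : R := (N %/ i)%:R in h1 h2 h3 *; set y : R := N%:R / i%:R in h2 h3 *.
have q0 : 0 < q by lra.
have y0 : 0 < y by lra.
split.
- by rewrite rt4_ge1 //; lra.
- apply: le_trans (_ : rt4 (2 ^+ 4 * q) <= _); first by rewrite ler_rt4 //; lra.
  rewrite rt4M ?exprn_ge0 //; have -> // : rt4 (2 ^+ 4) = 2 :> R.
  by rewrite /rt4 (exprM _ 2 2) sqrtr_sqr ger0_norm ?sqr_ge0 // sqrtr_sqr ger0_norm.
- by rewrite subr_ge0 ler_ln ?posrE.
rewrite rt4X ?(ltW y0) // -ln_div ?posrE //.
apply: le_trans (ln_le_subr1 _) _; first by rewrite divr_gt0.
have -> : y / q - 1 = (y - q) / q by field; rewrite gt_eqF.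
rewrite ler_pdivlMr // mulrAC ler_pdivrMr //.
have : 0 <= (q + 1 - y) * y by rewrite mulr_ge0 //; lra.
lra.
Qed.

Lemma quot_partial_sum (A q y s t : R) : 1 <= q -> q <= y -> y <= q + 1 ->
  0 <= s -> s <= t -> 1 <= t -> t ^+ 4 = y -> `|A - c * q| <= K * s ^+ 2 ->
  `|A - c * y| <= (K + `|c|) * (y / t).
Proof.
move=> f1 f2 f3 s0 st t1 ty hA; have t0 : 0 < t by lra.
have -> : A - c * y = (A - c * q) - c * (y - q) by ring.
have -> : y / t = t ^+ 3 by rewrite -ty; field; rewrite gt_eqF.
apply: le_trans (ler_normB _ _) _; rewrite mulrDl normrM [`|y - q|]ger0_norm; last by lra.
apply: lerD.
  apply: le_trans hA _; rewrite ler_wpM2l //.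
  apply: le_trans (_ : t ^+ 2 <= _); last by rewrite ler_weXn2l.
  by rewrite lerXn2r ?nnegrE //; lra.
rewrite ler_wpM2l //; apply: le_trans (_ : 1 <= _); first by lra.
by rewrite -(expr1n _ 3) lerXn2r ?nnegrE //; lra.
Qed.

Let Q j N : R := \sum_(1 <= i < N.+1) m i / i%:R * ln (N%:R / i%:R) ^+ j.

(** Four exact identities, for [sum_dinv_div], [sum_dinv_mulln], [sum_dinv_ln] and [sum_dinv], with
    the inner sum at y = N / i replaced by its main term: c ln y + c', c / 2 ln^2 y + c'', (c ln y +
    c') ln y and c y. The means Q 0, Q 1 and Q 2 are unknowns to be eliminated afterwards. *)
Lemma shapiro_dinv : exists c' c'' B : R, 0 <= B /\ forall N, (0 < N)%N ->
  [/\ `|1 - c * Q 1 N - c' * Q 0 N| <= B,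
      `|\sum_(1 <= n < N.+1) b n / n%:R - c / 2 * Q 2 N - c'' * Q 0 N| <= B,
      `|ln N%:R + \sum_(1 <= n < N.+1) b n / n%:R - c * Q 2 N - c' * Q 1 N| <= B &
      `|c * Q 0 N| <= B].
Proof.
have [c' [K1 [K10 h1]]] := sum_div_asymp K0 ha.
have [c'' [K2 [K20 h2]]] := sum_ln_div_asymp K0 ha.
pose B1 := 4 * K1 + 2 * `|c|.
have B10 : 0 <= B1 by rewrite addr_ge0 // mulr_ge0.
pose B2 := 2 * K2 + 8 * `|c|.
have B20 : 0 <= B2 by rewrite addr_ge0 // mulr_ge0.
have B30 : 0 <= K + `|c| by rewrite addr_ge0.
have hD N i : (0 < i <= N)%N ->
   `|\sum_(1 <= j < (N %/ i).+1) a j / j%:R - c * ln (N%:R / i%:R) - c'|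
     <= B1 / rt4 (N%:R / i%:R) ^+ 2.
  move=> hi; have [g1 g2 g3 g4] := quot_rt4 hi.
  have := h1 (N %/ i)%N (quot_gt0 hi).
  set D := \sum_(_ <= _ < _) _; move: g1 g2 g3 g4.
  move: (rt4 (N%:R / i%:R)) (rt4 (N %/ i)%:R) (ln (N%:R / i%:R)) (ln (N %/ i)%:R) => t s y q g1 g2 g3 g4 g5.
  have -> : D - c * y - c' = (D - c * q - c') - c * (y - q) by ring.
  apply: le_trans (ler_normB _ _) _; rewrite mulrDl; apply: lerD.
    apply: le_trans g5 _; have s0 : 0 < s by lra.
    have -> : 4 * K1 / t ^+ 2 = K1 * (4 / t ^+ 2) by ring.
    rewrite ler_wpM2l // ler_pdivlMr ?exprn_gt0 //; last by lra.
    rewrite mulrC ler_pdivrMr ?exprn_gt0 // (_ : 4 = 2 ^+ 2) -?exprMn; last by ring.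
    by rewrite lerXn2r ?nnegrE //; lra.
  rewrite normrM [`|y - q|]ger0_norm // [2 * _]mulrC -mulrA ler_wpM2l //.
  apply: le_trans g4 _; rewrite ler_wpM2l // lef_pV2 ?posrE ?exprn_gt0 //; try lra.
  by rewrite ler_weXn2l.
have hDl N i : (0 < i <= N)%N ->
   `|\sum_(1 <= j < (N %/ i).+1) mulln a j / j%:R - c / 2 * ln (N%:R / i%:R) ^+ 2 - c''|
     <= B2 / rt4 (N%:R / i%:R).
  move=> hi; have [g1 g2 g3 g4] := quot_rt4 hi.
  have y1 : 1 <= N%:R / i%:R :> R by have [] := quot_bounds hi; lra.
  have := h2 (N %/ i)%N (quot_gt0 hi).
  have := ln_le_rt4 y1; have := ln_nat_ge0 R (N %/ i).
  set D := \sum_(_ <= _ < _) _; move: g1 g2 g3 g4.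
  move: (rt4 (N%:R / i%:R)) (rt4 (N %/ i)%:R) (ln (N%:R / i%:R)) (ln (N %/ i)%:R) => t s y q g1 g2 g3 g4 q0 yt g5.
  have s0 : 0 < s by lra.
  have t0 : 0 < t by lra.
  have -> : D - c / 2 * y ^+ 2 - c'' = (D - c / 2 * q ^+ 2 - c'') - c * ((y ^+ 2 - q ^+ 2) / 2) by field.
  apply: le_trans (ler_normB _ _) _; rewrite [leRHS]mulrDl; apply: lerD.
    apply: le_trans g5 _.
    have -> : 2 * K2 / t = K2 * (2 / t) by ring.
    by rewrite ler_wpM2l // ler_pdivlMr // mulrC ler_pdivrMr.
  have z0 : 0 <= y ^+ 2 - q ^+ 2 by rewrite subr_ge0 lerXn2r ?nnegrE //; lra.
  rewrite normrM [`|_ / 2|]ger0_norm ?divr_ge0 // [8 * _]mulrC -mulrA ler_wpM2l //.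
  have A : (y - q) * ((y + q) / 2) <= (2 / t ^+ 4) * (4 * t) by apply: ler_pM => //; lra.
  have -> : (y ^+ 2 - q ^+ 2) / 2 = (y - q) * ((y + q) / 2) by ring.
  apply: le_trans A _; have -> : 2 / t ^+ 4 * (4 * t) = 8 / t ^+ 3 by field; rewrite gt_eqF.
  rewrite ler_wpM2l // lef_pV2 ?posrE ?exprn_gt0 //.
  by rewrite -[leLHS]expr1 ler_weXn2l.
pose B := 4 * Kw * B1 + 4 * Kw * B2 + 4 * Kw * (4 * B1) + (1 + 4 * Kw * (K + `|c|)).
exists c', c'', B.
have b1 : 0 <= 4 * Kw * B1 by rewrite !mulr_ge0.
have b2 : 0 <= 4 * Kw * B2 by rewrite !mulr_ge0.
have b3 : 0 <= 4 * Kw * (4 * B1) by rewrite !mulr_ge0.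
have b4 : 0 <= 4 * Kw * (K + `|c|) by rewrite !mulr_ge0.
have rw (F : nat -> R) N x y (G H : nat -> R) :
   \sum_(1 <= i < N.+1) m i / i%:R * F i - x * (\sum_(1 <= i < N.+1) m i / i%:R * G i)
    - y * (\sum_(1 <= i < N.+1) m i / i%:R * H i) =
   \sum_(1 <= i < N.+1) m i / i%:R * (F i - x * G i - y * H i).
  by rewrite !mulr_sumr -!sumrB; apply: eq_bigr => i _; ring.
have [B_1 B_2 B_3 B_4] : [/\ 4 * Kw * B1 <= B, 4 * Kw * B2 <= B, 4 * Kw * (4 * B1) <= B &
    1 + 4 * Kw * (K + `|c|) <= B] by rewrite /B; split; lra.
have B0 : 0 <= B by exact: le_trans b1 B_1.
split => //.
move=> N N0; split.
- rewrite -[X in X - _ - _](sum_dinv_div N0) /Q rw.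
  apply: le_trans (sum_error (B := B1) N0 B10 _) B_1.
  move=> i hi; rewrite expr1 expr0 mulr1; apply: le_trans (hD N i hi) _.
  have [g1 _ _ _] := quot_rt4 hi.
  rewrite ler_wpM2l // lef_pV2 ?posrE ?exprn_gt0 //; try lra.
  by rewrite -[leLHS]expr1 ler_weXn2l.
- rewrite -sum_dinv_mulln /Q rw.
  apply: le_trans (sum_error (B := B2) N0 B20 _) B_2.
  by move=> i hi; rewrite expr0 mulr1; apply: hDl.
- rewrite -sum_dinv_ln // /Q rw.
  apply: le_trans (sum_error (B := 4 * B1) N0 _ _) B_3.
    by rewrite mulr_ge0.
  move=> i hi; have [g1 _ _ _] := quot_rt4 hi.
  have y1 : 1 <= N%:R / i%:R :> R by have [] := quot_bounds hi; lra.
  have := hD N i hi; have := ln_le_rt4 y1; have := ln_ge0 y1.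
  set D := \sum_(_ <= _ < _) _; move: g1; move: (rt4 _) (ln _) => t y t1 y0 yt hh.
  have t0 : 0 < t by lra.
  have -> : y * D - c * y ^+ 2 - c' * y ^+ 1 = (D - c * y - c') * y by ring.
  rewrite normrM [`|y|]ger0_norm //.
  have -> : 4 * B1 / t = (B1 / t ^+ 2) * (4 * t) by field; rewrite gt_eqF.
  exact: ler_pM.
- have e : c * Q 0 N = (1 - \sum_(1 <= i < N.+1) m i / i%:R *
     (i%:R * (\sum_(1 <= j < (N %/ i).+1) a j - c * (N%:R / i%:R)))) / N%:R.
    rewrite -[X in _ = (X - _) / _](sum_dinv N0) -sumrB /Q mulr_sumr mulr_suml.
    apply: eq_big_nat => i /andP[i0 _]; rewrite expr0.
    have I0 : i%:R != 0 :> R by rewrite pnatr_eq0 -lt0n.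
    have NN0 : N%:R != 0 :> R by rewrite pnatr_eq0 -lt0n.
    move: (\sum_(_ <= _ < _) _) (m i) => A x.
    by move: (i%:R : R) (N%:R : R) I0 NN0 => u v u0 v0; field; rewrite u0 v0.
  rewrite e normrM normfV [`|N%:R|]ger0_norm // ler_pdivrMr ?ltr0n //.
  have NN : 1 <= N%:R :> R by rewrite ler1n.
  apply: le_trans (ler_normB _ _) _; rewrite normr1.
  apply: le_trans (_ : 1 + 4 * Kw * ((K + `|c|) * N%:R) <= _); last first.
    apply: le_trans (ler_wpM2r (ler0n R N) B_4).
    by rewrite [leRHS]mulrDl mul1r -[X in _ <= _ + X]mulrA lerD2r.
  apply: lerD => //; apply: sum_error => //; first by rewrite mulr_ge0.
  move=> i hi; have [g1 g2 g3 g4] := quot_rt4 hi; have [f1 f2 f3] := quot_bounds hi.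
  have I0 : 0 < i%:R :> R by rewrite ltr0n; case/andP: (hi).
  rewrite normrM ger0_norm ?ler0n // mulrC -ler_pdivlMr //.
  have y0 : 0 < N%:R / i%:R :> R by lra.
  have -> : (K + `|c|) * N%:R / rt4 (N%:R / i%:R) / i%:R =
     (K + `|c|) * ((N%:R / i%:R) / rt4 (N%:R / i%:R)) by ring.
  by apply: quot_partial_sum f1 f2 f3 (rt4_ge0 _) (ler_rt4 f2) g1 (rt4X (ltW y0)) (ha _).
Qed.

(* The three cases correspond to a pole, a nonzero finite value, and a zero of the Dirichlet series of [a] at 1. *)
Theorem shapiro_trichotomy : exists eps : R,
  [/\ c != 0 -> eps = 1, c = 0 -> eps = 0 \/ eps = -1 &
   exists B, forall N, (0 < N)%N ->
     `|\sum_(1 <= n < N.+1) b n / n%:R - eps * ln N%:R| <= B].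
Proof.
have [c' [c'' [B [B0 H]]]] := shapiro_dinv.
have [c0|c0] := eqVneq c 0; last first.
  have Q0 N : (0 < N)%N -> `|Q 0 N| <= B / `|c|.
    by move=> /H[_ _ _]; rewrite normrM ler_pdivlMr ?normr_gt0 // mulrC.
  have Q1 N : (0 < N)%N -> `|Q 1 N| <= (1 + B + `|c'| * (B / `|c|)) / `|c|.
    move=> N0; have [h1 _ _ _] := H N N0; have h2 := Q0 N N0.
    rewrite ler_pdivlMr ?normr_gt0 // mulrC -normrM.
    have -> : c * Q 1 N = 1 - (1 - c * Q 1 N - c' * Q 0 N) - c' * Q 0 N by ring.
    apply: le_trans (ler_normB _ _) _; apply: lerD.
      by apply: le_trans (ler_normB _ _) _; rewrite normr1 lerD.
    by rewrite normrM ler_wpM2l.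
  exists 1; split => //; first by move=> e; rewrite e eqxx in c0.
  exists (2 * B + B + `|c'| * ((1 + B + `|c'| * (B / `|c|)) / `|c|) + 2 * `|c''| * (B / `|c|)).
  move=> N N0; have [_ h1 h2 _] := H N N0; have h3 := Q0 N N0; have h4 := Q1 N N0.
  set S := \sum_(_ <= _ < _) _ in h1 h2 *.
  (* With Q 0 and then Q 1 bounded, twice the second estimate minus the third eliminates Q 2 and
     leaves S - ln N. *)
  have -> : S - 1 * ln N%:R = 2 * (S - c / 2 * Q 2 N - c'' * Q 0 N) -
      (ln N%:R + S - c * Q 2 N - c' * Q 1 N) - c' * Q 1 N + 2 * c'' * Q 0 N by field.
  apply: le_trans (ler_normD _ _) _; apply: lerD; last first.
    by rewrite !normrM ger0_norm // ler_wpM2l // mulr_ge0.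
  apply: le_trans (ler_normB _ _) _; apply: lerD; last by rewrite normrM ler_wpM2l.
  apply: le_trans (ler_normB _ _) _; apply: lerD => //.
  by rewrite normrM ger0_norm // ler_wpM2l.
have [c'0|c'0] := eqVneq c' 0.
  exists (-1); split => [/eqP //|_|]; first by right.
  exists (B + B) => N N0; have [_ h1 h2 _] := H N N0; rewrite c0 c'0 !mul0r !subr0 in h1 h2.
  have -> : \sum_(1 <= n < N.+1) b n / n%:R - -1 * ln N%:R =
     ln N%:R + \sum_(1 <= n < N.+1) b n / n%:R by ring.
  by apply: le_trans h2 _; lra.
exists 0; split => [/eqP //|_|]; first by left.
exists (B + `|c''| * ((1 + B) / `|c'|)) => N N0.
have [h0 h1 _ _] := H N N0; rewrite c0 !mul0r !subr0 in h0 h1.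
have hQ : `|Q 0 N| <= (1 + B) / `|c'|.
  rewrite ler_pdivlMr ?normr_gt0 // mulrC -normrM.
  have -> : c' * Q 0 N = 1 - (1 - c' * Q 0 N) by ring.
  by apply: le_trans (ler_normB _ _) _; rewrite normr1 lerD.
set S := \sum_(_ <= _ < _) _ in h1 *.
have -> : S - 0 * ln N%:R = (S - c'' * Q 0 N) + c'' * Q 0 N by ring.
by apply: le_trans (ler_normD _ _) _; rewrite lerD // normrM ler_wpM2l.
Qed.

End Trichotomy.

(** * Hecke characters and lattice points *)

Import ComplexField.Normc.

Section Embedding.
Variable R : realType.
Local Notation C := R[i].
Local Notation Re := (@complex.Re R).
Local Notation Im := (@complex.Im R).
Local Notation "x %:C" := (real_complex R x) : ring_scope.

Lemma normc_ge0 (z : C) : 0 <= normc z.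
Proof. by case: z => x y; exact: sqrtr_ge0. Qed.
Lemma normcX (z : C) n : normc (z ^+ n) = normc z ^+ n.
Proof. by elim: n => [|n IH]; rewrite ?expr0 ?normc1 // !exprS normcM IH. Qed.
Lemma normc_real (x : R) : normc x%:C = `|x|.
Proof. by rewrite /= expr0n addr0 sqrtr_sqr. Qed.
Lemma le_normcB (x y : C) : normc (x - y) <= normc x + normc y.
Proof. by rewrite -(normcN y); exact: le_normcD. Qed.
Lemma normc_sum I (r : seq I) (P : pred I) (F : I -> C) :
  normc (\sum_(i <- r | P i) F i) <= \sum_(i <- r | P i) normc (F i).
Proof.
elim/big_rec2: _ => [|i y x _ h]; first by rewrite normc0.
by apply: le_trans (le_normcD _ _) _; rewrite lerD2l.
Qed.
Lemma Re_le_normc (z : C) : `|Re z| <= normc z.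
Proof. by case: z => x y /=; rewrite -sqrtr_sqr ler_wsqrtr // lerDl sqr_ge0. Qed.
Lemma sqr_normc (z : C) : normc z ^+ 2 = Re z ^+ 2 + Im z ^+ 2.
Proof. by case: z => x y /=; rewrite sqr_sqrtr // addr_ge0 // sqr_ge0. Qed.

Lemma ReD (x y : C) : Re (x + y) = Re x + Re y. Proof. by case: x y => a b []. Qed.
Lemma ReN (x : C) : Re (- x) = - Re x. Proof. by case: x. Qed.
Lemma ImD (x y : C) : Im (x + y) = Im x + Im y. Proof. by case: x y => a b []. Qed.
Lemma Re_sum I (r : seq I) (P : pred I) (F : I -> C) :
  Re (\sum_(i <- r | P i) F i) = \sum_(i <- r | P i) Re (F i).
Proof. by elim/big_rec2: _ => // i x y _ <-; rewrite ReD. Qed.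
Lemma ReM_real (x : R) (z : C) : Re (x%:C * z) = x * Re z.
Proof. by case: z => a b /=; rewrite mul0r subr0. Qed.

(** The complex embedding with omega = (-1 + i sqrt 3) / 2. *)
Definition emb (x : eis) : C :=
  Complex ((ere x)%:~R - (eim x)%:~R / 2) ((eim x)%:~R * (Num.sqrt 3 / 2)).
Definition mabs (x : eis) : R := Num.sqrt (norme x)%:R.

Let sqrt3 : Num.sqrt 3 ^+ 2 = 3 :> R. Proof. by rewrite sqr_sqrtr. Qed.

Lemma embD x y : emb (x + y) = emb x + emb y.
Proof. by case: x y => a b [c d]; congr Complex; rewrite /= !intrD; field. Qed.
Lemma embM x y : emb (x * y) = emb x * emb y.
Proof.
case: x y => a b [c d]; rewrite /emb; congr Complex; rewrite /= !(intrD, intrM, intrB).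
  transitivity ((a%:~R - b%:~R / 2) * (c%:~R - d%:~R / 2) - b%:~R * d%:~R * (Num.sqrt 3 ^+ 2) / 4 : R).
    by rewrite sqrt3; field.
  by field.
by field.
Qed.
Lemma emb_conj x : emb (conje x) = conjc (emb x).
Proof. by case: x => a b; congr Complex; rewrite /= !(intrD, intrN); field. Qed.
Lemma emb1 : emb 1 = 1.
Proof. by congr Complex; rewrite /= ?mul0r ?subr0. Qed.

Lemma normc_emb x : normc (emb x) = mabs x.
Proof.
rewrite /mabs; have -> : (norme x)%:R = (normez x)%:~R :> R by rewrite -normeE pmulrn.
case: x => a b; rewrite /normez /emb /=; congr Num.sqrt.
rewrite exprMn (exprMn _ (Num.sqrt 3)) sqrt3 !(intrD, intrM, intrB, intrN, exprSz) /= ?expr2 ?intrM; field => //.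
Qed.

Lemma mabs_ge0 x : 0 <= mabs x. Proof. exact: sqrtr_ge0. Qed.
Lemma mabs_gt0 x : x != 0 -> 0 < mabs x.
Proof. by rewrite -norme_gt0 sqrtr_gt0 ltr0n. Qed.
Lemma mabsM x y : mabs (x * y) = mabs x * mabs y.
Proof. by rewrite -!normc_emb embM normcM. Qed.
Lemma mabsD x y : mabs (x + y) <= mabs x + mabs y.
Proof. by rewrite -!normc_emb embD le_normcD. Qed.
Lemma mabsN x : mabs (- x) = mabs x.
Proof.
by rewrite /mabs; have -> : norme (- x) = norme x; rewrite // /norme; congr absz; case: x => a b; rewrite /normez /=; ring.
Qed.
Lemma mabs_conj x : mabs (conje x) = mabs x. Proof. by rewrite /mabs norme_conj. Qed.
Lemma sqr_mabs x : mabs x ^+ 2 = (norme x)%:R. Proof. by rewrite sqr_sqrtr. Qed.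
Lemma mabs_le x (r : R) : 0 <= r -> (mabs x <= r) = ((norme x)%:R <= r ^+ 2).
Proof. by move=> r0; rewrite -sqr_mabs ler_sqr // nnegrE ?mabs_ge0. Qed.
Lemma mabs_le_nat x r : (mabs x <= r%:R) = (norme x <= r ^ 2)%N.
Proof. by rewrite mabs_le // -natrX ler_nat. Qed.
Lemma mabs_le_sqrt x n : (mabs x <= Num.sqrt n%:R) = (norme x <= n)%N.
Proof. by rewrite mabs_le ?sqrtr_ge0 // sqr_sqrtr // ler_nat. Qed.

Definition unit_part x : C := emb x / (mabs x)%:C.
Definition lam k x : C := unit_part x ^+ k.

Lemma uaM x y : unit_part (x * y) = unit_part x * unit_part y.
Proof. by rewrite /unit_part embM mabsM rmorphM /= invfM; ring. Qed.
Lemma ua1 : unit_part 1 = 1.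
Proof. by rewrite /unit_part emb1 /mabs sqrtr1 rmorph1 divr1. Qed.
Lemma uaX x n : unit_part (x ^+ n) = unit_part x ^+ n.
Proof. by elim: n => [|n IH]; rewrite ?expr0 ?ua1 // !exprS uaM IH. Qed.
Lemma ua_conj x : unit_part (conje x) = conjc (unit_part x).
Proof. by rewrite /unit_part emb_conj mabs_conj rmorphM; congr (_ * _); rewrite -fmorphV /= oppr0. Qed.
Lemma normc_ua x : x != 0 -> normc (unit_part x) = 1.
Proof.
move=> /mabs_gt0 x0; rewrite /unit_part normcM normcV normc_real normc_emb ger0_norm ?ltW //.
by rewrite divff // gt_eqF.
Qed.
Lemma lamM k x y : lam k (x * y) = lam k x * lam k y.
Proof. by rewrite /lam uaM exprMn. Qed.
Lemma lam1 k : lam k 1 = 1. Proof. by rewrite /lam ua1 expr1n. Qed.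
Lemma normc_lam k x : x != 0 -> normc (lam k x) = 1.
Proof. by move=> x0; rewrite normcX normc_ua // expr1n. Qed.
Lemma lam_conj k x : lam k (conje x) = conjc (lam k x).
Proof. by rewrite /lam ua_conj rmorphXn. Qed.

(** Replacing the denominator |x| by |y| costs |x - y| / |y| a second time; hence the factor 2. *)
Lemma ua_lipschitz x y : x != 0 -> y != 0 ->
  normc (unit_part x - unit_part y) <= 2 * mabs (x - y) / mabs y.
Proof.
move=> x0 y0; have X0 := mabs_gt0 x0; have Y0 := mabs_gt0 y0.
have Xc : (mabs x)%:C != 0 by rewrite (inj_eq (@complexI _) _ 0) gt_eqF.
have Yc : (mabs y)%:C != 0 by rewrite (inj_eq (@complexI _) _ 0) gt_eqF.
have -> : unit_part x - unit_part y = emb (x - y) / (mabs y)%:C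
    + emb x / (mabs x)%:C * (((mabs y)%:C - (mabs x)%:C) / (mabs y)%:C).
  have -> : emb (x - y) = emb x - emb y.
    have -> : emb x = emb (x - y) + emb y by rewrite -embD subrK.
    by rewrite addrK.
  by rewrite /unit_part; field; rewrite Xc Yc.
have ny : normc (mabs y)%:C = mabs y by rewrite normc_real ger0_norm ?ltW.
apply: le_trans (le_normcD _ _) _; rewrite normcM normcV ny.
have := normc_ua x0; rewrite /unit_part => e; rewrite normcM e mul1r normcM normcV ny normc_emb.
rewrite -mulrDl ler_wpM2r ?invr_ge0 ?(ltW Y0) //.
have -> : 2 * mabs (x - y) = mabs (x - y) + mabs (x - y) by ring.
rewrite lerD2l -rmorphB normc_real ler_norml.
have h1 := mabsD (x - y) y; have h2 := mabsD (y - x) x.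
have h3 := mabsN (x - y); rewrite opprB in h3.
rewrite !subrK in h1 h2; apply/andP; split; lra.
Qed.

Lemma lam_lipschitz k x y : x != 0 -> y != 0 ->
  normc (lam k x - lam k y) <= k%:R * (2 * mabs (x - y) / mabs y).
Proof.
move=> x0 y0; apply: le_trans (_ : k%:R * normc (unit_part x - unit_part y) <= _); last first.
  by rewrite ler_wpM2l // ua_lipschitz.
rewrite /lam; elim: k => [|k IH]; first by rewrite !expr0 subrr normc0 mul0r.
have -> : unit_part x ^+ k.+1 - unit_part y ^+ k.+1 = unit_part x * (unit_part x ^+ k - unit_part y ^+ k) + (unit_part x - unit_part y) * unit_part y ^+ k.
  by rewrite !exprS; ring.
apply: le_trans (le_normcD _ _) _.
rewrite normcM normc_ua // mul1r normcM normcX normc_ua // expr1n mulr1.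
by rewrite -natr1 mulrDl mul1r lerD2r.
Qed.

End Embedding.

(** * Residue systems and tilings of the primary elements *)

Definition residues (g : eis) (F : seq eis) :=
  [/\ uniq F, forall x, exists q, exists2 r, r \in F & x = g * q + r &
   forall q q' r r', r \in F -> r' \in F -> g * q + r = g * q' + r' -> q = q' /\ r = r'].

Lemma residues_int (g : nat) : (0 < g)%N ->
  residues g%:R [seq Eis (Posz i) (Posz j) | i <- iota 0 g, j <- iota 0 g].
Proof.
move=> g0; have gE : g%:R = Eis g 0 by rewrite pmulrn eis_intr.
split.
- by apply: allpairs_uniq; rewrite ?iota_uniq // => -[a b] [c d] _ _ /= [-> ->].
- case=> a b; exists (Eis (a %/ g)%Z (b %/ g)%Z).
  have ha := modz_ge0 a (_ : g%:Z != 0); have hb := modz_ge0 b (_ : g%:Z != 0).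
  have ha' := ltz_pmod a (_ : 0 < g%:Z); have hb' := ltz_pmod b (_ : 0 < g%:Z).
  have g1 : g%:Z != 0 by lia.
  have g2 : 0 < g%:Z by lia.
  move: (ha g1) (hb g1) (ha' g2) (hb' g2) => {}ha {}hb {}ha' {}hb'.
  exists (Eis `|(a %% g)%Z|%N `|(b %% g)%Z|%N).
    by apply/allpairsP; exists (`|(a %% g)%Z|%N, `|(b %% g)%Z|%N); rewrite !mem_iota /=; split=> //; lia.
  rewrite gE !eisE; congr Eis => /=; rewrite gez0_abs //.
    by rewrite {1}(divz_eq a g); ring.
  by rewrite {1}(divz_eq b g); ring.
move=> [a b] [c d] r r' /allpairsP[[i j] /= [hi hj ->]] /allpairsP[[k l] /= [hk hl ->]].
rewrite gE !eisE /= => -[]; rewrite !mul0r ?subr0 ?addr0 => e1 e2.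
move: hi hj hk hl; rewrite !mem_iota /= => hi hj hk hl.
have D (x y : int) (m n : nat) : (m < g)%N -> (n < g)%N -> g%:Z * x + m%:Z = g%:Z * y + n%:Z -> x = y.
  move=> hm hn e; have : `|g%:Z * (x - y)| < g%:Z by have -> : g%:Z * (x - y) = n%:Z - m%:Z by [lia]; lia.
  by rewrite normrM ger0_norm // -{2}[g%:Z]mulr1 ltr_pM2l; lia.
have e3 := D _ _ _ _ hi hk e1; have e4 := D _ _ _ _ hj hl e2.
by rewrite e3 in e1 *; rewrite e4 in e2 *; split=> //; congr Eis; lia.
Qed.

(** A primary element of norm 7, the smallest rational prime congruent to 1 mod 3. *)
Definition gam7 := Eis 1 3.

(** The quotient is the field of 7 elements, with omega going to 2 since 1 + 3 * 2 = 7; thus x + y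
    omega has residue x + 2 y mod 7. *)
Lemma residues_gam7 : residues gam7 [seq Eis (Posz i) 0 | i <- iota 0 7].
Proof.
split=> //.
- case=> x y; pose t := ((x + 2 * y) %/ 7)%Z; pose r := ((x + 2 * y) %% 7)%Z.
  have r0 : 0 <= r by apply: modz_ge0.
  have r7 : r < 7 by apply: ltz_pmod.
  have e : x + 2 * y = t * 7 + r by exact: divz_eq.
  exists (Eis (- 2 * t + y) (- 3 * t + y)), (Eis `|r|%N 0).
    by apply/mapP; exists `|r|%N => //; rewrite mem_iota; lia.
  by rewrite /gam7 !eisE /= gez0_abs //; congr Eis; lia.
move=> q q' r r' /mapP[i + ->] /mapP[j + ->]; rewrite !mem_iota /= => hi hj e.
have e' : gam7 * (q - q') = Eis (j%:Z - i%:Z) 0.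
  have -> : gam7 * (q - q') = (gam7 * q + Eis i 0) - gam7 * q' - Eis i 0 by ring.
  by rewrite e [gam7 * q' + _]addrC addrK !eisE /=; congr Eis.
have := congr1 normez e'; rewrite normezM -(normeE (q - q')) /normez /= => e7.
have ij : j = i.
  have : (7 %| `|j%:Z - i%:Z| ^ 2)%N.
    apply/dvdnP; exists (norme (q - q')); apply/eqP; rewrite -eqz_nat expnE /=; nia.
  rewrite Euclid_dvdX // andbT => /dvdnP[k hk]; lia.
rewrite ij in e' *; split=> //; move: e'; rewrite subrr => /eqP.
by rewrite eis_mulf_eq0 subr_eq0 => /orP[/eqP//|/eqP].
Qed.

Lemma conje_inj : injective conje. Proof. exact: inv_inj conjeK. Qed.

Lemma residues_conj g F : residues g F -> residues (conje g) (map conje F).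
Proof.
case=> uF hE hU; split; first by rewrite map_inj_uniq //; exact: conje_inj.
- move=> x; have [q [r rF e]] := hE (conje x).
  exists (conje q), (conje r); first exact: map_f.
  by rewrite -conjeM -conjeD -e conjeK.
move=> q q' r r' /mapP[s sF ->] /mapP[s' sF' ->] /(congr1 conje).
rewrite !conjeD !conjeM !conjeK => /(hU _ _ _ _ sF sF')[h ->].
by split=> //; apply: conje_inj.
Qed.

Section Residues.
Variables (g : eis) (F : seq eis).
Hypotheses (pg : primary g) (hF : residues g F).

(** As g is 1 mod 3, division by g can be carried out within the class 1 mod 3: quotients remain
    primary and remainders are multiples of 3. With [primary_residue_inj], the points g y + 3 r
    enumerate the primary elements exactly once. *)
Lemma primary_residue x : primary x ->
  exists y, exists2 r, primary y && (r \in F) & x = g * y + r *+ 3.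
Proof.
case: hF => _ hE _ /primaryP[u ->]; case/primaryP: (pg) => v gE.
have [q [r rF e]] := hE (u - v).
exists (1 + q *+ 3), r; first by rewrite rF andbT; apply/primaryP; exists q.
have -> : u = g * q + r + v by rewrite -e subrK.
transitivity (1 + v *+ 3 + (g * q) *+ 3 + r *+ 3); first by ring.
by rewrite -gE; ring.
Qed.

Lemma primary_residue_primary y r : primary y -> primary (g * y + r *+ 3).
Proof.
move=> /(primaryM pg)/primaryP[u ->]; apply/primaryP; exists (u + r); ring.
Qed.

Lemma mulr3_inj (x y : eis) : x *+ 3 = y *+ 3 -> x = y.
Proof. by case: x y => a b [c d]; rewrite !eisMn /= => -[e1 e2]; congr Eis; lia. Qed.

Lemma primary_residue_inj y y' r r' : primary y -> primary y' -> r \in F -> r' \in F ->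
  g * y + r *+ 3 = g * y' + r' *+ 3 -> y = y' /\ r = r'.
Proof.
case: hF => _ _ hU /primaryP[u ->] /primaryP[u' ->] rF rF' e.
have : (g * u + r) *+ 3 = (g * u' + r') *+ 3.
  have -> : (g * u + r) *+ 3 = (g * (1 + u *+ 3) + r *+ 3) - g by ring.
  by rewrite e; ring.
by move/mulr3_inj/hU => /(_ rF rF')[-> ->].
Qed.

Definition residue_pairs M := [seq g * y + r *+ 3 | y <- disk M, r <- F].

Lemma residue_pairs_uniq M : uniq (residue_pairs M).
Proof.
apply: allpairs_uniq; rewrite ?disk_uniq //; first by case: hF.
move=> [y r] [y' r'] /allpairsP[[a b] /= [ha hb [-> ->]]] /allpairsP[[c d] /= [hc hd [-> ->]]] /=.
rewrite !mem_disk in ha hc; move/andP: ha => [ha _]; move/andP: hc => [hc _].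
by case/primary_residue_inj => // -> ->.
Qed.

Lemma size_residue_pairs M : size (residue_pairs M) = (size (disk M) * size F)%N.
Proof. exact: size_allpairs. Qed.

End Residues.

(** * Counting primary elements in disks *)

Definition disk_count n := size (disk n).

Lemma leq_disk_count m n : (m <= n)%N -> (disk_count m <= disk_count n)%N.
Proof.
move=> mn; apply: uniq_leq_size; rewrite ?disk_uniq // => x.
by rewrite !mem_disk => /andP[-> h]; rewrite (leq_trans h).
Qed.

Section Counting.
Variable R : realType.
Local Notation mabs := (@mabs R).

Lemma mabs_mulr3 x : mabs (x *+ 3) <= 3 * mabs x.
Proof.
have -> : x *+ 3 = x + (x + x) by ring.
have := mabsD R x (x + x); have := mabsD R x x; lra.
Qed.

Lemma mabs_residue_int (g : nat) r :
  r \in [seq Eis (Posz i) (Posz j) | i <- iota 0 g, j <- iota 0 g] -> mabs r <= g%:R.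
Proof.
case/allpairsP=> -[i j] /= [+ + ->]; rewrite !mem_iota /= => hi hj.
rewrite mabs_le_nat -lez_nat normeE /normez /= expnE /=.
have [ij|ij] := leqP i j; nia.
Qed.

Lemma mabs_nat (g : nat) : mabs g%:R = g%:R.
Proof.
have -> : g%:R = Eis g 0 by rewrite pmulrn eis_intr.
rewrite /mabs; have -> : norme (Eis g 0) = (g ^ 2)%N.
  by apply/eqP; rewrite -eqz_nat normeE /normez /=; apply/eqP; rewrite expnE /=; lia.
by rewrite natrX sqrtr_sqr ger0_norm.
Qed.

(** The blocks of g^2 points g y + 3 s are disjoint and stay within 3 g of g y, whence the change of
    radius by 3. The companion [disk_count_scale_le] reads the same tiling backwards. *)
Lemma disk_count_scale_ge (g r : nat) : (g %% 3 = 1)%N ->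
  (g ^ 2 * disk_count (r ^ 2) <= disk_count ((g * (r + 3)) ^ 2))%N.
Proof.
move=> g1; have g0 : (0 < g)%N by lia.
have pg : primary g%:R by rewrite pmulrn eis_intr /primary /=; lia.
have hF := residues_int g0; set F := [seq _ | _ <- _, _ <- _] in hF.
have sF : size F = (g ^ 2)%N by rewrite size_allpairs !size_iota mulnn.
rewrite -sF mulnC -(size_residue_pairs (g%:R)); apply: uniq_leq_size.
  exact: residue_pairs_uniq.
move=> x /allpairsP[[y s] /= [yd sF' ->]]; move: yd; rewrite !mem_disk => /andP[py hy].
rewrite primary_residue_primary //= -(@mabs_le_nat R) natrM natrD.
apply: le_trans (mabsD _ _ _) _; rewrite mabsM mabs_nat mulrDr; apply: lerD.
  by rewrite ler_wpM2l // mabs_le_nat.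
apply: le_trans (mabs_mulr3 _) _; rewrite mulrC ler_wpM2r //; exact: mabs_residue_int.
Qed.

Lemma disk_count_scale_le (g r : nat) : (g %% 3 = 1)%N ->
  (disk_count ((g * r) ^ 2) <= g ^ 2 * disk_count ((r + 3) ^ 2))%N.
Proof.
move=> g1; have g0 : (0 < g)%N by lia.
have pg : primary g%:R by rewrite pmulrn eis_intr /primary /=; lia.
have hF := residues_int g0; set F := [seq _ | _ <- _, _ <- _] in hF.
have sF : size F = (g ^ 2)%N by rewrite size_allpairs !size_iota mulnn.
rewrite -sF [leqRHS]mulnC -(size_residue_pairs (g%:R)); apply: uniq_leq_size.
  exact: disk_uniq.
move=> x; rewrite mem_disk => /andP[px hx].
have [y [s /andP[py sF'] e]] := primary_residue pg hF px.
apply/allpairsP; exists (y, s); split=> //=; rewrite mem_disk py /=.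
rewrite -(@mabs_le_nat R) natrD; rewrite -(@mabs_le_nat R) in hx.
have G0 : 0 < g%:R :> R by rewrite ltr0n.
rewrite -(ler_pM2l G0) -{1}mabs_nat -mabsM.
have -> : g%:R * y = x + - (s *+ 3) by rewrite e; ring.
apply: le_trans (mabsD _ _ _) _; rewrite mabsN mulrDr -natrM; apply: lerD => //.
apply: le_trans (mabs_mulr3 _) _; rewrite mulrC ler_wpM2r //; exact: mabs_residue_int.
Qed.

End Counting.

(** A square root rounded down to a number congruent to 1 mod 3, since scaling factors must be
    primary; 3 t + 4 is the next such number. *)
Lemma nat_root3 n : (0 < n)%N -> exists t, ((3 * t + 1) ^ 2 <= n < (3 * t + 4) ^ 2)%N.
Proof.
elim: n => // n IH _; have [->|n0] := posnP n; first by exists 0%N.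
have [t /andP[h1 h2]] := IH n0.
have [h|h] := ltnP n.+1 ((3 * t + 4) ^ 2); first by exists t; lia.
by exists t.+1; rewrite !expnE /= in h h1 h2 *; lia.
Qed.

Lemma disk_count0 : disk_count 0 = 0%N. Proof. by []. Qed.

Lemma disk_sum (V : nmodType) (F : eis -> V) n :
  \sum_(x <- disk n) F x = \sum_(1 <= i < n.+1) \sum_(x <- shell i) F x.
Proof.
elim: n => [|n IH]; first by rewrite big_geq // /disk /= big_nil.
rewrite big_nat_recr //= -IH -big_cat /=; apply/perm_big/uniq_perm.
- exact: disk_uniq.
- rewrite cat_uniq disk_uniq shell_uniq andbT /=; apply/hasPn => x.
  by rewrite mem_shell mem_disk => /andP[_ /eqP ->]; rewrite ltnn andbF.
move=> x; rewrite mem_cat !mem_disk mem_shell -andb_orr; congr andb.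
by rewrite leq_eqVlt orbC.
Qed.

Section Lattice.
Variable R : realType.
Local Notation mabs := (@mabs R).
Local Notation lam := (@lam R).

Lemma disk_count_asymp : exists c K : R, [/\ 0 < c, 0 <= K &
  forall n, `|(disk_count n)%:R - c * n%:R| <= K * Num.sqrt n%:R].
Proof.
(* Both sides are compared with the count at radius (3 t + 4) (3 t' + 1). Hence every lower ratio is
   at most every upper ratio, and the density c is the supremum of the lower ones. *)
have cmp t t' : (disk_count ((3 * t + 1) ^ 2))%:R / ((3 * t + 4) ^ 2)%:R <=
                (disk_count ((3 * t' + 4) ^ 2))%:R / ((3 * t' + 1) ^ 2)%:R :> R.
  rewrite ler_pdivrMr ?ltr0n ?expn_gt0 ?addn_gt0 ?orbT // mulrAC.
  rewrite ler_pdivlMr ?ltr0n ?expn_gt0 ?addn_gt0 ?orbT // -!natrM ler_nat.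
  have h1 := @disk_count_scale_ge R (3 * t' + 1) (3 * t + 1) ltac:(by rewrite mulnC modnMDl).
  have h2 := @disk_count_scale_le R (3 * t + 4) (3 * t' + 1) ltac:(by rewrite mulnC modnMDl).
  rewrite -addnA in h1; rewrite -addnA in h2.
  by rewrite mulnC (mulnC (disk_count ((3 * t' + 4) ^ 2))) (leq_trans h1) // mulnC.
pose E : set R := [set x | exists t, x = (disk_count ((3 * t + 1) ^ 2))%:R / ((3 * t + 4) ^ 2)%:R]%classic.
have E0 : (E !=set0)%classic by exists ((disk_count ((3 * 0 + 1) ^ 2))%:R / ((3 * 0 + 4) ^ 2)%:R), 0%N.
have ubE t : ubound E ((disk_count ((3 * t + 4) ^ 2))%:R / ((3 * t + 1) ^ 2)%:R).
  by move=> x [s ->].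
pose c := sup E.
have c1 t : (disk_count ((3 * t + 1) ^ 2))%:R <= c * ((3 * t + 4) ^ 2)%:R.
  rewrite -ler_pdivrMr ?ltr0n ?expn_gt0 ?addn_gt0 ?orbT //.
  by apply: ub_le_sup; [exists ((disk_count ((3 * 0 + 4) ^ 2))%:R / ((3 * 0 + 1) ^ 2)%:R); exact: ubE | exists t].
have c2 t : c * ((3 * t + 1) ^ 2)%:R <= (disk_count ((3 * t + 4) ^ 2))%:R.
  rewrite -ler_pdivlMr ?ltr0n ?expn_gt0 ?addn_gt0 ?orbT //.
  exact: ge_sup.
have c0 : 0 < c.
  have := c1 0%N; have : (0 < disk_count ((3 * 0 + 1) ^ 2))%N.
    have : 1 \in disk ((3 * 0 + 1) ^ 2) by rewrite mem_disk.
    by rewrite /disk_count; case: disk.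
  rewrite -(ler_nat R) => h1 h2; have : 0 < c * ((3 * 0 + 4) ^ 2)%:R by lra.
  by rewrite pmulr_lgt0 // ltr0n.
(* For x = sqrt n >= 1, (x + 6)^2 - x^2 = 12 x + 36 <= 48 x. *)
exists c, (48 * c); split=> //; first by rewrite mulr_ge0 // ltW.
move=> n; have [->|n0] := posnP n.
  by rewrite disk_count0 mulr0 subrr normr0 mulr_ge0 ?sqrtr_ge0 // mulr_ge0 // ltW.
have [t /andP[t1 t2]] := nat_root3 n0.
have N1 : 1 <= n%:R :> R by rewrite ler1n.
have xn : Num.sqrt n%:R ^+ 2 = n%:R :> R by rewrite sqr_sqrtr.
have x1 : 1 <= Num.sqrt n%:R :> R by rewrite -[leLHS]sqrtr1 ler_wsqrtr // ler1n.
move: (Num.sqrt _) x1 xn => x x1 xn.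
have T0 : 0 <= t%:R :> R by [].
have tx : 3 * t%:R + 1 <= x.
  have : (3 * t%:R + 1) ^+ 2 <= x ^+ 2 by rewrite xn -natrM natr1 -natrX ler_nat -addn1.
  by rewrite ler_sqr ?nnegrE //; lra.
have xt : x < 3 * t%:R + 4.
  have : x ^+ 2 < (3 * t%:R + 4) ^+ 2 by rewrite xn -natrM -natrD -natrX ltr_nat.
  by rewrite ltr_sqr ?nnegrE //; lra.
have up : (disk_count n)%:R <= c * (x + 6) ^+ 2.
  apply: le_trans (_ : (disk_count ((3 * t.+1 + 1) ^ 2))%:R <= _).
    by rewrite ler_nat leq_disk_count // ltnW // (leq_trans t2) // leq_sqr; lia.
  apply: le_trans (c1 _) _; rewrite ler_pM2l // natrX lerXn2r ?nnegrE //; first lra.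
  by rewrite natrD natrM -natr1; lra.
have dn : c * (x ^+ 2 - 12 * x) <= (disk_count n)%:R.
  case: t t1 t2 T0 tx xt => [|t] t1 t2 T0 tx xt.
    apply: le_trans (_ : 0 <= _) => //; rewrite -oppr_ge0 -mulrN mulr_ge0 ?(ltW c0) //; nra.
  apply: le_trans (_ : (disk_count ((3 * t + 4) ^ 2))%:R <= _); last first.
    by rewrite ler_nat leq_disk_count // (leq_trans _ t1) // leq_sqr; lia.
  apply: le_trans (c2 t); rewrite ler_pM2l // natrX natrD natrM.
  have {}T0 : 0 <= t%:R :> R by [].
  by rewrite -natr1 in tx xt; nra.
rewrite ler_norml -xn; apply/andP; split.
  have : c * 0 <= c * x by rewrite ler_pM2l //; lra.
  lra.
have : c * 1 <= c * x by rewrite ler_pM2l.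
lra.
Qed.

Lemma disk_count_le : exists2 K : R, 0 <= K & forall n, (disk_count n)%:R <= K * n%:R.
Proof.
have [c [K [c0 K0 H]]] := disk_count_asymp; exists (c + K); first lra.
move=> n; have [->|n0] := posnP n; first by rewrite disk_count0 mulr0.
have := H n; rewrite ler_norml => /andP[_ h].
have : K * Num.sqrt n%:R <= K * n%:R.
  apply: ler_wpM2l => //; have x1 : 1 <= Num.sqrt n%:R :> R.
    by rewrite -[leLHS]sqrtr1 ler_wsqrtr // ler1n.
  by rewrite -{2}(sqr_sqrtr (ler0n R n)) expr2 ler_peMr // sqrtr_ge0.
lra.
Qed.

Lemma sum_inv_sqrt n : \sum_(1 <= i < n.+1) (Num.sqrt i%:R)^-1 <= 2 * Num.sqrt n%:R :> R.
Proof.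
elim: n => [|n IH]; first by rewrite big_geq // mulr_ge0 // sqrtr_ge0.
rewrite big_nat_recr //=.
have e0 : Num.sqrt n%:R ^+ 2 = n%:R :> R by rewrite sqr_sqrtr.
have e1 : Num.sqrt n.+1%:R ^+ 2 = n%:R + 1 :> R by rewrite sqr_sqrtr // natr1.
have s0 : 0 <= Num.sqrt n%:R :> R by exact: sqrtr_ge0.
have t0 : 0 < Num.sqrt n.+1%:R :> R by rewrite sqrtr_gt0 ltr0n.
have st : Num.sqrt n%:R <= Num.sqrt n.+1%:R :> R by rewrite ler_wsqrtr // ler_nat.
apply: le_trans (lerD IH (lexx _)) _.
move: (Num.sqrt _) (Num.sqrt _) e0 e1 s0 t0 st => t s e0 e1 s0 t0 st.
suff : t^-1 <= 2 * (t - s) by lra.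
rewrite -div1r ler_pdivrMr //; have := sqr_ge0 (t - s); nra.
Qed.

(** Bounds the total error made when lam_k is moved by a bounded amount at each element of a
    disk. *)
Lemma sum_inv_mabs : exists2 K : R, 0 <= K &
  forall n, \sum_(x <- disk n) (mabs x)^-1 <= K * Num.sqrt n%:R.
Proof.
have [K K0 hK] := disk_count_le; exists (K * 2); first by rewrite mulr_ge0.
move=> n; rewrite disk_sum.
have -> : \sum_(1 <= i < n.+1) \sum_(x <- shell i) (mabs x)^-1 =
   \sum_(1 <= i < n.+1) (size (shell i))%:R * (Num.sqrt i%:R)^-1.
  apply: eq_bigr => i _; rewrite big_seq (eq_bigr (fun=> (Num.sqrt i%:R)^-1)).
    by rewrite -big_seq big_const_seq count_predT iter_addr_0 mulr_natl.
  by move=> x; rewrite mem_shell => /andP[_ /eqP <-].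
apply: le_trans (sum_monotone_le _ _ (_ : forall k, \sum_(1 <= i < k.+1) (size (shell i))%:R <= K * k%:R) _ _) _ => //.
- move=> k; apply: le_trans (hK k); rewrite /disk_count -sum1_size disk_sum natr_sum.
  by under [leRHS]eq_bigr do rewrite sum1_size.
- by move=> k k0; rewrite lef_pV2 ?posrE ?sqrtr_gt0 ?ltr0n // ler_wsqrtr // ler_nat.
- by move=> k _; rewrite invr_ge0 sqrtr_ge0.
by rewrite -mulrA ler_wpM2l // sum_inv_sqrt.
Qed.

(** Controls the elements that a shift of length at most 7 carries across the circle of radius sqrt
    n. The bound is uniform in the list [disk M] from which they are drawn. *)
Lemma annulus_count : exists2 K : R, 0 <= K & forall n M, (0 < n)%N ->
  (size [seq x <- disk M | (Num.sqrt n%:R - 7 <= mabs x) && (mabs x <= Num.sqrt n%:R + 7)])%:R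
    <= K * Num.sqrt n%:R.
Proof.
have [c [K [c0 K0 H]]] := disk_count_asymp.
exists (c * 106 + K * 10); first by rewrite addr_ge0 ?mulr_ge0 // ltW.
move=> n M n0; set L := [seq _ <- _ | _].
have xn : Num.sqrt n%:R ^+ 2 = n%:R :> R by rewrite sqr_sqrtr.
have x1 : 1 <= Num.sqrt n%:R :> R by rewrite -[leLHS]sqrtr1 ler_wsqrtr // ler1n.
have [s /andP[s1 s2]] : exists s, (s ^ 2 <= n < s.+1 ^ 2)%N.
  have [t /andP[h1 h2]] := nat_root3 n0.
  have [h|h] := ltnP n ((3 * t + 2) ^ 2); first by exists (3 * t + 1)%N; rewrite h1 (leq_trans h) // leq_sqr; lia.
  have [h'|h'] := ltnP n ((3 * t + 3) ^ 2); first by exists (3 * t + 2)%N; rewrite h (leq_trans h') // leq_sqr; lia.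
  by exists (3 * t + 3)%N; rewrite h' (leq_trans h2) // leq_sqr; lia.
have sx : s%:R <= Num.sqrt n%:R :> R.
  by rewrite -ler_sqr ?nnegrE ?sqrtr_ge0 // xn -natrX ler_nat.
have xs : Num.sqrt n%:R <= s%:R + 1 :> R.
  by rewrite natr1 -ler_sqr ?nnegrE ?sqrtr_ge0 // xn -natrX ler_nat ltnW.
(* With sqrt n < s + 1, norms in the annulus are at most n1, and norms up to n2 lie inside its inner
   circle. If the subtraction truncates to 0, the disk of n2 is empty. *)
pose n1 := (n + 14 * (s + 1) + 49)%N; pose n2 := (n - (14 * (s + 1) + 1))%N.
have n1E : n1%:R = n%:R + 14 * (s%:R + 1) + 49 :> R.
  by rewrite /n1 addn1 natr1 -natrM -!natrD.
have n21 : (n2 <= n1)%N by rewrite /n1 /n2; lia.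
have sz : (size L + disk_count n2 <= disk_count n1)%N.
  rewrite -size_cat; apply: uniq_leq_size.
    rewrite cat_uniq filter_uniq ?disk_uniq // andbT; apply/hasPn => y.
    rewrite mem_disk => /andP[py hy]; rewrite /= mem_filter negb_and; apply/orP; left.
    rewrite negb_and; apply/orP; left; rewrite -ltNge.
    have ny : (0 < norme y)%N by rewrite norme_gt0 primary_neq0.
    have nn : (norme y + 14 * (s + 1) + 1 <= n)%N by move: hy; rewrite /n2; lia.
    have : (norme y)%:R + 14 * (s%:R + 1) + 1 <= n%:R :> R.
      by rewrite natr1 -natrM -natrD natr1 ler_nat; lia.
    rewrite -(sqr_mabs R y).
    have := mabs_ge0 R y; move: x1 xs xn; move: (Num.sqrt n%:R) (mabs y) => x z x1 xs xn z0 h.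
    rewrite ltNge; apply/negP => h7; have [x7|x7] := leP 7 x.
      have : (x - 7) ^+ 2 <= z ^+ 2 by rewrite ler_sqr ?nnegrE //; lra.
      lra.
    have : x * x <= 7 * x by rewrite ler_wpM2r //; lra.
    have := sqr_ge0 z; lra.
  move=> y; rewrite mem_cat => /orP[|].
    rewrite mem_filter => /andP[/andP[_ hy]]; rewrite mem_disk => /andP[py _].
    rewrite mem_disk py /= -(ler_nat R) -(sqr_mabs R) n1E -xn.
    have := mabs_ge0 R y; move: hy x1 xs; move: (Num.sqrt _) (mabs y) => x z hy x1 xs z0.
    have : z ^+ 2 <= (x + 7) ^+ 2 by rewrite ler_sqr ?nnegrE //; lra.
    lra.
  by rewrite !mem_disk => /andP[-> h] /=; exact: leq_trans h n21.
have sz' : (size L)%:R <= (disk_count n1)%:R - (disk_count n2)%:R :> R.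
  by rewrite lerBrDr -natrD ler_nat.
apply: le_trans sz' _.
have := H n1; rewrite ler_norml => /andP[_ h1].
have := H n2; rewrite ler_norml => /andP[h2 _].
have q1 : Num.sqrt n1%:R <= 9 * Num.sqrt n%:R :> R.
  rewrite -ler_sqr ?nnegrE ?sqrtr_ge0 ?mulr_ge0 ?sqrtr_ge0 // sqr_sqrtr //.
  rewrite exprMn xn n1E.
  have : Num.sqrt n%:R <= n%:R :> R by rewrite -[leRHS]xn expr2 ler_peMr // sqrtr_ge0.
  by have : 1 <= n%:R :> R; [rewrite ler1n | lra].
have q2 : Num.sqrt n2%:R <= Num.sqrt n%:R :> R by rewrite ler_wsqrtr // ler_nat leq_subr.
have q3 : n1%:R - n2%:R <= 106 * Num.sqrt n%:R :> R.
  have : (n1 <= n2 + (28 * (s + 1) + 50))%N by rewrite /n1 /n2; lia.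
  rewrite -(ler_nat R) natrD; have -> : (28 * (s + 1) + 50)%:R = 28 * (s%:R + 1) + 50 :> R.
    by rewrite addn1 natr1 -natrM -natrD.
  lra.
have p1 := ler_wpM2l K0 q1; have p2 := ler_wpM2l K0 q2; have p3 := ler_wpM2l (ltW c0) q3.
lra.
Qed.

End Lattice.

(** The form x + 2 y is reduction modulo gam7: it vanishes mod 7 on multiples of gam7 and is -1 at
    the conjugate, whose powers thus have residue 1 or -1. *)
Lemma exp_gam7_neq k : (0 < k)%N -> gam7 ^+ k != conje gam7 ^+ k.
Proof.
pose h (x : eis) := ere x + 2 * eim x.
case: k => // k _; apply/eqP => e.
have h1 y : exists m, h (gam7 * y) = 7 * m.
  by case: y => c d; exists (c - d); rewrite /h /gam7 /=; ring.
have h2 y : exists m, h (conje gam7 * y) = 7 * m - h y.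
  by case: y => c d; exists (d - c); rewrite /h /gam7 /=; ring.
have h3 n : exists m, h (conje gam7 ^+ n) = 7 * m + 1 \/ h (conje gam7 ^+ n) = 7 * m - 1.
  elim: n => [|n [m IH]]; first by exists 0; left.
  rewrite exprS; have [m' ->] := h2 (conje gam7 ^+ n).
  by case: IH => ->; exists (m' - m); [right | left]; ring.
have [m em] := h3 k.+1; rewrite -e exprS in em; have [m' em'] := h1 (gam7 ^+ k).
by rewrite em' in em; lia.
Qed.

(** * Cancellation in sums of lam_k *)

Section CharacterSums.
Variable R : realType.
Local Notation C := R[i].
Local Notation mabs := (@mabs R).
Local Notation lam := (@lam R).
Local Notation "x %:C" := (real_complex R x) : ring_scope.

Lemma emb_inj : injective (@emb R).
Proof.
move=> [a b] [c d] [] e1 e2.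
have s0 : Num.sqrt 3 / 2 != 0 :> R by rewrite mulf_neq0 ?invr_eq0 ?gt_eqF ?sqrtr_gt0.
have ebd : b%:~R = d%:~R :> R by exact: (mulIf s0 e2).
have bd : b = d by exact: intr_inj ebd.
have ac : a = c by apply: (@intr_inj R); move: e1; rewrite ebd; lra.
by rewrite bd ac.
Qed.

Lemma lam_gam7_neq k : (0 < k)%N -> lam k gam7 != lam k (conje gam7).
Proof.
move=> k0; apply: contra (exp_gam7_neq k0) => /eqP; rewrite /lam -!uaX /unit_part.
have -> : mabs (gam7 ^+ k) = mabs (conje gam7 ^+ k) by rewrite /mabs !normeX norme_conj.
set c := (_)%:C; have c0 : c != 0.
  rewrite (inj_eq (@complexI _) _ 0) gt_eqF // mabs_gt0 // -norme_gt0 normeX expn_gt0.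
  by rewrite norme_conj.
by move=> /(mulIf (invr_neq0 c0)) /emb_inj ->.
Qed.

Section Scaling.
Variables (g : eis) (F : seq eis) (k : nat).
Hypotheses (pg : primary g) (hF : residues g F) (ng : norme g = 7%N) (sF : size F = 7%N).
Hypothesis F6 : forall r, r \in F -> mabs r <= 6.

Let sg : mabs g ^+ 2 = 7. Proof. by rewrite sqr_mabs ng. Qed.
Let g0 : 0 < mabs g. Proof. by rewrite mabs_gt0 ?primary_neq0. Qed.

(** Here 3 * 6 = 18 and 18^2 = 324 <= 343 = (7 sqrt 7)^2. After division by |g| = sqrt 7 the shift
    is at most 7, the half-width of the annulus. *)
Let F18 r : r \in F -> mabs (r *+ 3) <= 7 * mabs g.
Proof.
move=> rF; apply: le_trans (_ : 18 <= _).
  by apply: le_trans (mabs_mulr3 _ _) _; have := F6 rF; lra.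
rewrite -ler_sqr ?nnegrE ?mulr_ge0 ?(ltW g0) // exprMn sg; lra.
Qed.

(** If both points count, the Lipschitz bound with |3 r| <= 7 |g| gives 14 k / |x|. If exactly one
    counts, x lies in the annulus and the difference has modulus 1. *)
Lemma scaling_term n x r : primary x -> r \in F ->
  normc ((if (norme (g * x + r *+ 3)%R <= 7 * n)%N then lam k (g * x + r *+ 3) else 0) -
         (if (norme x <= n)%N then lam k (g * x) else 0)) <=
  (if (norme x <= n)%N then 14 * k%:R / mabs x else 0) +
  (if (Num.sqrt n%:R - 7 <= mabs x) && (mabs x <= Num.sqrt n%:R + 7) then 1 else 0).
Proof.
move=> px rF; set y := g * x + r *+ 3.
have x0 := primary_neq0 px; have X0 := mabs_gt0 R x0.
have py : primary y by exact: primary_residue_primary.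
have y0 := primary_neq0 py.
have gx0 : g * x != 0 by rewrite eis_mulf_eq0 negb_or primary_neq0.
have b0 (b : bool) : 0 <= (if b then 1 else 0) :> R by case: b.
have t0 : 0 <= 14 * k%:R / mabs x by rewrite divr_ge0 ?mulr_ge0 // ltW.
have s7 : Num.sqrt (7 * n)%:R = mabs g * Num.sqrt n%:R :> R.
  by rewrite natrM sqrtrM // -{1}sg sqrtr_sqr ger0_norm ?ltW.
have r18 := F18 rF.
have q0 : 0 <= Num.sqrt n%:R :> R by exact: sqrtr_ge0.
case: ifPn => hy; case: ifPn => hx.
- apply: le_trans (_ : 14 * k%:R / mabs x <= _); last by rewrite lerDl.
  apply: le_trans (lam_lipschitz _ k y0 gx0) _.
  have -> : y - g * x = r *+ 3 by rewrite /y addrAC subrr add0r.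
  have -> : 14 * k%:R / mabs x = k%:R * (14 / mabs x) by ring.
  rewrite ler_wpM2l // mabsM ler_pdivrMr ?mulr_gt0 //.
  have -> : 14 / mabs x * (mabs g * mabs x) = 14 * mabs g by field; rewrite gt_eqF.
  lra.
- rewrite subr0 normc_lam // add0r ifT //.
  move: hy hx; rewrite -!(mabs_le_sqrt R) -ltNge s7 => hy hx; apply/andP; split; first by lra.
  rewrite -(ler_pM2l g0) -mabsM.
  have -> : g * x = y + - (r *+ 3) by rewrite /y addrK.
  by apply: le_trans (mabsD _ _ _) _; rewrite mabsN; lra.
- rewrite sub0r normcN normc_lam // ifT; first by lra.
  move: hy hx; rewrite -!(mabs_le_sqrt R) -ltNge s7 => hy hx; apply/andP; split; last by lra.
  rewrite -(ler_pM2l g0) mulrBr -mabsM.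
  by have := mabsD R (g * x) (r *+ 3); rewrite -/y; lra.
- by rewrite subr0 normc0 add0r.
Qed.

Lemma scaling_sum : exists2 K : R, 0 <= K & forall n, (0 < n)%N ->
  normc (\sum_(x <- disk (7 * n)) lam k x - 7 * lam k g * \sum_(x <- disk n) lam k x) <=
    K * Num.sqrt n%:R.
Proof.
have [K1 K10 h1] := sum_inv_mabs R; have [K2 K20 h2] := annulus_count R.
exists (7 * (14 * k%:R * K1 + K2)); first by rewrite mulr_ge0 // addr_ge0 // !mulr_ge0.
(* Large enough for every x that occurs: (q + 7)^2 <= 2 q^2 + 98 with q = sqrt n. *)
move=> n n0; pose M := (2 * n + 98)%N.
have e1 : \sum_(x <- disk (7 * n)) lam k x = \sum_(x <- disk M) \sum_(r <- F)
    (if (norme (g * x + r *+ 3)%R <= 7 * n)%N then lam k (g * x + r *+ 3) else 0).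
  rewrite -(big_allpairs_dep (h := fun x r => g * x + r *+ 3) (r2 := fun=> F)
     (F := fun y => if (norme y <= 7 * n)%N then lam k y else 0)) /=.
  rewrite -big_mkcond -[RHS]big_filter.

apply/perm_big/uniq_perm.
  - exact: disk_uniq.
  - by rewrite filter_uniq //; exact: residue_pairs_uniq.
  move=> y; rewrite mem_disk mem_filter andbC; apply: andb_id2l => hy.
  apply/idP/allpairsP => [py|[[x r] /= [xd rF ->]]]; last first.
    by apply: primary_residue_primary; move: xd; rewrite mem_disk => /andP[].
  have [x [r /andP[px rF] e]] := primary_residue pg hF py.
  exists (x, r); split=> //=; rewrite mem_disk px /= -(ler_nat R) -(sqr_mabs R).
  have s7 : Num.sqrt (7 * n)%:R = mabs g * Num.sqrt n%:R :> R.
    by rewrite natrM sqrtrM // -{1}sg sqrtr_sqr ger0_norm ?ltW.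
  rewrite -(mabs_le_sqrt R) s7 in hy.
  have hx : mabs x <= Num.sqrt n%:R + 7.
    rewrite -(ler_pM2l g0) -mabsM.
    have -> : g * x = y + - (r *+ 3) by rewrite e addrK.
    by apply: le_trans (mabsD _ _ _) _; rewrite mabsN; have := F18 rF; lra.
  have xn : Num.sqrt n%:R ^+ 2 = n%:R :> R by rewrite sqr_sqrtr.
  have -> : M%:R = 2 * n%:R + 98 :> R by rewrite /M natrD natrM.
  have q0 : 0 <= Num.sqrt n%:R :> R by exact: sqrtr_ge0.
  have x0 := mabs_ge0 R x.
  move: (mabs x) (Num.sqrt n%:R) x0 q0 hx xn => z q z0 q0 hz qn.
  have : z ^+ 2 <= (q + 7) ^+ 2 by rewrite ler_sqr ?nnegrE //; lra.
  have := sqr_ge0 (q - 7); lra.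
have e2 : 7 * lam k g * \sum_(x <- disk n) lam k x = \sum_(x <- disk M) \sum_(r <- F)
    (if (norme x <= n)%N then lam k (g * x) else 0).
  rewrite exchange_big /= big_const_seq count_predT sF iter_addr_0 -mulrA mulr_natl; congr (_ *+ _).
  rewrite mulr_sumr -big_mkcond -[RHS]big_filter; under [RHS]eq_bigr do rewrite lamM.
  apply/perm_big/uniq_perm => [||x]; [exact: disk_uniq | by rewrite filter_uniq // disk_uniq |].
  rewrite mem_disk mem_filter mem_disk; case: (primary x); rewrite ?andbF //=.
  by rewrite andb_idr // => h; rewrite /M; lia.
rewrite e1 e2 -sumrB; under eq_bigr do rewrite -sumrB.
apply: le_trans (normc_sum _ _ _) _.
apply: le_trans (_ : \sum_(x <- disk M) \sum_(r <- F)
   ((if (norme x <= n)%N then 14 * k%:R / mabs x else 0) +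
  (if (Num.sqrt n%:R - 7 <= mabs x) && (mabs x <= Num.sqrt n%:R + 7) then 1 else 0)) <= _).
  rewrite big_seq [leRHS]big_seq; apply: ler_sum => x; rewrite mem_disk => /andP[px _].
  apply: le_trans (normc_sum _ _ _) _.
  by rewrite big_seq [leRHS]big_seq; apply: ler_sum => r rF; exact: scaling_term.
rewrite exchange_big /= big_const_seq count_predT sF iter_addr_0 -[leLHS]mulr_natl -mulrA.
rewrite ler_pM2l // big_split /= [leRHS]mulrDl; 
apply: lerD.
  rewrite -big_mkcond -big_filter -mulr_sumr -mulrA; apply: ler_wpM2l; first by rewrite mulr_ge0.
  apply: le_trans (h1 n); rewrite le_eqVlt; apply/orP; left; apply/eqP.
  apply/perm_big/uniq_perm => [||x]; [by rewrite filter_uniq // disk_uniq | exact: disk_uniq |].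
  rewrite [RHS]mem_disk mem_filter mem_disk; case: (primary x); rewrite ?andbF //=.
  by rewrite andb_idr // => h; rewrite /M; lia.
rewrite -big_mkcond -big_filter big_const_seq count_predT iter_addr_0; exact: h2.
Qed.

End Scaling.

(* Scaling by two elements of norm 7 whose characters differ forces cancellation. *)
Lemma lam_sum_bound k : (0 < k)%N -> exists2 K : R, 0 <= K & forall n,
  normc (\sum_(x <- disk n) lam k x) <= K * Num.sqrt n%:R.
Proof.
move=> k0.
have F6 r : r \in [seq Eis (Posz i) 0 | i <- iota 0 7] -> mabs r <= 6.
  case/mapP => i; rewrite mem_iota /= => hi ->; rewrite mabs_le_nat.
  by rewrite -lez_nat normeE /normez /= ; nia.
have [K1 K10 h1] := @scaling_sum gam7 _ k isT residues_gam7 erefl erefl F6.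
have [||K2 K20 h2] := @scaling_sum (conje gam7) _ k isT (residues_conj residues_gam7) erefl.
- by rewrite size_map.
- by move=> r /mapP[s sF ->]; rewrite mabs_conj F6.
set d := normc (lam k gam7 - lam k (conje gam7)).
have d0 : 0 < d.
  rewrite lt_neqAle normc_ge0 andbT eq_sym; apply/eqP => /eq0_normc /eqP.
  by rewrite subr_eq0 (negPf (lam_gam7_neq k0)).
exists ((K1 + K2) / (7 * d)); first by rewrite divr_ge0 ?addr_ge0 // mulr_ge0 // ltW.
move=> n; have [->|n0] := posnP n.
  by rewrite big_nil normc0 mulr_ge0 ?sqrtr_ge0 // divr_ge0 ?addr_ge0 // mulr_ge0 // ltW.
rewrite mulrAC ler_pdivlMr ?mulr_gt0 //.
set S := \sum_(x <- disk n) _.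
have -> : normc S * (7 * d) = normc (7 * (lam k gam7 - lam k (conje gam7)) * S).
  rewrite !normcM; have -> : normc 7 = 7 :> R; last by rewrite -/d; ring.
  by have := normcMn (1 : C) 7; rewrite normc1.
have -> : 7 * (lam k gam7 - lam k (conje gam7)) * S =
  (\sum_(x <- disk (7 * n)) lam k x - 7 * lam k (conje gam7) * S) -
  (\sum_(x <- disk (7 * n)) lam k x - 7 * lam k gam7 * S) by ring.
apply: le_trans (le_normcB _ _) _; rewrite [(K1 + K2) * _]mulrDl [K1 * _ + _]addrC.
exact: lerD (h2 n n0) (h1 n n0).
Qed.

End CharacterSums.

(** * Hecke coefficients and nonvanishing *)

Section PrimePowers.
Variable S : comNzRingType.
Implicit Types L F : eis -> S.

(** The weight L(p) F(p^m) summed over primary prime powers of norm n. For L = ln N and F = lam_k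
    these are the coefficients of minus the logarithmic derivative of the Hecke L-series. Exponents
    up to n suffice, as norms of primes are at least 2. *)
Definition ppsum L F n : S :=
  \sum_(p <- disk_primes n) \sum_(1 <= m < n.+1)
    (if (norme p ^ m == n)%N then L p * F (p ^+ m) else 0).

Lemma disk_primes_norm_gt1 M p : p \in disk_primes M -> (1 < norme p)%N.
Proof. by rewrite mem_disk_primes => /and3P[/asboolP[]]. Qed.
Lemma disk_primes_primary M p : p \in disk_primes M -> primary p.
Proof. by rewrite mem_disk_primes => /and3P[]. Qed.

Lemma ppsum_widen L F n M : (0 < n <= M)%N -> ppsum L F n =
  \sum_(p <- disk_primes M) \sum_(1 <= m < M.+1)
    (if (norme p ^ m == n)%N then L p * F (p ^+ m) else 0).
Proof.
move=> /andP[n0 nM]; symmetry.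
transitivity (\sum_(p <- disk_primes M) \sum_(1 <= m < n.+1)
    (if (norme p ^ m == n)%N then L p * F (p ^+ m) else 0)).
  rewrite big_seq [RHS]big_seq; apply: eq_bigr => p /disk_primes_norm_gt1 p1.
  rewrite (big_cat_nat (n := n.+1)) //= [X in _ + X]big_nat_cond [X in _ + X]big1 ?addr0 //.
  move=> m /andP[/andP[h _] _]; case: eqP => // e.
  by have := ltn_expl m p1; rewrite e; lia.
rewrite (bigID (fun p => (norme p <= n)%N)) /= [X in _ + X]big1 ?addr0; last first.
  move=> p hp; rewrite big_nat_cond big1 // => m /andP[/andP[m0 _] _].
  case: eqP => // e; case: m m0 e => // m _ e.
  have [z|p0] := posnP (norme p); first by rewrite z in hp.
  by move: hp; rewrite -e expnS leq_pmulr // expn_gt0 p0.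
rewrite /ppsum -big_filter; apply/perm_big/uniq_perm => [||p].
- by rewrite filter_uniq // disk_primes_uniq.
- exact: disk_primes_uniq.
rewrite mem_filter mem_disk_primes [RHS]mem_disk_primes; case: (_ <= n)%N / idP => h /=; last by rewrite !andbF.
by rewrite (leq_trans h nM).
Qed.

Lemma sum_shell_dvd F d n : (forall x y, F (x * y) = F x * F y) -> primary d -> (0 < n)%N ->
  \sum_(x <- shell n) (if `[< dvde d x >] then F x else 0) =
  F d * \sum_(1 <= j < n.+1 | (norme d * j == n)%N) \sum_(y <- shell j) F y.
Proof.
move=> FM pd n0; have d0 := primary_neq0 pd.
transitivity (\sum_(y <- disk n) (if (norme d * norme y == n)%N then F (d * y) else 0)).
  rewrite -!big_mkcond -[LHS]big_filter -[RHS]big_filter -(big_map (fun y => d * y) predT F).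
  apply/perm_big/uniq_perm => [||x].
  - by rewrite filter_uniq // shell_uniq.
  - by rewrite map_inj_uniq; [rewrite filter_uniq // disk_uniq | exact: (eis_mulfI d0)].
  rewrite mem_filter mem_shell; apply/idP/mapP => [/and3P[/asboolP[y e] px /eqP nx]|[y]].
    exists y; last by rewrite e mulrC.
    have py : primary y by apply: (primary_divr pd); rewrite mulrC -e.
    have e2 : (norme d * norme y)%N = n by rewrite -nx e normeM mulnC.
    rewrite mem_filter mem_disk e2 eqxx py /=.
    by rewrite -e2 leq_pmull // norme_gt0.
  rewrite mem_filter mem_disk => /and3P[/eqP e2 py _] ->.
  apply/and3P; split; [apply/asboolP | exact: primaryM | by rewrite normeM e2].
  by exists y; rewrite mulrC.
rewrite disk_sum mulr_sumr [RHS]big_mkcond; apply: eq_bigr => j _.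
rewrite big_seq (eq_bigr (fun y => if (norme d * j == n)%N then F d * F y else 0)).
  by rewrite -big_seq; case: ifP => _; rewrite ?mulr_sumr // big1.
by move=> y; rewrite mem_shell => /andP[_ /eqP ->]; rewrite FM.
Qed.

(* The logarithmic derivative of the Euler product, read on coefficients. *)
Lemma conv_ppsum L F n (l : S) : (forall x y, F (x * y) = F x * F y) -> (0 < n)%N ->
  (forall x, x \in shell n -> l = \sum_(p <- disk_primes n) \sum_(1 <= m < n.+1)
     (if `[< dvde (p ^+ m) x >] then L p else 0)) ->
  conv (ppsum L F) (fun j => \sum_(x <- shell j) F x) n = (\sum_(x <- shell n) F x) * l.
Proof.
move=> FM n0 hl.
transitivity (\sum_(p <- disk_primes n) \sum_(1 <= m < n.+1) L p *
   \sum_(x <- shell n) (if `[< dvde (p ^+ m) x >] then F x else 0)); last first.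
  rewrite mulr_suml [RHS]big_seq.
  transitivity (\sum_(x <- shell n) \sum_(p <- disk_primes n) \sum_(1 <= m < n.+1)
     (if `[< dvde (p ^+ m) x >] then L p * F x else 0)).
    rewrite [RHS]exchange_big; apply: eq_bigr => p _ /=.
    rewrite [RHS]exchange_big; apply: eq_bigr => m _ /=.
    by rewrite mulr_sumr; apply: eq_bigr => x _; case: ifP; rewrite ?mulr0.
  rewrite big_seq; apply: eq_bigr => x /hl ->; rewrite mulr_sumr; apply: eq_bigr => p _.
  by rewrite mulr_sumr; apply: eq_bigr => m _; case: ifP; rewrite ?mulr0 // mulrC.
transitivity (\sum_(1 <= i < n.+1) \sum_(p <- disk_primes n) \sum_(1 <= m < n.+1)
   (if (norme p ^ m == i)%N then L p * F (p ^+ m) * \sum_(1 <= j < n.+1 | (i * j == n)%N) \sum_(x <- shell j) F x else 0)).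
  apply: eq_big_nat => i hi; rewrite -mulr_sumr (@ppsum_widen _ _ _ n) // mulr_suml.
  apply: eq_bigr => p _; rewrite mulr_suml; apply: eq_bigr => m _.
  by case: ifP; rewrite ?mul0r.
rewrite exchange_big [LHS]big_seq [RHS]big_seq; apply: eq_bigr => p pn /=.
rewrite exchange_big; apply: eq_bigr => m _ /=.
have pp : primary (p ^+ m) by rewrite primaryX // (disk_primes_primary pn).
rewrite sum_shell_dvd // -big_mkcond sum_nat_eq normeX; case: ifP => [_|h]; first by rewrite mulrA.
rewrite big_nat_cond big1 ?mulr0 // => j /andP[/andP[j0 _] /eqP e].
have q0 : (0 < norme p ^ m)%N by rewrite expn_gt0 norme_gt0 primary_neq0 // (disk_primes_primary pn).
by have := leq_pmulr (norme p ^ m) j0; rewrite e; move: h; rewrite q0 /= ltnS => ->.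
Qed.

End PrimePowers.

Section Hecke.
Variable R : realType.
Local Notation C := R[i].
Local Notation Re := (@complex.Re R).
Local Notation Im := (@complex.Im R).
Local Notation lam := (@lam R).
Local Notation "x %:C" := (real_complex R x) : ring_scope.

Definition lnN (p : eis) : R := ln (norme p)%:R.
Definition pp_rsum (G : eis -> R) n : R := ppsum lnN G n.
(** Real parts make the sequences fit the real-valued convolution method. They are the full complex
    sums, by [sum_shell_lam] and [ppsum_lam], so the convolution identities persist. *)
Definition ak k n : R := \sum_(x <- shell n) Re (lam k x).
Definition bk k n : R := pp_rsum (fun x => Re (lam k x)) n.

Lemma lnN_ge0 p : 0 <= lnN p. Proof. exact: ln_nat_ge0. Qed.

Lemma le_pps G H n : (forall x, primary x -> G x <= H x) -> pp_rsum G n <= pp_rsum H n.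
Proof.
move=> GH; rewrite /pp_rsum /ppsum big_seq [leRHS]big_seq; apply: ler_sum => p hp.
apply: ler_sum => m _; case: ifP => // _; rewrite ler_wpM2l ?lnN_ge0 // GH //.
by rewrite primaryX // (disk_primes_primary hp).
Qed.

Lemma ppsD G H n : pp_rsum (fun x => G x + H x) n = pp_rsum G n + pp_rsum H n.
Proof.
rewrite /pp_rsum /ppsum -big_split; apply: eq_bigr => p _; rewrite -big_split.
by apply: eq_bigr => m _ /=; case: ifP; rewrite ?addr0 // mulrDr.
Qed.

Lemma ppsZ c G n : pp_rsum (fun x => c * G x) n = c * pp_rsum G n.
Proof.
rewrite /pp_rsum /ppsum mulr_sumr; apply: eq_bigr => p _; rewrite mulr_sumr.
by apply: eq_bigr => m _ /=; case: ifP; rewrite ?mulr0 // mulrCA.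
Qed.

Lemma eq_pps G H n : (forall x, primary x -> G x = H x) -> pp_rsum G n = pp_rsum H n.
Proof. by move=> e; apply/le_anti/andP; split; apply: le_pps => x x0; rewrite e. Qed.

Lemma pps0 n : pp_rsum (fun=> 0) n = 0.
Proof.
rewrite -[RHS](mul0r (pp_rsum (fun=> 0) n)) -ppsZ; apply: eq_pps => x _; rewrite mul0r //.
Qed.

Lemma pps_ge0 G n : (forall x, primary x -> 0 <= G x) -> 0 <= pp_rsum G n.
Proof. by move=> h; rewrite -(pps0 n); exact: le_pps. Qed.

Lemma Im_conj_eq0 (z : C) : conjc z = z -> Im z = 0.
Proof. by case: z => a b [] /=; lra. Qed.

Lemma complex_Re (z : C) : Im z = 0 -> z = (Re z)%:C.
Proof. by case: z => a b /= ->. Qed.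

(** Conjugation permutes the primary elements of given norm and conjugates lam_k. *)
Lemma sum_shell_lam k n : \sum_(x <- shell n) lam k x = (ak k n)%:C.
Proof.
rewrite /ak -(@Re_sum R); apply: complex_Re; apply: Im_conj_eq0.
rewrite rmorph_sum /=; under eq_bigr do rewrite -lam_conj.
rewrite -(big_map conje predT (lam k)); apply/perm_big/uniq_perm => [||x].
- by rewrite map_inj_uniq ?shell_uniq //; exact: conje_inj.
- exact: shell_uniq.
apply/mapP/idP => [[y + ->]|]; rewrite !mem_shell.
  by move=> /andP[h]; rewrite norme_conj primary_conj.
move=> /andP[h1 h2]; exists (conje x); rewrite ?conjeK //.
by rewrite mem_shell primary_conj // norme_conj.
Qed.

Lemma ppsum_lam_real k n : Im (ppsum (fun p => (lnN p)%:C) (lam k) n) = 0.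
Proof.
apply: Im_conj_eq0; rewrite /ppsum rmorph_sum.
rewrite (eq_bigr (fun p => \sum_(1 <= m < n.+1) (if (norme (conje p) ^ m == n)%N
    then (lnN (conje p))%:C * lam k (conje p ^+ m) else 0))); last first.
  move=> p _; rewrite rmorph_sum; apply: eq_bigr => m _.
  rewrite /lnN norme_conj; case: ifP => _; rewrite ?rmorph0 // rmorphM /= oppr0; congr (_ * _).
  have -> : conje p ^+ m = conje (p ^+ m).
    by elim: m => [//|m IH]; rewrite !exprS IH conjeM.
  by rewrite lam_conj.
rewrite -(big_map conje predT (fun p => \sum_(1 <= m < n.+1) (if (norme p ^ m == n)%N
    then (lnN p)%:C * lam k (p ^+ m) else 0))).
have pc x : prime_eis x -> prime_eis (conje x).
  move=> [x1 hx]; split; first by rewrite norme_conj.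
  have cj u v : dvde (conje u) v -> dvde u (conje v).
    by move=> [w ->]; exists (conje w); rewrite conjeM conjeK.
  have cj' u v : dvde u (conje v) -> dvde (conje u) v.
    by move=> [w e]; exists (conje w); rewrite -conjeM -e conjeK.
  by move=> y z /cj; rewrite conjeM => /hx[] /cj'; [left | right].
apply/perm_big/uniq_perm => [||x].
- by rewrite map_inj_uniq ?disk_primes_uniq //; exact: conje_inj.
- exact: disk_primes_uniq.
apply/mapP/idP => [[y + ->]|]; rewrite !mem_disk_primes.
  by move=> /and3P[/asboolP h1 h2 h3]; rewrite norme_conj primary_conj // h3 andbT; apply/andP; split => //; apply/asboolP/pc.
move=> /and3P[/asboolP h1 h2 h3]; exists (conje x); rewrite ?conjeK //.
by rewrite mem_disk_primes primary_conj // norme_conj h3 andbT; apply/andP; split => //; apply/asboolP/pc.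
Qed.

Lemma ppsum_lam k n : ppsum (fun p => (lnN p)%:C) (lam k) n = (bk k n)%:C.
Proof.
rewrite [LHS]complex_Re ?ppsum_lam_real //; congr (_%:C).
rewrite /bk /pp_rsum /ppsum Re_sum; apply: eq_bigr => p _; rewrite Re_sum.
by apply: eq_bigr => m _; case: ifP => // _; rewrite ReM_real.
Qed.

Lemma ak1 k : ak k 1 = 1.
Proof.
have e : perm_eq (shell 1) [:: 1] by [].
by rewrite /ak (perm_big _ e) /= big_seq1 lam1.
Qed.

Lemma conv_bk k n : (0 < n)%N -> conv (bk k) (ak k) n = mulln (ak k) n.
Proof.
move=> n0; have inj : injective (fun x => x%:C) by exact: complexI.
apply: inj; rewrite /mulln rmorphM /= -sum_shell_lam.
rewrite -(conv_ppsum (L := fun p => (lnN p)%:C) (@lamM R k) n0); last first.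
  move=> x; rewrite mem_shell => /andP[px /eqP nx].
  have h : (norme x <= n)%N by rewrite nx.
  have := ln_norme_factor R px h; rewrite nx => ->; rewrite rmorph_sum; apply: eq_bigr => p _.
  by rewrite rmorph_sum; apply: eq_bigr => m _; case: ifP => // _; rewrite rmorph0.
rewrite /conv rmorph_sum; apply: eq_bigr => i _; rewrite rmorph_sum; apply: eq_bigr => j _.
by rewrite rmorphM /= -ppsum_lam -sum_shell_lam.
Qed.

Lemma ak0E n : ak 0 n = (size (shell n))%:R.
Proof.
rewrite /ak; under eq_bigr do rewrite /lam expr0 /=.
by rewrite big_const_seq count_predT iter_addr_0.
Qed.

Lemma bk_le k n : `|bk k n| <= bk 0 n.
Proof.
have B x : x != 0 -> `|Re (lam k x)| <= 1.
  by move=> x0; apply: le_trans (Re_le_normc _) _; rewrite normc_lam.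
rewrite ler_norml; apply/andP; split; last first.
  by apply: le_pps => x /primary_neq0 /B; rewrite ler_norml => /andP[].
rewrite lerNl -mulN1r -ppsZ; apply: le_pps => x /primary_neq0 /B.
have -> : lam 0 x = 1 by [].
by rewrite ler_norml /= => /andP[]; lra.
Qed.

Lemma sum_ak k n : \sum_(1 <= i < n.+1) ak k i = Re (\sum_(x <- disk n) lam k x).
Proof. by rewrite disk_sum Re_sum; apply: eq_bigr => i _; rewrite Re_sum. Qed.

Lemma sum_ak0 n : \sum_(1 <= i < n.+1) ak 0 i = (disk_count n)%:R.
Proof.
under eq_bigr do rewrite ak0E.
rewrite -natr_sum; congr _%:R; rewrite /disk_count -sum1_size disk_sum.
by apply: eq_bigr => i _; rewrite sum1_size.
Qed.

Definition bsum k N : R := \sum_(1 <= n < N.+1) bk k n / n%:R.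

Lemma bsum_trichotomy k : exists eps : R,
  [/\ k = 0%N -> eps = 1, (0 < k)%N -> eps = 0 \/ eps = -1 &
   exists B, forall N, (0 < N)%N -> `|bsum k N - eps * ln N%:R| <= B].
Proof.
have [Kw Kw0 hKw] := disk_count_le R.
have hw n : \sum_(1 <= i < n.+1) ak 0 i <= Kw * n%:R by rewrite sum_ak0.
have w0 n : 0 <= ak 0 n by rewrite ak0E.
have mw n : (0 < n)%N -> `|dinv (ak k) n| <= ak 0 n.
  exact: (dinv_le (ak1 k) (@conv_bk k) (ak1 0) w0 (@conv_bk 0) (bk_le k)).
have [k0|k0] := posnP k.
  rewrite k0 in mw *; have [c [K [c0 K0 H]]] := disk_count_asymp R.
  have ha n : `|\sum_(1 <= i < n.+1) ak 0 i - c * n%:R| <= K * rt4 n%:R ^+ 2.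
    by rewrite sum_ak0 rt4X2.
  have [eps [e1 _ h]] := shapiro_trichotomy (ak1 0) (@conv_bk 0) K0 Kw0 w0 hw mw ha.
  by exists eps; split=> // _; apply: e1; rewrite gt_eqF.
have [K K0 H] := lam_sum_bound R k0.
have ha n : `|\sum_(1 <= i < n.+1) ak k i - 0 * n%:R| <= K * rt4 n%:R ^+ 2.
  by rewrite mul0r subr0 sum_ak rt4X2 //; apply: le_trans (Re_le_normc _) (H n).
have [eps [_ e2 h]] := shapiro_trichotomy (ak1 k) (@conv_bk k) K0 Kw0 w0 hw mw ha.
exists eps; split=> //; last by move=> _; exact: e2.
by move=> e; rewrite e in k0.
Qed.

Lemma ln_unbounded (B : R) : exists2 N, (0 < N)%N & B < ln N%:R.
Proof.
exists (Num.truncn (expR B)).+1 => //.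
by rewrite -ltr_expR lnK ?posrE ?ltr0n // truncnS_gt.
Qed.

Lemma sum_pps_ge0 G N : (forall x, primary x -> 0 <= G x) ->
  0 <= \sum_(1 <= n < N.+1) pp_rsum G n / n%:R.
Proof. by move=> G0; apply: sumr_ge0 => n _; rewrite divr_ge0 // pps_ge0. Qed.

Theorem bsum0 : exists B, forall N, (0 < N)%N -> `|bsum 0 N - ln N%:R| <= B.
Proof.
have [eps [/(_ erefl) -> _ [B hB]]] := bsum_trichotomy 0.
by exists B => N /hB; rewrite mul1r.
Qed.

(* Nonvanishing at 1 from [3 + 4 cos t + cos 2t >= 0]. *)
Theorem bsum_bounded k : (0 < k)%N -> exists B, forall N, (0 < N)%N -> `|bsum k N| <= B.
Proof.
move=> k0; have [eps [_ /(_ k0) he [B hB]]] := bsum_trichotomy k.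
case: he => he; rewrite he in hB; first by exists B => N /hB; rewrite mul0r subr0.
have [B0 hB0] := bsum0.
have [e2 [_ he2 [B2 hB2]]] := bsum_trichotomy (2 * k).
have {}he2 : e2 <= 0 by case: he2; [rewrite muln_gt0 | move=> -> | move=> ->; lra].
(* Both possible values for 2 k are nonpositive, so the nonnegative combination would be at most (3
   - 4) ln N + O(1). *)
have [N N0 hN] := ln_unbounded (3 * B0 + 4 * B + B2).
have := hB0 N N0; have := hB N N0; have := hB2 N N0; rewrite !ler_norml.
move=> /andP[_ h2] /andP[_ h1] /andP[_ h0].
have L0 := ln_nat_ge0 R N.
have e2L : e2 * ln N%:R <= 0 by rewrite mulr_le0_ge0.
have : 0 <= \sum_(1 <= n < N.+1) pp_rsum (fun x => 3 * Re (lam 0 x) + 4 * Re (lam k x) + Re (lam (2 * k) x)) n / n%:R.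
  apply: sum_pps_ge0 => x /primary_neq0 x0; have -> : lam 0 x = 1 by [].
  rewrite mulnC /lam exprM /=.
  have := sqr_normc (lam k x); rewrite normc_lam // /lam => e.
  have -> : Re ((unit_part R x ^+ k) ^+ 2) = Re (unit_part R x ^+ k) ^+ 2 - Im (unit_part R x ^+ k) ^+ 2.
    by case: (_ ^+ k) => u v /=.
  move: e; move: (Re _) (Im _) => u v e.
  (* As u^2 + v^2 = 1, the combination 3 + 4 u + u^2 - v^2 equals 2 (1 + u)^2. *)
  have : 0 <= (1 + u) ^+ 2 by exact: sqr_ge0.
  lra.
have -> : \sum_(1 <= n < N.+1) pp_rsum (fun x => 3 * Re (lam 0 x) + 4 * Re (lam k x) + Re (lam (2 * k) x)) n / n%:R =
  3 * bsum 0 N + 4 * bsum k N + bsum (2 * k) N.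
  rewrite /bsum !mulr_sumr -!big_split; apply: eq_bigr => n _ /=.
  by rewrite !ppsD !ppsZ -/(bk 0 n) -/(bk k n) -/(bk (2 * k) n); ring.
lra.
Qed.

End Hecke.

(** * Primes in sectors *)

Lemma prime_dvde_nat p n : prime_eis p -> (0 < n)%N -> dvde p n%:R ->
  exists2 q, prime q & dvde p q%:R.
Proof.
move=> hp; have [M] := ubnP n; elim: M n => // M IH n nM n0 pn.
have [n1|n1] := leqP n 1.
  have e : n = 1%N by lia.
  by move: pn; rewrite e => /dvde_norm; rewrite dvdn1; case: hp => + _ /eqP e1; rewrite e1.
have hq := pdiv_prime n1; have /dvdnP[k ek] := pdiv_dvd n.
have q1 := prime_gt1 hq.
case: (hp) => _ hpp; have : dvde p (k%:R * (pdiv n)%:R) by rewrite -natrM -ek.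
case/hpp => h; last by exists (pdiv n).
have k0 : (0 < k)%N by move: n0; rewrite {1}ek muln_gt0 => /andP[].
apply: (IH k) => //; move: nM; rewrite {1}ek; nia.
Qed.

Lemma norme_nat n : norme n%:R = (n ^ 2)%N.
Proof.
by rewrite pmulrn eis_intr; apply/eqP; rewrite -eqz_nat normeE /normez /=; lia.
Qed.

(* The inert primes: those whose norm is the square of a rational prime. *)
Lemma prime_norm_or_real p : prime_eis p -> primary p -> prime (norme p) \/ eim p = 0.
Proof.
move=> hp pp; have n0 : (0 < norme p)%N by rewrite norme_gt0 primary_neq0.
have [|q hq pq] := prime_dvde_nat hp n0.
  exists (conje p); rewrite mulrC mul_conje -normeE pmulrn //.
have := dvde_norm pq; rewrite norme_nat => /(dvdn_pfactor _ 2 hq)[m].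
case: m => [_ e|[_ ->|[_ e|//]]]; first by case: hp => + _; rewrite e.
  by left; rewrite expn1.
right; case: pq => u eu.
have u1 : norme u = 1%N.
  have := norme_nat q; rewrite eu normeM e => /eqP; rewrite -{2}[(q ^ 2)%N]mul1n eqn_pmul2r.
    by move/eqP.
  by rewrite expn_gt0 prime_gt0.
have ep : p = conje u * q%:R by rewrite eu mulrA [conje u * u]mulrC eis_unit_mul // mul1r.
have q3 : ~~ (3 %| q)%N.
  apply/negP => /dvdnP[k ek]; have := norme_primary_mod3 pp.
  by rewrite e ek expnMn -modnMmr muln0.
have : (eim p %% 3 == 0)%Z by case/andP: pp.
have v1 := norme_conj u; rewrite u1 in v1.
move: ep v1; case: (conje u) => a b -> /(congr1 Posz); rewrite normeE pmulrn eis_intr.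
rewrite /normez /= mulr0 add0r => h1 h2.
(* The imaginary coordinate of p is b q. It is a multiple of 3 while q is not, so 3 divides b, and
   the unit has |b| <= 1. *)
have hb : -1 <= b <= 1 by apply/andP; split; have := sqr_ge0 (2 * a - b); nia.
move: h2 q3; have [->|->|->] : [\/ b = 0, b = 1 | b = -1] by case/andP: hb => *; case: (ltrgt0P b) => *; [constructor 2 | constructor 3 | constructor 1]; lia.
- by lia.
- by lia.
- by lia.
Qed.

Section Sector.
Variable R : realType.
Local Notation C := R[i].
Local Notation Re := (@complex.Re R).
Local Notation Im := (@complex.Im R).
Local Notation lam := (@lam R).
Local Notation lnN := (@lnN R).
Local Notation "x %:C" := (real_complex R x) : ring_scope.

Lemma sum_inv_3half n : (0 < n)%N ->
  \sum_(1 <= i < n.+1) (i%:R * Num.sqrt i%:R)^-1 <= 3 - 2 / Num.sqrt n%:R :> R.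
Proof.
elim: n => // n IH _; have [->|n0] := posnP n.
  by rewrite big_nat1 sqrtr1 mulr1 invr1; lra.
rewrite big_nat_recr //=; apply: le_trans (lerD (IH n0) (lexx _)) _.
have e0 : Num.sqrt n%:R ^+ 2 = n%:R :> R by rewrite sqr_sqrtr.
have e1 : Num.sqrt n.+1%:R ^+ 2 = n.+1%:R :> R by rewrite sqr_sqrtr.
have s0 : 0 < Num.sqrt n%:R :> R by rewrite sqrtr_gt0 ltr0n.
have t0 : 0 < Num.sqrt n.+1%:R :> R by rewrite sqrtr_gt0 ltr0n.
have st : Num.sqrt n%:R <= Num.sqrt n.+1%:R :> R by rewrite ler_wsqrtr // ler_nat.
have e2 : Num.sqrt n.+1%:R ^+ 2 - Num.sqrt n%:R ^+ 2 = 1 :> R by rewrite e0 e1 -natr1; ring.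
move: (Num.sqrt n%:R) (Num.sqrt n.+1%:R) e0 e1 s0 t0 st e2 => s t e0 <- s0 t0 st e2.
suff : (t ^+ 2 * t)^-1 <= 2 * (s^-1 - t^-1) by lra.
have -> : s^-1 - t^-1 = (t - s) / (s * t) by field; rewrite !gt_eqF.
rewrite -div1r ler_pdivrMr ?mulr_gt0 ?exprn_gt0 // -[leLHS]e2.
have -> : 2 * ((t - s) / (s * t)) * (t ^+ 2 * t) = (t - s) * (2 * t ^+ 2 / s) by field; rewrite !gt_eqF.
have -> : t ^+ 2 - s ^+ 2 = (t - s) * (t + s) by ring.
rewrite ler_wpM2l ?subr_ge0 // ler_pdivlMr //.
have : s * s <= t * t by rewrite ler_pM // ltW.
have : t * s <= t * t by rewrite ler_wpM2l // ltW.
lra.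
Qed.

Lemma ln_div_sqr_le i : (0 < i)%N -> ln i%:R / i%:R ^+ 2 <= 4 * (i%:R * Num.sqrt i%:R)^-1 :> R.
Proof.
move=> i0; have I1 : 1 <= i%:R :> R by rewrite ler1n.
have := ln_le_rt4 I1; have t1 := rt4_ge1 I1; have := @rt4X R i%:R (ler0n _ _).
rewrite -rt4X2 //; move: (ln _) (rt4 _) t1 => l t t1 <- lt.
have t0 : 0 < t by lra.
rewrite ler_pdivrMr ?exprn_gt0 // ; apply: le_trans lt _.
have -> : 4 * (t ^+ 4 * t ^+ 2)^-1 * (t ^+ 4) ^+ 2 = 4 * t ^+ 2 by field; rewrite gt_eqF.
by rewrite ler_pM2l // expr2 ler_peMr // ltW.
Qed.

Lemma sum_lnN_sqr : exists B : R, forall X,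
  \sum_(x <- disk X) lnN x / (norme x)%:R ^+ 2 <= B.
Proof.
have [K K0 hK] := disk_count_le R; exists (4 * (K * 3)) => X.
rewrite disk_sum; have [->|X0] := posnP X; first by rewrite big_geq // !mulr_ge0.
apply: le_trans (_ : 4 * \sum_(1 <= i < X.+1) (size (shell i))%:R * (i%:R * Num.sqrt i%:R)^-1 <= _).
  rewrite mulr_sumr; apply: ler_sum_nat => i /andP[i0 _].
  rewrite big_seq (eq_bigr (fun=> ln i%:R / i%:R ^+ 2)).
    rewrite -big_seq big_const_seq count_predT iter_addr_0 -[leLHS]mulr_natl [leRHS]mulrCA ler_wpM2l //.
    exact: ln_div_sqr_le.
  by move=> x; rewrite mem_shell /lnN => /andP[_ /eqP <-].
rewrite ler_pM2l //.
apply: le_trans (sum_monotone_le _ _ (_ : forall k, \sum_(1 <= i < k.+1) (size (shell i))%:R <= K * k%:R) _ _) _ => //.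
- move=> k; apply: le_trans (hK k); rewrite /disk_count -sum1_size disk_sum natr_sum.
  by under [leRHS]eq_bigr do rewrite sum1_size.
- move=> k k0; rewrite lef_pV2 ?posrE ?mulr_gt0 ?sqrtr_gt0 ?ltr0n //.
  by rewrite ler_pM ?sqrtr_ge0 ?ler0n // ?ler_wsqrtr // ler_nat.
- by move=> k _; rewrite invr_ge0 mulr_ge0 // sqrtr_ge0.
rewrite ler_wpM2l //; apply: le_trans (sum_inv_3half X0) _.
by rewrite gerBl divr_ge0 // sqrtr_ge0.
Qed.

(** A real primary x = q or - q has norm q^2, and ln(q^2) / q^2 <= 4 q^(-3/2); the bound is 4 times
    3. The congruence mod 3 fixes the sign, so each q occurs at most once. *)
Lemma sum_lnN_real X :
  \sum_(x <- disk X) (if eim x == 0 then lnN x / (norme x)%:R else 0) <= 12 :> R.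
Proof.
have [->|X0] := posnP X; first by rewrite big_nil.
rewrite -big_mkcond -big_filter; set L := [seq _ <- _ | _].
pose f (q : nat) : R := 4 * (q%:R * Num.sqrt q%:R)^-1.
have f0 q : 0 <= f q by rewrite mulr_ge0 // invr_ge0 mulr_ge0 // sqrtr_ge0.
apply: le_trans (_ : \sum_(q <- [seq `|ere x|%N | x <- L]) f q <= _).
  rewrite big_map big_seq [leRHS]big_seq; apply: ler_sum => x.
  rewrite mem_filter mem_disk => /and3P[/eqP x0 px _].
  have nx : norme x = (`|ere x| ^ 2)%N.
    by apply/eqP; rewrite -eqz_nat normeE /normez x0; lia.
  have q0 : (0 < `|ere x|)%N.
    by have := primary_neq0 px; rewrite -norme_gt0 nx expn_gt0 orbF.
  have Q1 : 1 <= `|ere x|%N%:R :> R by rewrite ler1n.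
  rewrite /lnN nx natrX /f; move: (`|ere x|%N%:R : R) Q1 => q q1.
  have := @ln_le_rt4 R (q ^+ 2) ltac:(by rewrite exprn_ege1).
  have -> : rt4 (q ^+ 2) = Num.sqrt q by rewrite /rt4 sqrtr_sqr ger0_norm //; lra.
  have s0 : 0 < Num.sqrt q by rewrite sqrtr_gt0; lra.
  have := @sqr_sqrtr _ q ltac:(lra); move: (ln _) (Num.sqrt q) s0 => l s s0 <- h.
  rewrite ler_pdivrMr ?exprn_gt0 //; apply: le_trans h _.
  rewrite le_eqVlt; apply/orP; left; apply/eqP; field; rewrite gt_eqF //.
have uL : uniq [seq `|ere x|%N | x <- L].
  rewrite map_inj_in_uniq; first by rewrite filter_uniq // disk_uniq.
  move=> [a b] [c d]; rewrite mem_filter mem_disk mem_filter mem_disk => /and3P[/eqP /= -> pa _] /and3P[/eqP /= -> pc _] e.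
  move: pa pc; rewrite /primary /= => /andP[pa _] /andP[pc _]; congr Eis; lia.
have sub : {subset [seq `|ere x|%N | x <- L] <= index_iota 1 X.+1}.
  move=> q /mapP[x]; rewrite mem_filter mem_disk => /and3P[/eqP x0 px hx] ->.
  have nx : norme x = (`|ere x| ^ 2)%N.
    by apply/eqP; rewrite -eqz_nat normeE /normez x0; lia.
  have := primary_neq0 px; rewrite -norme_gt0 mem_index_iota; move: hx; rewrite nx.
  by move: (absz _) => q' h1 h2; nia.
apply: le_trans (_ : \sum_(1 <= q < X.+1) f q <= _).
  have -> : \sum_(q <- [seq `|ere x|%N | x <- L]) f q =
    \sum_(1 <= q < X.+1 | q \in [seq `|ere x|%N | x <- L]) f q.
    rewrite -[RHS]big_filter; apply/perm_big/uniq_perm => //.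
      by rewrite filter_uniq // iota_uniq.
    by move=> q; rewrite mem_filter andb_idr // => /sub.
  by rewrite [leRHS](bigID (fun q => q \in [seq `|ere x|%N | x <- L])) /= lerDl sumr_ge0.
rewrite -mulr_sumr; have := sum_inv_3half X0.
have : 0 <= 2 / Num.sqrt X%:R :> R by rewrite divr_ge0 // sqrtr_ge0.
lra.
Qed.

Lemma geometric_tail (y : R) M : 0 <= y -> y <= 1 / 2 -> \sum_(2 <= m < M.+1) y ^+ m <= 2 * y ^+ 2.
Proof.
move=> y0 y2; case: M => [|M]; first by rewrite big_geq // mulr_ge0 // sqr_ge0.
have [] : (M = 0 \/ 0 < M)%N by lia.
  by move=> ->; rewrite big_geq // mulr_ge0 // sqr_ge0.
move=> M0.
suff : \sum_(2 <= m < M.+2) y ^+ m <= 2 * y ^+ 2 - y ^+ M.+1.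
  by have : 0 <= y ^+ M.+1 by [rewrite exprn_ge0]; lra.
elim: M M0 => // M IH _; have [->|M0] := posnP M.
  by rewrite big_nat1; lra.
rewrite big_nat_recr //=; have := IH M0.
have : y * y ^+ M.+1 <= 1 / 2 * y ^+ M.+1 by rewrite ler_wpM2r // exprn_ge0.
rewrite -exprS; lra.
Qed.

(** The indicator of everything but the primes being sought. Applied to prime powers it equals 1 on
    all higher powers, which are not prime. *)
Definition exceptional (N : nat) (x : eis) : R :=
  if `[< prime_eis x >] && prime (norme x) && (N < norme x)%N then 0 else 1.

(** Three sources: first powers of primes of norm at most N, inert primes, which are real by
    [prime_norm_or_real], and exponents m >= 2, bounded by a geometric series of ratio at most 1 /
    2. Their bounds are the three terms of the constant. *)
Lemma sum_exceptional N : exists B : R, forall X,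
  \sum_(1 <= n < X.+1) pp_rsum (exceptional N) n / n%:R <= B.
Proof.
have [B hB] := sum_lnN_sqr.
exists (\sum_(x <- disk N) lnN x + 12 + 2 * B) => X.
have w0 (p : eis) m : 0 <= lnN p * exceptional N (p ^+ m) / (norme p)%:R ^+ m.
  rewrite divr_ge0 ?exprn_ge0 // mulr_ge0 ?lnN_ge0 // /exceptional; by case: ifP.
apply: le_trans (_ : \sum_(p <- disk_primes X) \sum_(1 <= m < X.+1)
    lnN p * exceptional N (p ^+ m) / (norme p)%:R ^+ m <= _).
  have -> : \sum_(1 <= n < X.+1) pp_rsum (exceptional N) n / n%:R = \sum_(p <- disk_primes X) \sum_(1 <= m < X.+1)
     \sum_(1 <= n < X.+1 | (norme p ^ m == n)%N) lnN p * exceptional N (p ^+ m) / n%:R.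
    transitivity (\sum_(1 <= n < X.+1) \sum_(p <- disk_primes X) \sum_(1 <= m < X.+1)
       (if (norme p ^ m == n)%N then lnN p * exceptional N (p ^+ m) / n%:R else 0)).
      apply: eq_big_nat => n hn; rewrite /pp_rsum (@ppsum_widen _ _ _ n X) // mulr_suml.
      apply: eq_bigr => p _; rewrite mulr_suml; apply: eq_bigr => m _.
      by case: ifP; rewrite ?mul0r.
    rewrite exchange_big; apply: eq_bigr => p _ /=; rewrite exchange_big; apply: eq_bigr => m _ /=.
    by rewrite -big_mkcond.
  apply: ler_sum => p _; apply: ler_sum => m _.
  by rewrite sum_nat_eq; case: ifP => _; rewrite ?natrX.
apply: le_trans (_ : \sum_(p <- disk_primes X) ((if (norme p <= N)%N then lnN p else 0) +
   (if eim p == 0 then lnN p / (norme p)%:R else 0) + 2 * (lnN p / (norme p)%:R ^+ 2)) <= _).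
  rewrite big_seq [leRHS]big_seq; apply: ler_sum => p hp.
  have [X0|X0] := posnP X.
    move: hp; rewrite mem_disk_primes => /and3P[_ /primary_neq0]; rewrite -norme_gt0; lia.
  have p1 := disk_primes_norm_gt1 hp; move: hp; rewrite mem_disk_primes => /and3P[/asboolP hp pp _].
  have P2 : 2 <= (norme p)%:R :> R by rewrite ler_nat.
  have P0 : 0 < (norme p)%:R :> R by lra.
  have l0 := lnN_ge0 R p.
  rewrite big_ltn ?ltnS //; apply: lerD.
    rewrite !expr1 /exceptional; case: ifPn => [_|hb].
      by rewrite mulr0 mul0r addr_ge0 //; case: ifP => _ //; rewrite divr_ge0 // ltW.
    rewrite mulr1; move: hb; rewrite (introT (asboolP _) hp) /=.
    case: (boolP (prime (norme p))) => hpr /=.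
      rewrite -leqNgt => ->; apply: le_trans (_ : lnN p <= _).
        by rewrite ler_pdivrMr // ler_peMr //; lra.
      by rewrite lerDl; case: ifP => _ //; rewrite divr_ge0 // ltW.
    move=> _; case: (prime_norm_or_real hp pp) => [h|->]; first by rewrite h in hpr.
    by rewrite eqxx lerDr; case: ifP.
  have y0 : 0 <= ((norme p)%:R : R)^-1 by rewrite invr_ge0 ltW.
  have y2 : ((norme p)%:R : R)^-1 <= 1 / 2 by rewrite div1r lef_pV2 ?posrE.
  apply: le_trans (_ : lnN p * \sum_(2 <= m < X.+1) ((norme p)%:R : R)^-1 ^+ m <= _).
    rewrite mulr_sumr; apply: ler_sum => m _; rewrite exprVn ler_wpM2r ?invr_ge0 ?exprn_ge0 ?(ltW P0) //.
    by rewrite ler_piMr // /exceptional; case: ifP.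
  by have := ler_wpM2l l0 (geometric_tail X y0 y2); rewrite exprVn; lra.
rewrite 2!big_split /=.
have sub (f : eis -> R) : (forall x, 0 <= f x) -> \sum_(p <- disk_primes X) f p <= \sum_(p <- disk X) f p.
  move=> f0; rewrite /disk_primes big_filter.
  by rewrite [leRHS](bigID (fun p => `[< prime_eis p >])) /= lerDl sumr_ge0.
apply: lerD; first apply: lerD.
- apply: le_trans (sub _ _) _ => [x|]; first by case: ifP; rewrite ?lnN_ge0.
  rewrite -big_mkcond -big_filter; apply: le_trans (_ : \sum_(x <- disk N | (norme x <= X)%N) lnN x <= _).
    rewrite -[leRHS]big_filter le_eqVlt; apply/orP; left; apply/eqP.
    apply/perm_big/uniq_perm => [||x]; [by rewrite filter_uniq // disk_uniq.. |].
    by rewrite mem_filter mem_disk mem_filter mem_disk; case: (primary x); rewrite ?andbF //= andbC.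
  by rewrite [leRHS](bigID (fun p => (norme p <= X)%N)) /= lerDl sumr_ge0 // => x _; rewrite lnN_ge0.
- apply: le_trans (sub _ _) (sum_lnN_real X) => x.
  by case: ifP => // _; rewrite divr_ge0 ?lnN_ge0.
rewrite -mulr_sumr ler_pM2l //; apply: le_trans (sub _ _) (hB X) => x.
by rewrite divr_ge0 ?exprn_ge0 ?lnN_ge0.
Qed.

End Sector.

(** * The kernel |u + z|^(2n) and primes in sectors *)

Lemma central_binomial n : (4 ^ n <= (2 * n + 1) * 'C(2 * n, n))%N.
Proof.
elim: n => // n IH.
have e : ('C(2 * n.+1, n.+1) * n.+1 = 2 * (2 * n + 1) * 'C(2 * n, n))%N.
  have e1 := mul_bin_diag (2 * n).+2 n; have e2 := mul_bin_diag (2 * n).+1 n.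
  have e3 : 'C((2 * n).+1, n.+1) = 'C((2 * n).+1, n).
    by rewrite -bin_sub; [congr 'C(_, _); lia | lia].
  rewrite e3 /= in e1 e2.
  have -> : (2 * n.+1 = (2 * n).+2)%N by lia.
  by rewrite mulnC -e1 addn1 -mulnA e2; lia.
rewrite expnS.
have : ((2 * n.+1 + 1) * 'C(2 * n.+1, n.+1) * n.+1 >= 4 * 4 ^ n * n.+1)%N.
  by rewrite -(mulnA _ 'C(_, _)) e; nia.
by rewrite leq_pmul2r.
Qed.

Section Sector.
Variable R : realType.
Local Notation C := R[i].
Local Notation Re := (@complex.Re R).
Local Notation Im := (@complex.Im R).
Local Notation lam := (@lam R).
Local Notation lnN := (@lnN R).
Local Notation "x %:C" := (real_complex R x) : ring_scope.

Lemma bernoulli (h : R) m : 0 <= h -> 1 + m%:R * h <= (1 + h) ^+ m.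
Proof.
move=> h0; elim: m => [|m IH]; first by rewrite mul0r addr0 expr0.
rewrite exprS -natr1; have := ler_wpM2l (_ : 0 <= 1 + h) IH.
have : 0 <= m%:R * h * h by rewrite !mulr_ge0.
move=> h1 h2; have := h2 ltac:(lra); lra.
Qed.

(** Since the central binomial coefficient is at least 4^n / (2 n + 1), it suffices that (1 + h)^n >
    2 n + 1, where 4 = (4 - d) (1 + h). Taking n = 2 m squares the Bernoulli bound, which then beats
    the linear factor as soon as m h^2 > 4. *)
Lemma central_binomial_gt (d : R) : 0 < d -> d <= 1 ->
  exists n, (4 - d) ^+ n < 'C(2 * n, n)%:R.
Proof.
move=> d0 d1; pose h := d / (4 - d).
have h0 : 0 < h by rewrite divr_gt0 //; lra.
pose m := (Num.truncn (4 / h ^+ 2)).+1.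
have m0 : 4 / h ^+ 2 < m%:R by rewrite truncnS_gt.
have M0 : 0 < m%:R :> R by rewrite ltr0n.
exists (2 * m)%N.
have B := bernoulli m (ltW h0).
have E : (1 + h) ^+ (2 * m) > 4 * m%:R + 1.
  rewrite mulnC exprM; apply: lt_le_trans (_ : (1 + m%:R * h) ^+ 2 <= _); last first.
    by rewrite lerXn2r ?nnegrE // ?(le_trans _ B) // addr_ge0 // mulr_ge0 // ltW.
  have : 4 < m%:R * h ^+ 2 by rewrite -ltr_pdivrMr ?exprn_gt0.
  rewrite -(ltr_pM2l M0); have : 0 < m%:R * h by rewrite mulr_gt0.
  lra.
have q0 : 0 < (4 - d) ^+ (2 * m) by rewrite exprn_gt0 //; lra.
have e : (4 : R) = (4 - d) * (1 + h) by rewrite /h; field; lra.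
have c4 : (4 ^ (2 * m))%:R <= (2 * (2 * m) + 1)%:R * 'C(2 * (2 * m), 2 * m)%:R :> R.
  by rewrite -natrM ler_nat central_binomial.
rewrite natrX e exprMn in c4.
have n1 : (2 * (2 * m) + 1)%:R = 4 * m%:R + 1 :> R by rewrite mulnA natrD natrM.
rewrite n1 in c4; have P0 : 0 < 4 * m%:R + 1 :> R by lra.
rewrite -(ltr_pM2l P0); apply: lt_le_trans c4.
by rewrite mulrC ltr_pM2l.
Qed.

Lemma pps_Im k n : pp_rsum (fun x => Im (lam k x)) n = 0.
Proof.
rewrite -[RHS](@ppsum_lam_real R k n) /pp_rsum /ppsum.
have ImS I (r : seq I) (P : pred I) (F : I -> C) :
  Im (\sum_(i <- r | P i) F i) = \sum_(i <- r | P i) Im (F i).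
  by elim/big_rec2: _ => // i x y _ <-; rewrite ImD.
rewrite ImS; apply: eq_bigr => p _; rewrite ImS; apply: eq_bigr => m _.
by case: ifP => // _; case: (lam k _) => a b /=; rewrite mul0r addr0.
Qed.

Lemma pps_sum I (r : seq I) (F : I -> eis -> R) n :
  pp_rsum (fun x => \sum_(i <- r) F i x) n = \sum_(i <- r) pp_rsum (F i) n.
Proof.
elim: r => [|i r IH].
  by rewrite big_nil -[RHS](pps0 R n); apply: eq_pps => x _; rewrite big_nil.
by rewrite big_cons -IH -ppsD; apply: eq_pps => x _; rewrite big_cons.
Qed.

(** The distance |i - n|, by truncated subtraction. *)
Definition ndist (i n : nat) := ((n - i) + (i - n))%N.

(** On the unit circle conj(u + v) = (u + v) conj(u v), so the kernel is (u + v)^(2n) conj(u v)^n.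
    The i-th binomial term has the real part of (u conj v)^|i - n|, and the constant term is the
    central coefficient. *)
Lemma normc_add_expansion (u v : C) n : normc u = 1 -> normc v = 1 ->
  (normc (u + v) ^+ 2) ^+ n = \sum_(i < (2 * n).+1) 'C(2 * n, i)%:R *
    (Re (u ^+ ndist i n) * Re (v ^+ ndist i n) + Im (u ^+ ndist i n) * Im (v ^+ ndist i n)).
Proof.
move=> u1 v1.
have cj (z : C) : z * conjc z = (normc z ^+ 2)%:C.
  by rewrite sqr_normc; case: z => a b /=; congr Complex; ring.
have uu : u * conjc u = 1 by rewrite cj u1 expr1n.
have vv : v * conjc v = 1 by rewrite cj v1 expr1n.
have e : ((normc (u + v) ^+ 2) ^+ n)%:C = (u + v) ^+ (2 * n) * (conjc u * conjc v) ^+ n.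
  rewrite rmorphXn /= -cj rmorphD /=.
  have -> : conjc u + conjc v = (u + v) * (conjc u * conjc v).
    transitivity (u * conjc u * conjc v + v * conjc v * conjc u); last by ring.
    by rewrite uu vv; ring.
  by rewrite mulrA -expr2 exprMn exprM.
transitivity (Re ((normc (u + v) ^+ 2) ^+ n)%:C); first by [].
rewrite e exprDn mulr_suml Re_sum; apply: eq_bigr => i _.
rewrite [_ * (_ * _) ^+ n]mulrnAl; have -> k (z : C) : Re (z *+ k) = k%:R * Re z.
  by elim: k => [|k IH]; rewrite ?mulr0n ?mul0r // mulrS ReD IH -natr1; ring.
congr (_ * _); have hi := ltn_ord i.
have [ni|ni] := leqP i n.
  have -> : ndist i n = (n - i)%N by rewrite /ndist; lia.
  have -> : u ^+ (2 * n - i) * v ^+ i * (conjc u * conjc v) ^+ n =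
     u ^+ (n - i) * conjc v ^+ (n - i) * ((u * conjc u) ^+ n * (v * conjc v) ^+ i).
    have -> : (2 * n - i = (n - i) + n)%N by lia.
    have e1 : conjc v ^+ n = conjc v ^+ (n - i) * conjc v ^+ i by rewrite -exprD subnK.
    by rewrite exprD !exprMn e1; ring.
  rewrite uu vv !expr1n !mulr1 -rmorphXn.
  by case: (u ^+ _) (v ^+ _) => a b [c d] /=; ring.
have -> : ndist i n = (i - n)%N by rewrite /ndist; lia.
have -> : u ^+ (2 * n - i) * v ^+ i * (conjc u * conjc v) ^+ n =
   conjc u ^+ (i - n) * v ^+ (i - n) * ((u * conjc u) ^+ (2 * n - i) * (v * conjc v) ^+ n).
  have e1 : conjc u ^+ n = conjc u ^+ (i - n) * conjc u ^+ (2 * n - i).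
    by rewrite -exprD; congr (_ ^+ _); lia.
  have e2 : v ^+ i = v ^+ (i - n) * v ^+ n by rewrite -exprD subnK // ltnW.
  by rewrite !exprMn e1 e2; ring.
rewrite uu vv !expr1n !mulr1 -rmorphXn.
by case: (u ^+ _) (v ^+ _) => a b [c d] /=; ring.
Qed.

Lemma bsum_asymp : exists B : nat -> R, forall k N, (0 < N)%N ->
  `|bsum R k N - (k == 0%N)%:R * ln N%:R| <= B k.
Proof.
have H k : exists B, forall N, (0 < N)%N -> `|bsum R k N - (k == 0%N)%:R * ln N%:R| <= B.
  case: k => [|k].
    by have [B hB] := bsum0 R; exists B => N /hB; rewrite mul1r.
  by have [B hB] := bsum_bounded R (ltn0Sn k); exists B => N /hB; rewrite mul0r subr0.
by have [f hf] := choice H; exists f.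
Qed.

(** If the sector contained no such prime, F - kap would be at most 0 away from the exceptional
    elements, so its weighted sum over prime powers would be bounded above, whereas its mean C(2n,
    n) - kap is positive and makes the sum grow like ln X. *)
Theorem prime_in_sector (z : C) (d : R) N : normc z = 1 -> 0 < d ->
  exists p, [/\ prime_eis p, primary p, prime (norme p), (N < norme p)%N &
    normc (unit_part R p - z) < d].
Proof.
move=> z1 d0; apply: contrapT => hno.
(* Capping the radius at 1 keeps d'^2 within the range of [central_binomial_gt]. *)
pose d' := Num.min d 1.
have d'0 : 0 < d' by rewrite lt_min d0 ltr01.
have d'1 : d' <= 1 by rewrite ge_min lexx orbT.
have d'd : d' <= d by rewrite ge_min lexx.
have d2 : d' ^+ 2 <= 1 by rewrite exprn_ile1 // ltW.
have [n hn] := central_binomial_gt (exprn_gt0 2 d'0) d2.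
set kap := (4 - d' ^+ 2) ^+ n in hn.
have kap0 : 0 <= kap by rewrite exprn_ge0 //; lra.
pose F x := (normc (unit_part R x + z) ^+ 2) ^+ n.
have [B hB] := sum_exceptional R N.
(* The parallelogram law: |u + z|^2 = 4 - |u - z|^2 for unit u and z. *)
have far x : prime_eis x -> primary x -> prime (norme x) -> (N < norme x)%N -> F x <= kap.
  move=> h1 h2 h3 h4; rewrite /F /kap lerXn2r ?nnegrE ?sqr_ge0 //; first by lra.
  have hd : d' <= normc (unit_part R x - z).
    apply: le_trans d'd _; rewrite leNgt; apply/negP => h; apply: hno; by exists x.
  have hd2 : d' ^+ 2 <= normc (unit_part R x - z) ^+ 2.
    by rewrite ler_sqr ?nnegrE ?normc_ge0 // ltW.
  have := normc_ua R (primary_neq0 h2); move/(congr1 (fun t => t ^+ 2)); rewrite expr1n sqr_normc.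
  move: z1 => /(congr1 (fun t => t ^+ 2)); rewrite expr1n sqr_normc.
  move: hd2; rewrite !sqr_normc; move: (unit_part R x) (z) => [a b] [a' b'] /=; lra.
have up x : primary x -> F x - kap <= 4 ^+ n * exceptional R N x.
  move=> px; rewrite /exceptional; case: ifPn => [|_].
    by move=> /andP[/andP[/asboolP h1 h2] h3]; rewrite mulr0 subr_le0 far.
  rewrite mulr1; apply: le_trans (_ : F x <= _); first by lra.
  have -> : (4 : R) = 2 ^+ 2 by ring.
  rewrite /F lerXn2r ?nnegrE ?sqr_ge0 // ler_sqr ?nnegrE ?normc_ge0 //.
  apply: le_trans (le_normcD _ _) _; rewrite z1 normc_ua ?primary_neq0 //; lra.
have upper X : \sum_(1 <= m < X.+1) pp_rsum (fun x => F x - kap) m / m%:R <= 4 ^+ n * B.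
  apply: le_trans (_ : 4 ^+ n * \sum_(1 <= m < X.+1) pp_rsum (exceptional R N) m / m%:R <= _).
    rewrite mulr_sumr; apply: ler_sum => m _; rewrite mulrA -ppsZ ler_wpM2r ?invr_ge0 //.
    exact: le_pps.
  by rewrite ler_wpM2l ?exprn_ge0.
have FE m : pp_rsum F m = \sum_(i < (2 * n).+1) 'C(2 * n, i)%:R * Re (z ^+ ndist i n) * bk R (ndist i n) m.
  rewrite (eq_pps (H := fun x => \sum_(i < (2 * n).+1) ('C(2 * n, i)%:R * Re (z ^+ ndist i n) * Re (lam (ndist i n) x) +
     'C(2 * n, i)%:R * Im (z ^+ ndist i n) * Im (lam (ndist i n) x)))); last first.
    move=> x px; rewrite /F normc_add_expansion ?normc_ua ?primary_neq0 //.
    by apply: eq_bigr => i _; rewrite /lam; ring.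
  rewrite pps_sum; apply: eq_bigr => i _.
  by rewrite ppsD !ppsZ pps_Im mulr0 addr0.
have [Bf hBf] := bsum_asymp.
pose c (i : 'I_(2 * n).+1) : R := 'C(2 * n, i)%:R * Re (z ^+ ndist i n).
have lower X : (0 < X)%N -> ('C(2 * n, n)%:R - kap) * ln X%:R -
    (\sum_(i < (2 * n).+1) `|c i| * Bf (ndist i n) + kap * Bf 0%N) <=
    \sum_(1 <= m < X.+1) pp_rsum (fun x => F x - kap) m / m%:R.
  move=> X0.
  have -> : \sum_(1 <= m < X.+1) pp_rsum (fun x => F x - kap) m / m%:R =
     \sum_(i < (2 * n).+1) c i * bsum R (ndist i n) X - kap * bsum R 0 X.
    have -> : \sum_(i < (2 * n).+1) c i * bsum R (ndist i n) X =
       \sum_(1 <= m < X.+1) pp_rsum F m / m%:R.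
      transitivity (\sum_(i < (2 * n).+1) \sum_(1 <= m < X.+1) c i * (bk R (ndist i n) m / m%:R)).
        by apply: eq_bigr => i _; rewrite /bsum mulr_sumr.
      rewrite exchange_big; apply: eq_bigr => m _ /=; rewrite FE mulr_suml.
      by apply: eq_bigr => i _; rewrite mulrA.
    rewrite /bsum mulr_sumr -sumrB; apply: eq_bigr => m _.
    have -> : pp_rsum (fun x => F x - kap) m = pp_rsum F m - kap * bk R 0 m.
      have -> : pp_rsum (fun x => F x - kap) m = pp_rsum (fun x => F x + - kap * Re (lam 0 x)) m.
        by apply: eq_pps => x _; have -> : lam 0 x = 1 by []; rewrite /= mulr1.
      by rewrite ppsD ppsZ mulNr.
    by ring.
  have h0 := hBf 0%N X X0; rewrite mul1r ler_norml in h0; case/andP: h0 => _ h0.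
  have {}h0 := ler_wpM2l kap0 h0.
  have h1 : 'C(2 * n, n)%:R * ln X%:R - \sum_(i < (2 * n).+1) `|c i| * Bf (ndist i n) <=
     \sum_(i < (2 * n).+1) c i * bsum R (ndist i n) X.
    have nn : (n < (2 * n).+1)%N by lia.
    (* Only i = n has frequency 0, so the logarithm appears there alone. *)
    have -> : 'C(2 * n, n)%:R * ln X%:R = \sum_(i < (2 * n).+1) c i * ((ndist i n == 0%N)%:R * ln X%:R).
      rewrite (bigD1 (Ordinal nn)) //= big1 ?addr0 => [|i /eqP hi].
        by rewrite /c /= {1 2}/ndist subnn addn0 expr0 eqxx /= !mulr1 mul1r.
      have -> : (ndist i n == 0%N) = false; last by rewrite mul0r mulr0.
      by apply/negbTE/negP => /eqP e; apply: hi; apply: val_inj => /=; move: e; rewrite /ndist; lia.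
    rewrite -sumrB; apply: ler_sum => i _.
    have := hBf (ndist i n) X X0; set u := bsum _ _ _; set v := _ * ln _ => huv.
    have := ler_wpM2l (normr_ge0 (c i)) huv; rewrite -normrM ler_norml => /andP[h _].
    by move: h; rewrite mulrBr; lra.
  lra.
set D := \sum_(i < (2 * n).+1) `|c i| * Bf (ndist i n) + kap * Bf 0%N in lower.
have gap : 0 < 'C(2 * n, n)%:R - kap by rewrite subr_gt0.
have [X X0 hX] := ln_unbounded ((4 ^+ n * B + D) / ('C(2 * n, n)%:R - kap)).
rewrite ltr_pdivrMr // in hX.
have := lower X X0; have := upper X; lra.
Qed.

End Sector.

Theorem mainTheorem1 :
  (forall p : nat, prime p -> (2 < p)%N ->
     A2 p = (p%:Z) ^+ 2 - (n32 p)%:Z * p%:Z - 1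
            + p%:Z * \sum_(x < p) legendre p (4 * (x%:Z) ^+ 3 + 1))
  /\
  (forall (R : realType) (a b : R), -2 <= a -> a < b -> b <= 2 ->
     forall N : nat, exists p : nat,
       [/\ (N < p)%N, prime p, (p %% 3 = 1)%N &
         let d : R := (A2 p - ((p%:Z) ^+ 2 - (n32 p)%:Z * p%:Z - 1))%:~R in
         let s : R := p%:R * Num.sqrt (p%:R) in
         a * s <= d /\ d <= b * s]).
Proof.
split; first exact: second_moment.
move=> R a b ha ab hb N.
(* The quotient d / s will be - 2 Re u, with u the unit part of w. The target z is therefore a point
   of the unit circle with real part - m / 2, for m the midpoint of the interval. *)
pose m := (a + b) / 2.
pose z : R[i] := Complex (- m / 2) (Num.sqrt (1 - m ^+ 2 / 4)).
have z1 : ComplexField.Normc.normc z = 1.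
  rewrite /z /= sqr_sqrtr; last first.
    have : 0 <= (2 - m) * (2 + m) by rewrite /m mulr_ge0 //; lra.
    lra.
  rewrite (_ : (- m / 2) ^+ 2 + _ = 1) ?sqrtr1 //; by field.
(* Doubling the radius (b - a) / 4 gives the half-length of the interval. *)
have d0 : 0 < (b - a) / 4 by lra.
have [w [hw pw pr big close]] := @prime_in_sector R z _ (maxn N 3) z1 d0.
set p := norme w in pr big.
have Np : (N < p)%N by rewrite (leq_ltn_trans _ big) // leq_maxl.
have p2 : (2 < p)%N by rewrite ltnW // (leq_ltn_trans _ big) // leq_maxr.
exists p; split=> //; first exact: norme_primary_mod3.
rewrite second_moment // addrAC subrr add0r sum_legendre_curve //.
rewrite (Ssum_primary pr p2 pw erefl) rmorphM /= -pmulrn.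
have p0 : 0 < p%:R :> R by rewrite ltr0n prime_gt0.
have s0 : 0 < Num.sqrt p%:R :> R by rewrite sqrtr_gt0.
rewrite !(mulrCA _ (p%:R)) !ler_pM2l //.
(* The real part of the embedding of w is [ere w - eim w / 2], and its modulus is sqrt p. *)
have -> : (eim w - 2 * ere w)%:~R = - 2 * complex.Re (unit_part R w) * Num.sqrt p%:R.
  have -> : complex.Re (unit_part R w) = complex.Re (emb R w) / Num.sqrt p%:R.
    by rewrite /unit_part mulrC -fmorphV ReM_real mulrC.
  rewrite /emb /= rmorphB rmorphM /=; field.
  by rewrite gt_eqF.
rewrite !ler_pM2r //.
have := Re_le_normc (unit_part R w - z); rewrite ReD ReN => /le_lt_trans /(_ close).
rewrite ltr_norml /z /= /m => /andP[h1 h2]; split; lra.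
Qed.
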